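(* Let $K_+=\{\nu\in\mathbb{R}^n:\nu_i\ge0,\ i=1,\dots,n\}$, and consider the likelihood ratio test of $H_0:\mu=\mu_0$ versus $H_1:\mu\in K_+$, with $\mu_0\in K_+$. (1) There exists a universal constant $C>0$ such that for $\mu_0\in K_+$, under $Y=\mu_0+\xi$, $$d_{\mathrm{TV}}\left(\frac{T(Y)-m_{\mu_0}}{\sigma_{\mu_0}},\mathcal{N}(0,1)\right)\le\frac{C}{\sqrt n}.$$ Consequently $\mathbb{E}_{\mu_0}\Psi_{\mathrm{ts}}(Y;m_{\mu_0},\sigma_{\mu_0})=\alpha+\mathcal{O}(n^{-1/2})$. (2) For any $\mu\in K_+$, $\mathbb{E}_\mu\Psi_{\mathrm{ts}}(Y;m_{\mu_0},\sigma_{\mu_0})\to1$ as $n\to\infty$ if and only if $$\left|\sum_{i=1}^n\left\{\bar S_+(\mu_i)-\bar S_+((\mu_0)_i)\right\}+\|\mu-\mu_0\|^2\right|\gg n^{1/2}.$$ Here $\bar S_+$, defined by $$\bar S_+(x)=\Phi(x)+x\varphi(x)-x^2(1-\Phi(x))-\tfrac12,\qquad x\ge0,$$ is an increasing, concave and bounded function on $[0,\infty)$ with $\bar S_+(0)=0$.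
   Context: Model: $Y=\mu+\xi$, $\xi$ standard Gaussian in $\mathbb{R}^n$; $\mathbb{E}_\mu,\mathrm{Var}_\mu$ refer to mean $\mu$; $\|\cdot\|$ Euclidean norm. With $K=K_+$ and $\Pi_K$ the metric projection onto $K$, $T(Y)=\|Y-\mu_0\|^2-\|Y-\Pi_K(Y)\|^2$, $m_\mu=\mathbb{E}_\mu T(Y)$, $\sigma_\mu^2=\mathrm{Var}_\mu(T(Y))$. For fixed $\alpha\in(0,1)$, the two-sided test is $\Psi_{\mathrm{ts}}(Y;m_{\mu_0},\sigma_{\mu_0})=\mathbf{1}\big(|T(Y)-m_{\mu_0}|/\sigma_{\mu_0}>z_{\alpha/2}\big)$, where $\mathbb{P}(\mathcal{N}(0,1)\ge z_{\alpha})=\alpha$. $\varphi,\Phi$ are the standard normal density and distribution function. $d_{\mathrm{TV}}$ is total variation distance, $\sup_B|\mathbb{P}(X\in B)-\mathbb{P}(Z\in B)|$. Asymptotics are as $n\to\infty$; $\mu_0,\mu$ are sequences depending on $n$. For nonnegative sequences $a_n\gg b_n$ means $a_n/b_n\to\infty$. *)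

(* Defs.v *)
From HB Require Import structures.
From mathcomp Require Import all_boot all_order all_algebra.
From mathcomp Require Import all_classical all_reals all_analysis.

Set Implicit Arguments.
Unset Strict Implicit.
Unset Printing Implicit Defensive.

Import Order.TTheory GRing.Theory Num.Theory.
Import numFieldNormedType.Exports.

Local Open Scope classical_set_scope.
Local Open Scope ring_scope.

(* The library norm on matrices is the sup norm, hence this definition. *)
Definition enorm (R : realType) (n : nat) (x : 'rV[R]_n) : R :=
  Num.sqrt (\sum_(i < n) x 0 i ^+ 2).

Definition orthant (R : realType) (n : nat) : set 'rV[R]_n :=
  [set nu | forall i, 0 <= nu 0 i].
Arguments orthant : clear implicits.

(* Metric projection onto K: a minimizer over K of the distance to y (unique
   when K is nonempty, closed and convex). *)
Definition metric_proj (R : realType) (n : nat) (K : set 'rV[R]_n)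
    (y : 'rV[R]_n) : 'rV[R]_n :=
  xget 0 [set p | K p /\ forall q, K q -> enorm (y - p) <= enorm (y - q)].

(* The log-likelihood ratio statistic for mu = mu0 versus mu in K. *)
Definition lrt (R : realType) (n : nat) (K : set 'rV[R]_n)
    (mu0 y : 'rV[R]_n) : R :=
  enorm (y - mu0) ^+ 2 - enorm (y - metric_proj K y) ^+ 2.

Definition T_plus (R : realType) (n : nat) (mu0 y : 'rV[R]_n) : R :=
  lrt (orthant R n) mu0 y.

Definition mutually_independent (R : realType) (d : measure_display)
    (Omega : measurableType d) (P : probability Omega R) (I : finType)
    (X : I -> {RV P >-> R}) : Prop :=
  forall (J : {set I}) (B : I -> set R), (forall i, measurable (B i)) ->
    P (\bigcap_(i in [set` J]) (X i @^-1` B i)) =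
    (\prod_(i in J) P (X i @^-1` B i))%E.

(* The random vector with coordinates xi is standard Gaussian in R^n. *)
Definition std_gaussian (R : realType) (d : measure_display)
    (Omega : measurableType d) (P : probability Omega R) (n : nat)
    (xi : 'I_n -> {RV P >-> R}) : Prop :=
  mutually_independent xi /\
  forall (i : 'I_n) (B : set R), measurable B ->
    distribution P (xi i) B = normal_prob 0 1 B.

Definition obs (R : realType) (d : measure_display)
    (Omega : measurableType d) (P : probability Omega R) (n : nat)
    (xi : 'I_n -> {RV P >-> R}) (mu : 'rV[R]_n) (w : Omega) : 'rV[R]_n :=
  mu + \row_(i < n) xi i w.

(* Mean m_mu and standard deviation sigma_mu of T(Y) under Y = mu + xi; the
   statistic T itself is always built from mu0. *)
Definition mean_T (R : realType) (d : measure_display)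
    (Omega : measurableType d) (P : probability Omega R) (n : nat)
    (xi : 'I_n -> {RV P >-> R}) (mu0 mu : 'rV[R]_n) : R :=
  fine 'E_P[fun w => T_plus mu0 (obs xi mu w)].

Definition sd_T (R : realType) (d : measure_display)
    (Omega : measurableType d) (P : probability Omega R) (n : nat)
    (xi : 'I_n -> {RV P >-> R}) (mu0 mu : 'rV[R]_n) : R :=
  Num.sqrt (fine 'V_P[fun w => T_plus mu0 (obs xi mu w)]).

(* The z such that P(N(0,1) >= z) = a; it exists and is unique for
   0 < a < 1. *)
Definition z_ (R : realType) (a : R) : R :=
  xget 0 [set z : R | normal_prob 0 1 `[z, +oo[%classic = a%:E].

Definition Psi_ts (R : realType) (n : nat) (alpha : R) (mu0 : 'rV[R]_n)
    (m sigma : R) (y : 'rV[R]_n) : R :=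
  (z_ (alpha / 2) < `|T_plus mu0 y - m| / sigma)%R%:R.

(* E_mu Psi_ts(Y; m_mu0, sigma_mu0) *)
Definition power_ts (R : realType) (d : measure_display)
    (Omega : measurableType d) (P : probability Omega R) (n : nat)
    (xi : 'I_n -> {RV P >-> R}) (alpha : R) (mu0 mu : 'rV[R]_n) : \bar R :=
  'E_P[fun w => Psi_ts alpha mu0 (mean_T xi mu0 mu0) (sd_T xi mu0 mu0)
                  (obs xi mu w)].

Definition dTV (R : realType) (P Q : set R -> \bar R) : \bar R :=
  ereal_sup [set `|P B - Q B|%E | B in measurable].

Definition std_normal_cdf (R : realType) (x : R) : R :=
  fine (normal_prob 0 1 `]-oo, x]%classic).

Definition Splus (R : realType) (x : R) : R :=
  std_normal_cdf x + x * normal_pdf 0 1 x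
    - x ^+ 2 * (1 - std_normal_cdf x) - 2^-1.

(* Main.v *)
Require Import Defs.
From HB Require Import structures.
From mathcomp Require Import all_boot all_order all_algebra.
From mathcomp Require Import all_classical all_reals all_analysis.
From mathcomp Require Import measurable_realfun ring lra.

(** The statistic is a sum of functions of the independent noise coordinates:
    with [a = mu i] and [d = mu i - mu0 i], projecting onto the orthant
    coordinatewise gives the summand [(x + d)^2 - (min (a + x, 0))^2] at noise
    [x]. Its mean is [Splus a + 1/2 + d^2], because
    [Splus a = 1/2 - E (min (a + x, 0))^2]; so the quantity in the power
    characterization is the displacement of the mean of the statistic between
    null and alternative. The same formula shows that [Splus] is increasing,
    concave and bounded.

    Normal approximation. A plain central limit theorem does not control
    total variation; Stein's method does, since the summands are
    continuously differentiable functions of Gaussian variables. Let [k] be a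
    centered summand and let [g] solve [g' = x g - k]. Gaussian integration by
    parts gives [E (k u) = E (g u')] for smooth [u] ([stein_kernel]), so the
    product [t = g k'] is a Stein kernel, of mean the variance of [k]. Freezing
    the other coordinates and summing, the standardized sum [W] of variance
    [V] before standardization satisfies
    [E (W F (W)) = E (F' (W) (sum of the t) / V)] ([stein_discrepancy]). For [F]
    the Stein solution of a test function with values in [[0, 1]], both [F] and
    [F'] are bounded by a universal constant ([stein_sol_bounded]), hence the
    error of the normal approximation is at most a constant times the standard
    deviation of the sum of the kernels divided by [V]. Two estimates, uniform
    in [a >= 0], conclude: the variance of a summand is at least [1/2]
    ([centered_var_ge]), and that of a kernel is at most a constant times
    [1 + d^2] ([stein_kernel_coord_var]). The error is therefore
    [O (sqrt (n + |mu - mu0|^2) / n)], in particular [O (n^(-1/2))] under the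
    null. The Stein solution is only differentiated for continuous tests;
    Borel sets are reached by approximation in mean for both laws
    ([probability_test_le]).

    Power. Let [D] be the displacement. As [Splus] is bounded,
    [|mu - mu0|^2 <= |D| + n]. If [|D|] is a large multiple of [sqrt n],
    Chebyshev's inequality under the alternative, where the variance is
    [O (n + |D|)], makes acceptance improbable. If [|D| <= A sqrt n], then
    [|mu - mu0|^2 = O (n)], the normal approximation holds under the
    alternative too, and in standard units the acceptance region contains an
    interval of length bounded below at bounded distance from the origin
    ([accept_lower]): the power stays away from one. *)

Import Order.TTheory GRing.Theory Num.Theory.
Import numFieldNormedType.Exports.

Local Open Scope classical_set_scope.
Local Open Scope ring_scope.

(** * Gaussian integrals *)

Section gauss_density.
Context {R : realType}.
Local Notation leb := (@lebesgue_measure R).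
Local Notation gam := (@normal_prob R 0 1).
Local Notation phi := (@normal_pdf R 0 1).

Lemma phiE (x : R) : phi x = normal_peak 1 * expR (- (x ^+ 2 / 2)).
Proof.
rewrite normal_pdfE ?oner_neq0// /normal_fun subr0 expr1n; congr (_ * expR _).
by rewrite mulNr.
Qed.

Lemma phi_gt0 (x : R) : 0 < phi x.
Proof. by rewrite phiE mulr_gt0 ?expR_gt0// normal_peak_gt0// oner_neq0. Qed.

Lemma continuous_phi : continuous phi.
Proof. by apply: continuous_normal_pdf; rewrite oner_neq0. Qed.

Lemma phiN (x : R) : phi (- x) = phi x.
Proof. by rewrite !phiE sqrrN. Qed.

Lemma is_derive_phi (x : R) : is_derive x (1 : R) phi (- x * phi x).
Proof.
have -> : phi = (fun x => normal_peak 1 * expR (- (x ^+ 2 / 2))).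
  by apply/funext => y; rewrite phiE.
apply: is_derive_eq.
by rewrite /= !scaler1 /GRing.scale/=; field.
Qed.

(** The Gaussian law is given as an integral of its density over sets; integrals
    of functions against it are transported by identifying the abstract
    Radon-Nikodym derivative with [phi]. *)
Lemma gauss_density_ae :
  ae_eq leb setT (Radon_Nikodym_SigmaFinite.f gam leb) (EFin \o phi).
Proof.
have dom := @normal_prob_dominates R 0 1.
apply: integral_ae_eq => //.
- exact: Radon_Nikodym_SigmaFinite.f_integrable.
- by apply/measurable_EFinP; exact: measurable_normal_pdf.
- by move=> E _ mE; rewrite -Radon_Nikodym_SigmaFinite.f_integral.
Qed.

Lemma ge0_integral_gauss (f : R -> \bar R) : (forall x, 0 <= f x)%E ->
  measurable_fun setT f ->
  (\int[gam]_x f x = \int[leb]_x (f x * (phi x)%:E))%E.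
Proof.
move=> f0 mf; have dom := @normal_prob_dominates R 0 1.
rewrite -(Radon_Nikodym_SigmaFinite.change_of_variables dom)//.
apply: ae_eq_integral => //.
- apply: emeasurable_funM => //.
  by apply: measurable_int; exact: Radon_Nikodym_SigmaFinite.f_integrable.
- apply: emeasurable_funM => //.
  by apply/measurable_EFinP; exact: measurable_normal_pdf.
- by have := gauss_density_ae; apply: filterS => x h _ /=; rewrite h.
Qed.

Lemma integrable_gaussP (f : R -> R) : measurable_fun setT f ->
  gam.-integrable setT (EFin \o f) <->
  leb.-integrable setT (fun x => (f x * phi x)%:E).
Proof.
move=> mf.
have mphi : measurable_fun setT phi by exact: measurable_normal_pdf.
have eqn : (\int[gam]_x `|(f x)%:E| = \int[leb]_x `|(f x * phi x)%:E|)%E.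
  rewrite ge0_integral_gauss//.
    apply: eq_integral => x _.
    by rewrite EFinM abseM (@gee0_abs _ (phi x)%:E)// lee_fin ltW// phi_gt0.
  by do 2 apply: measurableT_comp => //.
split=> /integrableP[_ h]; apply/integrableP; split.
- by apply/measurable_EFinP; exact: measurable_funM.
- by rewrite -eqn.
- exact/measurable_EFinP.
- by rewrite eqn.
Qed.

Lemma Rintegral_gauss (f : R -> R) : measurable_fun setT f ->
  gam.-integrable setT (EFin \o f) ->
  \int[gam]_x f x = \int[leb]_x (f x * phi x).
Proof.
move=> mf gf; rewrite /Rintegral; congr fine.
have mphi : measurable_fun setT phi by exact: measurable_normal_pdf.
rewrite [LHS]integralE [RHS]integralE !ge0_integral_gauss//.
- congr (_ - _)%E; apply: eq_integral => x _.
  + rewrite !funeposE -EFin_max -EFinM maxr_pMl ?mul0r ?ltW ?phi_gt0//.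
    by rewrite EFin_max.
  + rewrite !funenegE -EFin_max -EFinM maxr_pMl ?mul0r ?mulNr ?ltW ?phi_gt0//.
    by rewrite EFin_max.
- by apply: measurable_funeneg; apply/measurable_EFinP.
- by apply: measurable_funepos; apply/measurable_EFinP.
Qed.

End gauss_density.

Section gauss_calculus.
Context {R : realType}.
Local Notation leb := (@lebesgue_measure R).
Local Notation gam := (@normal_prob R 0 1).
Local Notation phi := (@normal_pdf R 0 1).

(** All functions of one coordinate met below grow at most polynomially; this
    class is stable under the algebraic operations and its members are
    integrable against the Gaussian law. *)
Definition poly_growth (f : R -> R) :=
  exists (c : R) (k : nat), forall x, `|f x| <= c * (1 + `|x|) ^+ k.

Lemma poly_growthP (f : R -> R) : poly_growth f ->
  exists (c : R) (k : nat), 0 <= c /\ forall x, `|f x| <= c * (1 + `|x|) ^+ k.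
Proof.
move=> [c [k h]]; exists `|c|, k; split=> // x.
by apply: (le_trans (h x)); rewrite ler_wpM2r ?ler_norm// exprn_ge0// addr_ge0.
Qed.

Lemma poly_growth_bounded (f : R -> R) c : (forall x, `|f x| <= c) ->
  poly_growth f.
Proof. by move=> h; exists c, 0%N => x; rewrite expr0 mulr1. Qed.

Lemma poly_growth_cst (c : R) : poly_growth (fun=> c).
Proof. exact: (@poly_growth_bounded _ `|c|). Qed.

Lemma poly_growth_id : poly_growth id.
Proof. by exists 1, 1%N => x; rewrite mul1r expr1 lerDr. Qed.

Lemma poly_growthD (f g : R -> R) : poly_growth f -> poly_growth g ->
  poly_growth (fun x => f x + g x).
Proof.
move=> /poly_growthP[c [k [c0 hf]]] /poly_growthP[d [l [d0 hg]]].
exists (c + d), (k + l)%N => x; apply: (le_trans (ler_normD _ _)).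
have w1 : 1 <= 1 + `|x| by rewrite lerDl.
rewrite mulrDl lerD//.
  by apply: (le_trans (hf x)); rewrite ler_wpM2l// ler_weXn2l ?leq_addr.
by apply: (le_trans (hg x)); rewrite ler_wpM2l// ler_weXn2l ?leq_addl.
Qed.

Lemma poly_growthM (f g : R -> R) : poly_growth f -> poly_growth g ->
  poly_growth (fun x => f x * g x).
Proof.
move=> /poly_growthP[c [k [c0 hf]]] /poly_growthP[d [l [d0 hg]]].
exists (c * d), (k + l)%N => x; rewrite normrM exprD mulrACA.
by rewrite ler_pM.
Qed.

Lemma poly_growthN (f : R -> R) : poly_growth f -> poly_growth (fun x => - f x).
Proof. by move=> [c [k h]]; exists c, k => x; rewrite normrN. Qed.

Lemma poly_growthX (f : R -> R) n : poly_growth f ->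
  poly_growth (fun x => f x ^+ n).
Proof.
move=> hf; elim: n => [|n ih].
  by under eq_fun do rewrite expr0; exact: poly_growth_cst.
by under eq_fun do rewrite exprS; exact: poly_growthM.
Qed.

Lemma poly_growth_le (f g : R -> R) : (forall x, `|f x| <= `|g x|) ->
  poly_growth g -> poly_growth f.
Proof. by move=> h [c [k hg]]; exists c, k => x; exact: le_trans (hg x). Qed.

(** Half of the exponent of the density absorbs the polynomial, by way of
    [(1 + x)^k <= C exp x]; what is left is still integrable. *)
Lemma poly_phi_le (c : R) k (x : R) : 0 <= c ->
  c * (1 + `|x|) ^+ k * expR (- (x ^+ 2 / 2)) <=
  c * k.+1%:R ^+ k * expR 1 * expR (- (x ^+ 2 / 8)).
Proof.
move=> c0; rewrite -!(mulrA c) ler_wpM2l//.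
have k0 : (0 : R) < k.+1%:R by rewrite ltr0n.
have x0 := normr_ge0 x.
have h : 1 + `|x| <= k.+1%:R * expR (`|x| / k.+1%:R).
  rewrite -ler_pdivrMl// (le_trans _ (expR_ge1Dx _))// mulrDr mulr1.
  by rewrite mulrC lerD2r invf_le1// ler1n.
have h2 : (1 + `|x|) ^+ k <= k.+1%:R ^+ k * expR `|x|.
  apply: (@le_trans _ _ ((k.+1%:R * expR (`|x| / k.+1%:R)) ^+ k)).
    by rewrite lerXn2r// nnegrE ?addr_ge0// mulr_ge0 ?expR_ge0 ?ltW.
  rewrite exprMn ler_wpM2l ?exprn_ge0//.
  rewrite -expRM_natr ler_expR -mulrA ler_piMr// mulrC.
  by rewrite ler_pdivrMr// mul1r ler_nat.
apply: (le_trans (ler_wpM2r (expR_ge0 _) h2)).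
rewrite -!(mulrA (_ ^+ _)) ler_wpM2l ?exprn_ge0//.
rewrite -!expRD ler_expR.
rewrite -(real_normK (num_real x)).
have := sqr_ge0 (`|x| - 4 / 3); lra.
Qed.

(** The quantitative form in which boundary terms of integrations by parts
    vanish at both infinities. *)
Lemma poly_growth_vanish (v : R -> R) : poly_growth v ->
  exists C, forall x, `|v x * phi x| <= C / (1 + x ^+ 2).
Proof.
move=> /poly_growthP[c [k [c0 hv]]].
exists (normal_peak 1 * (c * k.+1%:R ^+ k * expR 1 * 8)) => x.
have p0 : 0 <= normal_peak (1 : R) by exact: normal_peak_ge0.
have x0 := sqr_ge0 x.
have m0 : 0 <= c * k.+1%:R ^+ k * expR 1.
  by rewrite mulr_ge0 ?expR_ge0// mulr_ge0// exprn_ge0.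
rewrite normrM (ger0_norm (ltW (phi_gt0 _))) phiE mulrCA -[leRHS]mulrA.
rewrite ler_wpM2l//.
apply: (le_trans (ler_wpM2r (expR_ge0 _) (hv x))).
apply: (le_trans (poly_phi_le _ _ _ c0)).
rewrite -[leRHS]mulrA ler_wpM2l// ler_pdivlMr; last by lra.
rewrite expRN mulrC ler_pdivrMr ?expR_gt0//.
have := expR_ge1Dx (x ^+ 2 / 8); lra.
Qed.

Lemma integrable_poly_growth (f : R -> R) :
  measurable_fun setT f -> poly_growth f -> gam.-integrable setT (EFin \o f).
Proof.
move=> mf /poly_growthP[c [k [c0 hf]]]; apply/integrable_gaussP => //.
have mphi : measurable_fun setT phi by exact: measurable_normal_pdf.
pose m := c * k.+1%:R ^+ k * expR 1.
have m0 : 0 <= m.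
  by rewrite mulr_ge0 ?expR_ge0// mulr_ge0// exprn_ge0.
have p1 : 0 < normal_peak (1 : R) by rewrite normal_peak_gt0// oner_neq0.
have p2 : 0 < normal_peak (2 : R) by rewrite normal_peak_gt0//.
have i2 : leb.-integrable setT
    (fun x => (normal_peak 1 * (m / normal_peak 2) * normal_pdf 0 2 x)%:E).
  under eq_fun do rewrite EFinM.
  by apply: integrableZl => //; exact: integrable_normal_pdf.
apply: (le_integrable _ _ _ i2) => //.
  by apply/measurable_EFinP; exact: measurable_funM.
move=> x _; rewrite lee_fin.
rewrite [leRHS]ger0_norm; last first.
  by rewrite mulr_ge0 ?normal_pdf_ge0// mulr_ge0 ?divr_ge0// ltW.
rewrite normrM (ger0_norm (ltW (phi_gt0 _))) phiE normal_pdfE//.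
rewrite mulrCA -[leRHS]mulrA ler_wpM2l//; first exact: ltW.
apply: (le_trans (ler_wpM2r (expR_ge0 _) (hf x))).
apply: (le_trans (poly_phi_le _ _ _ c0)).
have -> : normal_fun 0 2 x = expR (- (x ^+ 2 / 8)).
  by rewrite /normal_fun subr0 mulNr; congr expR; field.
by rewrite mulrA divfK// gt_eqF.
Qed.

Lemma cvg_integral_itvNn (f : R -> R) : leb.-integrable setT (EFin \o f) ->
  (\int[leb]_(x in `[(- n%:R)%R, n%:R%R]) (f x)%:E)%E @[n --> \oo] -->
  (\int[leb]_x (f x)%:E)%E.
Proof.
move=> intf; have mf : measurable_fun setT f.
  by move: intf => /integrableP[/measurable_EFinP].
under eq_fun do rewrite integral_mkcond.
apply: (@dominated_cvg _ _ _ leb setT measurableT _ _ (abse \o (EFin \o f))).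
- move=> n; apply/(measurable_restrictT _ _).1 => //.
  exact/measurable_funTS/measurable_EFinP.
- move=> x _; apply: cvg_near_cst; near=> n.
  rewrite patchE mem_set//= in_itv/= -ler_norml.
  by near: n; exact: nbhs_infty_ger.
- by [].
- exact: integrable_abse.
- move=> n x _; rewrite patchE; case: ifP => // _.
  by rewrite abse0 abse_ge0.
Unshelve. all: by end_near. Qed.

(** The fundamental theorem of calculus on the whole line, obtained by
    exhausting it with the segments [[-n, n]]. *)
Lemma Rintegral_derive (V V' : R -> R) (l1 l2 : R) :
  (forall x, is_derive x (1 : R) V (V' x)) -> continuous V' ->
  leb.-integrable setT (EFin \o V') ->
  V n%:R @[n --> \oo] --> l1 -> V (- n%:R) @[n --> \oo] --> l2 ->
  \int[leb]_x V' x = l1 - l2.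
Proof.
move=> dV cV' iV' h1 h2; rewrite /Rintegral.
have c1 := cvg_integral_itvNn _ iV'.
have c2 : (\int[leb]_(x in `[(- n%:R)%R, n%:R%R]) (V' x)%:E)%E @[n --> \oo] -->
    (l1 - l2)%:E.
  have : (V n%:R - V (- n%:R))%:E @[n --> \oo] --> (l1 - l2)%:E.
    by apply: cvg_EFin; [exact: nearW|exact: cvgB].
  apply: cvg_trans; apply: near_eq_cvg; near=> n.
  have n0 : (0 : R) < n%:R by rewrite ltr0n; near: n; exact: nbhs_infty_gt.
  rewrite (@continuous_FTC2 _ V' V) ?EFinB//.
  - by rewrite -subr_gt0 opprK addr_gt0.
  - exact: continuous_subspaceT.
  - have dif x : derivable V x 1 by have [] := dV x.
    have cV : continuous V by move=> x; exact/differentiable_continuous/derivable1_diffP.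
    split => //.
    + by apply: cvg_at_right_filter; exact: cV.
    + by apply: cvg_at_left_filter; exact: cV.
  - by move=> x _; rewrite derive1E; apply: derive_val.
by rewrite (cvg_unique _ c1 c2).
Unshelve. all: by end_near. Qed.

Lemma is_derive_continuous (f f' : R -> R) :
  (forall x, is_derive x (1 : R) f (f' x)) -> continuous f.
Proof.
move=> df x; apply/differentiable_continuous/derivable1_diffP.
by have [] := df x.
Qed.

Lemma continuous_measurable (f : R -> R) : continuous f -> measurable_fun setT f.
Proof. exact: continuous_measurable_fun. Qed.

Lemma continuous_Mphi (f : R -> R) : continuous f ->
  continuous (fun x => f x * phi x).
Proof. by move=> cf x; apply: cvgM; [exact: cf|exact: continuous_phi]. Qed.

Lemma cvg_le_inv (V : R -> R) (C : R) : (forall x, `|V x| <= C / (1 + x ^+ 2)) ->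
  (V n%:R @[n --> \oo] --> 0) * (V (- n%:R) @[n --> \oo] --> 0).
Proof.
have H (W : R -> R) : (forall x, `|W x| <= C / (1 + x ^+ 2)) ->
    W n%:R @[n --> \oo] --> 0.
  move=> hW; apply/cvgr0Pnorm_le => e e0; near=> n.
  apply: (le_trans (hW _)).
  have n0 : (0 : R) <= n%:R by [].
  have hn : `|C| / e <= n%:R by near: n; exact: nbhs_infty_ger.
  have hn1 : (1 : R) <= n%:R by near: n; exact: nbhs_infty_ger.
  rewrite ler_pdivrMr; last by have := sqr_ge0 (n%:R : R); lra.
  move: hn; rewrite ler_pdivrMr// => hn.
  apply: (le_trans (ler_norm _)); apply: (le_trans hn).
  by rewrite mulrC ler_wpM2l ?(ltW e0)//; nra.
move=> hV; split; first exact: H.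
apply: (H (V \o -%R)) => x /=.
by have := hV (- x); rewrite sqrrN.
Unshelve. all: by end_near. Qed.

(** Stein's identity: the derivative of [v * phi] is [(v' - x v) * phi], and
    the growth of [v] kills the boundary terms. *)
Lemma gauss_ibp (v v' : R -> R) : (forall x, is_derive x (1 : R) v (v' x)) ->
  continuous v' -> poly_growth v -> poly_growth v' ->
  \int[gam]_x v' x = \int[gam]_x (x * v x).
Proof.
move=> dv cv' gv gv'.
have cv := is_derive_continuous _ _ dv.
have mv := continuous_measurable _ cv; have mv' := continuous_measurable _ cv'.
have gxv : poly_growth (fun x => x * v x).
  exact: poly_growthM poly_growth_id gv.
have mxv : measurable_fun setT (fun x : R => x * v x) by exact: measurable_funM.
have i1 := integrable_poly_growth _ mv' gv'.
have i2 := integrable_poly_growth _ mxv gxv.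
pose w x := v' x - x * v x.
have mw : measurable_fun setT w by exact: measurable_funB.
have iw : gam.-integrable setT (EFin \o w).
  by apply: integrable_poly_growth => //; apply: poly_growthD => //; exact: poly_growthN.
apply/eqP; rewrite -subr_eq0 -RintegralB//; apply/eqP.
rewrite Rintegral_gauss//.
have [C hC] := poly_growth_vanish _ gv.
have [l1 l2] := cvg_le_inv (fun x => v x * phi x) C hC.
have dV (x : R) : is_derive x (1 : R) (fun x => v x * phi x) (w x * phi x).
  have dphi := is_derive_phi x.
  by apply: is_derive_eq; rewrite /= /GRing.scale/= /w; ring.
have cV : continuous (fun x => w x * phi x).
  apply: continuous_Mphi => x; apply: cvgB; first exact: cv'.
  by apply: cvgM; [exact: cvg_id|exact: cv].
have iV := (integrable_gaussP _ mw).1 iw.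
by have := Rintegral_derive _ _ 0 0 dV cV iV l1 l2; rewrite subrr.
Qed.

Lemma gauss_mean_cst (c : R) : \int[gam]_x c = c.
Proof. by rewrite Rintegral_cst//= probability_setT mulr1. Qed.

Lemma gauss_mean_id : \int[gam]_x x = 0.
Proof.
have h := gauss_ibp (cst 1) (cst 0) (fun x => is_derive_cst _ _ _)
  (fun x => cvg_cst _) (poly_growth_cst 1) (poly_growth_cst 0).
rewrite -[RHS]gauss_mean_cst [RHS]h.
by apply: eq_Rintegral => x _; rewrite mulr1.
Qed.

Lemma gauss_mean_sqr : \int[gam]_x (x ^+ 2) = 1.
Proof.
have h := gauss_ibp id (cst 1) (fun x => is_derive_id _ _)
  (fun x => cvg_cst _) poly_growth_id (poly_growth_cst 1).
rewrite -[RHS]gauss_mean_cst [RHS]h.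
by apply: eq_Rintegral => x _; rewrite expr2.
Qed.

Lemma integrable_gauss_pow n : gam.-integrable setT (EFin \o (fun x : R => x ^+ n)).
Proof.
apply: integrable_poly_growth; first exact: exprn_measurable.
by apply: poly_growthX; exact: poly_growth_id.
Qed.

(** The moments follow from Stein's identity applied to powers. *)
Lemma gauss_mean_pow4 : \int[gam]_x (x ^+ 4) = 3.
Proof.
have d (x : R) : is_derive x (1 : R) (fun x : R => x ^+ 3) (3 * x ^+ 2).
  by apply: is_derive_eq; rewrite /= /GRing.scale/=; ring.
have c : continuous (fun x : R => 3 * x ^+ 2).
  by move=> x; apply: cvgM; [exact: cvg_cst|exact: exprn_continuous].
have g3 : poly_growth (fun x : R => x ^+ 3).
  by apply: poly_growthX; exact: poly_growth_id.
have g : poly_growth (fun x : R => 3 * x ^+ 2).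
  apply: poly_growthM; first exact: poly_growth_cst.
  by apply: poly_growthX; exact: poly_growth_id.
have h := gauss_ibp _ _ d c g3 g.
transitivity (\int[gam]_x (3 * x ^+ 2)).
  by rewrite [RHS]h; apply: eq_Rintegral => x _; rewrite -exprS.
rewrite RintegralZl//; last exact: integrable_gauss_pow.
by rewrite gauss_mean_sqr mulr1.
Qed.

Lemma gauss_sym (f : R -> R) : measurable_fun setT f ->
  gam.-integrable setT (EFin \o f) ->
  \int[gam]_x f (- x) = \int[gam]_x f x.
Proof.
move=> mf fi.
have mphi : measurable_fun setT phi by exact: measurable_normal_pdf.
have mN : measurable_fun setT (-%R : R -> R) by [].
pose F (x : R) := (f x * phi x)%:E.
have iF : leb.-integrable setT F by apply/integrable_gaussP.
have mF : measurable_fun setT F by move/integrableP : iF => [].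
have eqL : (\int[leb]_x F x = \int[pushforward leb (-%R : R -> measurableTypeR R)]_x F x)%E.
  by apply: eq_measure_integral => //= A mA _; rewrite -[LHS]lebesgue_measureN.
have iFN : leb.-integrable setT (F \o -%R).
  apply/integrableP; split; first exact: measurableT_comp.
  move/integrableP : iF => [_]; apply: le_lt_trans.
  rewrite le_eqVlt; apply/orP; left; apply/eqP.
  transitivity (\int[pushforward leb (-%R : R -> measurableTypeR R)]_x `|F x|)%E.
    rewrite ge0_integral_pushforward//; exact: measurableT_comp.
  by apply: eq_measure_integral => //= A mA _; rewrite -[RHS]lebesgue_measureN.
rewrite [RHS]Rintegral_gauss// [LHS]Rintegral_gauss//; last 2 first.
- exact: measurableT_comp.
- apply/integrable_gaussP; first exact: measurableT_comp.
  by apply: eq_integrable iFN => // x _; rewrite /F/= phiN.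
rewrite /Rintegral; congr fine; rewrite [RHS]eqL.
rewrite integral_pushforward; [|exact: mN|exact: mF|exact: iFN|exact: measurableT].
by apply: eq_integral => x _; rewrite /F /= phiN.
Qed.

(** * The Stein equation in dimension one *)

Lemma cvg_integral_tails (f : R -> R) : leb.-integrable setT (EFin \o f) ->
  (\int[leb]_(y in `]-oo, n%:R]) f y @[n --> \oo] --> \int[leb]_y f y) *
  (\int[leb]_(y in `]-oo, - n%:R]) f y @[n --> \oo] --> 0).
Proof.
move=> intf; have mf : measurable_fun setT f.
  by move: intf => /integrableP[/measurable_EFinP].
have H (s : nat -> R) (h : R -> R) : leb.-integrable setT (EFin \o h) ->
    (forall x, (\forall n \near \oo,
     (f \_ `]-oo, s n]) x = h x)) ->
    \int[leb]_(y in `]-oo, s n]) f y @[n --> \oo] --> \int[leb]_y h y.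
  move=> ih hs.
  under eq_fun do rewrite Rintegral_mkcond.
  have hc : (\int[leb]_y ((f \_ `]-oo, s n]) y)%:E)%E @[n --> \oo] -->
     (\int[leb]_y (h y)%:E)%E.
    apply: (@dominated_cvg _ _ _ leb setT measurableT _ _ (abse \o (EFin \o f))).
    - move=> n; apply/measurable_EFinP/(measurable_restrictT _ _).1 => //.
      exact/measurable_funTS.
    - move=> x _; apply: cvg_near_cst.
      by apply: filterS (hs x) => n <-.
    - by [].
    - exact: integrable_abse.
    - move=> n x _; rewrite patchE; case: ifP => // _.
      by rewrite abse0 abse_ge0.
  by apply: fine_cvg; rewrite fineK//; exact: integrable_fin_num.
split.
- apply: H => // x; near=> n; rewrite patchE mem_set//= in_itv/=.
  by near: n; exact: nbhs_infty_ger.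
- have -> : 0 = \int[leb]_y (cst 0 y) :> R by rewrite Rintegral_cst// mul0r.
  apply: H => [|x]; first exact: integrable0.
  near=> n; rewrite patchE memNset//= in_itv/=.
  apply/negP; rewrite -ltNge ltrNl.
  by near: n; exact: nbhs_infty_gtr.
Unshelve. all: by end_near. Qed.

(** Two functions vanishing at minus infinity are compared through their
    derivatives. Applied with an explicit [B], this bounds the tails of the
    Stein solution without evaluating any integral. *)
Lemma tail_domination (K K' B B' : R -> R) (b : R) :
  (forall x, x <= b -> is_derive x (1 : R) K (K' x)) ->
  (forall x, x <= b -> is_derive x (1 : R) B (B' x)) ->
  (forall x, x <= b -> `|K' x| <= B' x) ->
  K (- n%:R) @[n --> \oo] --> 0 -> B (- n%:R) @[n --> \oo] --> 0 ->
  forall x, x <= b -> `|K x| <= B x.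
Proof.
move=> dK dB KB K0 B0.
have cK x : x <= b -> {for x, continuous K}.
  by move=> /dK dx; apply/differentiable_continuous/derivable1_diffP; case: dx.
have cB x : x <= b -> {for x, continuous B}.
  by move=> /dB dx; apply/differentiable_continuous/derivable1_diffP; case: dx.
have H (s : R) : `|s| = 1 -> forall x, x <= b -> 0 <= B x + s * K x.
  move=> s1 x xb.
  have lim0 : (B (- n%:R) + s * K (- n%:R)) @[n --> \oo] --> (0 : R).
    rewrite -[X in _ --> X](addr0 0) -{2}(mulr0 s).
    by apply: cvgD => //; apply: cvgM => //; exact: cvg_cst.
  rewrite -(cvg_lim _ lim0)//; apply: limr_le.
    by apply/cvg_ex; exists 0.
  near=> n.
  have nx : - n%:R < x by rewrite ltrNl; near: n; exact: nbhs_infty_gtr.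
  have [| |c] := @MVT R (fun y => B y + s * K y) (fun y => B' y + s * K' y) _ _ nx.
  - move=> y; rewrite in_itv/= => /andP[_ /ltW yx].
    have yb := le_trans yx xb.
    have := dB _ yb; have := dK _ yb => ? ?; apply: is_derive_eq.
    by rewrite /= /GRing.scale/=; ring.
  - apply: derivable_within_continuous => y; rewrite in_itv/= => /andP[_ yx].
    have yb := le_trans yx xb.
    by have := dB _ yb; have := dK _ yb => ? ?.
  - rewrite in_itv/= => /andP[_ /ltW cx] e; rewrite -subr_ge0 e mulr_ge0//.
    + have := KB _ (le_trans cx xb); rewrite -subr_ge0 => /le_trans; apply.
      rewrite lerD2l lerNl -mulNr (le_trans (ler_norm _))//.
      by rewrite normrM normrN s1 mul1r.
    + by rewrite subr_ge0 ltW.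
move=> x xb; have h1 := H 1 (normr1 _) x xb; have h2 := H (-1) (normrN1 _) x xb.
by rewrite ler_norml; apply/andP; split; lra.
Unshelve. all: by end_near. Qed.

Definition stein_prim (k : R -> R) (x : R) : R :=
  \int[leb]_(y in `]-oo, x]) (k y * phi y).

(** For a mean-zero [k], this is the solution of [f' - x f = k] that does not
    grow like [1 / phi]. *)
Definition stein_sol (k : R -> R) (x : R) : R := stein_prim k x / phi x.

Section stein_solution.
Variable k : R -> R.
Hypotheses (ck : continuous k) (gk : poly_growth k).
Hypothesis k0 : \int[gam]_x k x = 0.

Let kphi_integrable : leb.-integrable setT (EFin \o (fun x => k x * phi x)).
Proof.
apply/integrable_gaussP; first exact: continuous_measurable.
by apply: integrable_poly_growth => //; exact: continuous_measurable.
Qed.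

Lemma is_derive_stein_prim x : is_derive x (1 : R) (stein_prim k) (k x * phi x).
Proof.
have [||||d <-] := @continuous_FTC1 R (fun x => k x * phi x) -oo%O x (x + 1).
- by rewrite ltrDl.
- by apply: integrableS kphi_integrable.
- by rewrite ltNyr.
- exact: continuous_Mphi.
- by rewrite derive1E; exact: derivableP.
Qed.

Lemma is_derive_stein_sol x :
  is_derive x (1 : R) (stein_sol k) (x * stein_sol k x + k x).
Proof.
have p0 : phi x != 0 by rewrite gt_eqF// phi_gt0.
have d1 := is_derive_stein_prim x; have d2 := is_derive_phi x.
have d3 := is_deriveV p0 d2.
apply: is_derive_eq; rewrite /stein_sol /= /GRing.scale/=.
by field.
Qed.

Let prim0 : (stein_prim k n%:R @[n --> \oo] --> 0) *
  (stein_prim k (- n%:R) @[n --> \oo] --> 0).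
Proof.
have [h1 h2] := cvg_integral_tails _ kphi_integrable; split => //.
rewrite -Rintegral_gauss ?k0// in h1; first exact: continuous_measurable.
by apply: integrable_poly_growth => //; exact: continuous_measurable.
Qed.

Let primr x : is_derive x (1 : R) (fun y => - stein_prim k (- y)) (k (- x) * phi x).
Proof.
have d : is_derive (- x) (1 : R) (stein_prim k) (k (- x) * phi (- x)).
  exact: is_derive_stein_prim.
have d' : is_derive x (1 : R) (stein_prim k \o -%R)
      (k (- x) * phi (- x) * -1).
  exact: is_derive1_comp.
apply: (is_derive_eq (is_deriveN d')).
by rewrite phiN mulrN1 opprK.
Qed.

(** Domination on one tail yields domination on the other by reflection. *)
Let tails (B B' : R -> R) (b : R) :
  (forall x, x <= b -> is_derive x (1 : R) B (B' x)) ->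
  (forall x, x <= b -> `|k x * phi x| <= B' x) ->
  (forall x, x <= b -> `|k (- x) * phi x| <= B' x) ->
  B (- n%:R) @[n --> \oo] --> 0 ->
  forall x, x <= b -> `|stein_prim k x| <= B x /\ `|stein_prim k (- x)| <= B x.
Proof.
move=> dB h1 h2 B0 x xb; split.
  have d y : y <= b -> is_derive y (1 : R) (stein_prim k) (k y * phi y).
    by move=> _; exact: is_derive_stein_prim.
  exact: (tail_domination _ _ _ _ b d dB h1 prim0.2 B0).
have d y : y <= b ->
    is_derive y (1 : R) (fun y => - stein_prim k (- y)) (k (- y) * phi y).
  by move=> _; exact: primr.
rewrite -normrN; apply: (tail_domination _ _ _ _ b d dB h2 _ B0) => //.
under eq_fun do rewrite opprK.
by rewrite -oppr0; apply: cvgN; exact: prim0.1.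
Qed.

(** Near the origin the Stein solution is bounded by the total mass of [|k|]
    over the minimum of the density; beyond, by tail domination. *)
Lemma phi_ge_phi1 (x : R) : `|x| <= 1 -> phi 1 <= phi x.
Proof.
move=> x1; rewrite !phiE ler_wpM2l ?normal_peak_ge0// ler_expR lerN2.
by rewrite ler_pM2r// -(real_normK (num_real x)) ler_sqr ?nnegrE.
Qed.

Lemma stein_prim_bound (c : R) : 0 <= c -> (forall x, `|k x| <= c * (1 + x ^+ 2)) ->
  forall x, `|stein_prim k x| <= c * 2.
Proof.
move=> c0 hk x.
have mk : measurable_fun setT k by exact: continuous_measurable.
have ikn := integrable_norm kphi_integrable.
apply: (@le_trans _ _ (\int[leb]_x `|k x * phi x|)).
  rewrite /stein_prim; apply: (le_trans (le_normr_Rintegral _ _)) => //.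
    exact: integrableS kphi_integrable.
  rewrite /Rintegral; apply: fine_le.
  - apply: integrable_fin_num => //.
    by apply: integrableS ikn.
  - exact: integrable_fin_num.
  - apply: ge0_subset_integral => //.
    by move: ikn => /integrableP[].
have gk2 : poly_growth (fun x => c * (1 + x ^+ 2)).
  apply: poly_growthM; first exact: poly_growth_cst.
  apply: poly_growthD; first exact: poly_growth_cst.
  by apply: poly_growthX; exact: poly_growth_id.
have m2 : measurable_fun setT (fun x : R => c * (1 + x ^+ 2)).
  apply: measurable_funM => //; apply: measurable_funD => //.
have i2 := integrable_poly_growth _ m2 gk2.
have -> : c * 2 = \int[leb]_x ((c * (1 + x ^+ 2)) * phi x).
  rewrite -Rintegral_gauss// RintegralZl//; last first.
    apply: integrable_poly_growth; first exact: measurable_funD.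
    apply: poly_growthD; first exact: poly_growth_cst.
    by apply: poly_growthX; exact: poly_growth_id.
  rewrite RintegralD//; [|exact: finite_measure_integrable_cst|exact: integrable_gauss_pow].
  by rewrite gauss_mean_cst gauss_mean_sqr.
apply: le_Rintegral => //.
- exact/integrable_gaussP.
- move=> y _; rewrite normrM (ger0_norm (ltW (phi_gt0 _))).
  by rewrite ler_wpM2r// ltW// phi_gt0.
Qed.

Let vanish_at_Ny (v : R -> R) : poly_growth v ->
  v (- n%:R) * phi (- n%:R) @[n --> \oo] --> 0.
Proof.
move=> gv; have [C hC] := poly_growth_vanish _ gv.
exact: (cvg_le_inv (fun x => v x * phi x) C hC).2.
Qed.

Let sol_le (x M : R) : `|stein_prim k x| <= M * phi x -> `|stein_sol k x| <= M.
Proof.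
move=> h; rewrite /stein_sol normrM normfV (ger0_norm (ltW (phi_gt0 _))).
by rewrite ler_pdivrMr ?phi_gt0.
Qed.

Definition stein_cst : R := 2 + 2 / phi 1.

Lemma stein_cst_ge2 : 2 <= stein_cst.
Proof. by rewrite lerDl divr_ge0// ltW// phi_gt0. Qed.

Let sol_center (c : R) : 0 <= c -> (forall x, `|k x| <= c * (1 + x ^+ 2)) ->
  forall x, `|x| <= 1 -> `|stein_sol k x| <= c * (2 / phi 1).
Proof.
move=> c0 hk x x1; apply: sol_le.
apply: (le_trans (stein_prim_bound _ c0 hk x)).
rewrite -mulrA ler_wpM2l// -mulrA ler_peMr// ler_pdivlMl ?phi_gt0//.
by rewrite mulr1 phi_ge_phi1.
Qed.

(** Used for the summands of the statistic, which grow quadratically. On the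
    tail, [c (2 - y) phi y] dominates the primitive: its derivative is
    [c (y^2 - 2 y - 1) phi y], at least [c (1 + y^2) phi y] when [y <= -1]. *)
Lemma stein_sol_linear (c : R) : 0 <= c ->
  (forall x, `|k x| <= c * (1 + x ^+ 2)) ->
  forall x, `|stein_sol k x| <= c * (stein_cst + `|x|).
Proof.
move=> c0 hk x.
pose B (y : R) := c * (2 - y) * phi y; pose B' (y : R) := c * (y ^+ 2 - 2 * y - 1) * phi y.
have dB (y : R) : y <= -1 -> is_derive y (1 : R) B (B' y).
  move=> _; have d := is_derive_phi y; apply: is_derive_eq.
  by rewrite /= /GRing.scale/= /B'; ring.
have hB (y : R) : y <= -1 -> c * (1 + y ^+ 2) * phi y <= B' y.
  move=> y1; rewrite ler_wpM2r ?(ltW (phi_gt0 _))// ler_wpM2l//.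
  by lra.
have kB (y : R) : y <= -1 -> `|k y * phi y| <= B' y.
  move=> y1; apply: le_trans (hB _ y1).
  rewrite normrM (ger0_norm (ltW (phi_gt0 _))).
  by rewrite ler_wpM2r// ltW// phi_gt0.
have kBr (y : R) : y <= -1 -> `|k (- y) * phi y| <= B' y.
  move=> y1; apply: le_trans (hB _ y1).
  rewrite normrM (ger0_norm (ltW (phi_gt0 _))) -sqrrN.
  by rewrite ler_wpM2r// ltW// phi_gt0.
have gB : poly_growth (fun y => c * (2 - y)).
  apply: poly_growthM; first exact: poly_growth_cst.
  apply: poly_growthD; first exact: poly_growth_cst.
  exact: poly_growthN poly_growth_id.
have tl := tails _ _ _ dB kB kBr (vanish_at_Ny _ gB).
have p1 : 0 <= 2 / phi 1 by rewrite divr_ge0// ltW// phi_gt0.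
have far (y : R) : y <= -1 -> c * (2 - y) <= c * (stein_cst + `|y|).
  move=> y1; rewrite ler_wpM2l// ler0_norm; last by lra.
  by rewrite /stein_cst; lra.
have [x1|x1] := lerP `|x| 1.
  apply: (le_trans (sol_center _ c0 hk _ x1)); rewrite ler_wpM2l//.
  by rewrite /stein_cst; have := normr_ge0 x; lra.
have [x0|x0] := lerP 0 x.
  have xN : - x <= -1 by rewrite lerN2; move: x1; rewrite ger0_norm// => /ltW.
  have [_] := tl _ xN; rewrite opprK /B phiN => /sol_le h.
  by apply: (le_trans h); have := far _ xN; rewrite normrN.
have xN : x <= -1 by move: x1; rewrite ltr0_norm//; lra.
by have [/sol_le h _] := tl _ xN; exact: (le_trans h (far _ xN)).
Qed.

(** Used for bounded test functions: both terms of the derivative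
    [x f + k] of the solution [f] are bounded. The dominating function is the
    Mills ratio type bound [2 |y| / (1 + y^2)], whose product with [x] stays
    bounded. *)
Lemma stein_sol_bounded : (forall x, `|k x| <= 1) ->
  forall x, `|stein_sol k x| <= stein_cst /\ `|x * stein_sol k x| <= stein_cst.
Proof.
move=> hk.
have hk2 (x : R) : `|k x| <= 1 * (1 + x ^+ 2).
  by apply: (le_trans (hk x)); rewrite mul1r lerDl sqr_ge0.
pose v (y : R) := - 2 * y / (1 + y ^+ 2).
have w0 (y : R) : 0 < 1 + y ^+ 2 by have := sqr_ge0 y; lra.
pose B (y : R) := v y * phi y; pose B' (y : R) := 2 * (1 - 2 / (1 + y ^+ 2) ^+ 2) * phi y.
have dB (y : R) : y <= -1 -> is_derive y (1 : R) B (B' y).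
  move=> _; have d := is_derive_phi y.
  have d1 : is_derive y (1 : R) (fun y : R => 1 + y ^+ 2) (2 * y).
    by apply: is_derive_eq; rewrite /= /GRing.scale/=; ring.
  have n0 : (fun y : R => 1 + y ^+ 2) y != 0 by exact: lt0r_neq0.
  have d2 := is_deriveV (f := fun y : R => 1 + y ^+ 2) n0 d1.
  apply: is_derive_eq; rewrite /= /GRing.scale/= /B' /v.
  by field; exact: lt0r_neq0.
have hB (y : R) : y <= -1 -> phi y <= B' y.
  move=> y1; rewrite ler_peMl ?(ltW (phi_gt0 _))//.
  have : 2 / (1 + y ^+ 2) ^+ 2 <= 2^-1.
    have w2 : 2 <= 1 + y ^+ 2 by nra.
    rewrite ler_pdivrMr ?exprn_gt0//.
    by move: (1 + y ^+ 2) w2 => w w2; nra.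
  lra.
have kB (y : R) : y <= -1 -> `|k y * phi y| <= B' y.
  move=> y1; apply: le_trans (hB _ y1).
  rewrite normrM (ger0_norm (ltW (phi_gt0 _))).
  by rewrite ler_piMl// ltW// phi_gt0.
have kBr (y : R) : y <= -1 -> `|k (- y) * phi y| <= B' y.
  move=> y1; apply: le_trans (hB _ y1).
  rewrite normrM (ger0_norm (ltW (phi_gt0 _))).
  by rewrite ler_piMl// ltW// phi_gt0.
have vle (y : R) : `|v y| <= 1.
  rewrite /v normrM normfV (gtr0_norm (w0 y)) ler_pdivrMr// mul1r.
  rewrite ler_norml; apply/andP; split.
    have := sqr_ge0 (1 - y); nra.
  have := sqr_ge0 (1 + y); nra.
have gv : poly_growth v by exact: poly_growth_bounded vle.
have tl := tails _ _ _ dB kB kBr (vanish_at_Ny _ gv).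
have p1 : 0 <= 2 / phi 1 by rewrite divr_ge0// ltW// phi_gt0.
have far (y : R) : `|y| > 1 -> `|stein_sol k y| <= `|v y|.
  move=> y1; have [y0|y0] := lerP 0 y.
    have yN : - y <= -1 by rewrite lerN2; move: y1; rewrite ger0_norm// => /ltW.
    have [_] := tl _ yN; rewrite opprK /B phiN => /sol_le h.
    apply: (le_trans h); rewrite (le_trans (ler_norm _))//.
    by rewrite /v mulrN mulNr normrN sqrrN.
  have yN : y <= -1 by move: y1; rewrite ltr0_norm//; lra.
  have [/sol_le h _] := tl _ yN; apply: (le_trans h); exact: ler_norm.
move=> x; have [x1|x1] := lerP `|x| 1.
  have := sol_center _ ler01 hk2 _ x1; rewrite mul1r => h.
  have h2 : `|stein_sol k x| <= stein_cst by rewrite /stein_cst; lra.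
  by split=> //; rewrite normrM (le_trans _ h2)// ler_piMl.
have h := far _ x1; split.
  by apply: (le_trans h); apply: (le_trans (vle x)); have := stein_cst_ge2; lra.
rewrite normrM; apply: (le_trans (ler_wpM2l _ h)) => //.
apply: le_trans stein_cst_ge2.
rewrite -normrM /v normrM !normrM normrN normfV (gtr0_norm (w0 x)).
rewrite (@ger0_norm _ 2)// !mulrA ler_pdivrMr//.
rewrite -(real_normK (num_real x)).
have := normr_ge0 x; nra.
Qed.

End stein_solution.

(** * One coordinate of the statistic *)

(** A criterion that treats the junction point of the piecewise quadratic
    [negsq] on the same footing as the other points. *)
Lemma is_derive_quadratic_error (f : R -> R) (x d : R) :
  (forall h, `|f (x + h) - f x - d * h| <= h ^+ 2) -> is_derive x (1 : R) f d.
Proof.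
move=> H.
have lim : h^-1 *: (f (h *: 1 + x) - f x) @[h --> 0^'] --> d.
  apply/cvgrPdist_le => e e0; near=> h.
  have h0 : h != 0 by near: h; exact: nbhs_dnbhs_neq.
  have he : `|h| <= e.
    near: h; apply: (@nbhs_dnbhs _ (0 : R)).
    exists e => //= h; rewrite /ball_/= sub0r normrN; exact: ltW.
  rewrite /GRing.scale/= mulr1 addrC (addrC h).
  have -> : - (h^-1 * (f (x + h) - f x)) + d = - (h^-1 * (f (x + h) - f x - d * h)).
    by field.
  rewrite normrN normrM normfV ler_pdivrMl ?normr_gt0//.
  apply: (le_trans (H h)); rewrite -(real_normK (num_real h)) expr2.
  by rewrite ler_wpM2l.
apply: DeriveDef; first by apply/cvg_ex; exists d.
exact: cvg_lim lim.
Unshelve. all: by end_near. Qed.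

(** The squared distance to the half line of nonnegative reals. *)
Definition negsq (x : R) : R := Num.min x 0 ^+ 2.

Lemma is_derive_negsq (x : R) : is_derive x (1 : R) negsq (2 * Num.min x 0).
Proof.
apply: is_derive_quadratic_error => h; rewrite /negsq.
have := sqr_ge0 h; have := sqr_ge0 (x + h); have := sqr_ge0 x.
by case: (lerP x 0) => ?; case: (lerP (x + h) 0) => ?; rewrite ler_norml => *;
  apply/andP; split; nra.
Qed.

Lemma negsq_ge0 (x : R) : 0 <= negsq x. Proof. exact: sqr_ge0. Qed.

Lemma negsq_le (a x : R) : 0 <= a -> negsq (a + x) <= x ^+ 2.
Proof. by rewrite /negsq => a0; case: (lerP (a + x) 0) => ?; nra. Qed.

(** Stein's identity applied to [g * u] trades [k] for a derivative of the test
    function: if [g] solves [g' = x g - k], the derivative of [g u] minus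
    [x g u] is [g u' - k u]. With [u = F o k], the factor [g * k'] is a Stein
    kernel of the law of [k]. *)
Lemma stein_kernel (k g u u' : R -> R) : continuous k -> poly_growth k ->
  (forall x, is_derive x (1 : R) g (x * g x - k x)) -> poly_growth g ->
  (forall x, is_derive x (1 : R) u (u' x)) -> continuous u' ->
  poly_growth u -> poly_growth u' ->
  \int[gam]_x (k x * u x) = \int[gam]_x (g x * u' x).
Proof.
move=> ck pk dg pg du cu' pu pu'.
have cg := is_derive_continuous _ _ dg; have cu := is_derive_continuous _ _ du.
have cM (f h : R -> R) : continuous f -> continuous h ->
  continuous (fun x => f x * h x).
  by move=> cf ch x; apply: cvgM; [exact: cf|exact: ch].
have ci : continuous (fun x : R => x) by move=> x; exact: cvg_id.
have int (f h : R -> R) : continuous f -> continuous h -> poly_growth f ->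
    poly_growth h -> gam.-integrable setT (EFin \o (fun x => f x * h x)).
  move=> cf ch pf ph; apply: integrable_poly_growth; last exact: poly_growthM.
  by apply: continuous_measurable; exact: cM.
have pgu : poly_growth (fun x => g x * u x) by exact: poly_growthM.
pose v' (x : R) := x * (g x * u x) + (g x * u' x - k x * u x).
have dv (x : R) : is_derive x (1 : R) (fun x => g x * u x) (v' x).
  have d1 := dg x; have d2 := du x; apply: is_derive_eq.
  by rewrite /= /GRing.scale/= /v'; ring.
have pv' : poly_growth v'.
  apply: poly_growthD; first exact: poly_growthM poly_growth_id _.
  apply: poly_growthD; first exact: poly_growthM.
  by apply: poly_growthN; exact: poly_growthM.
have cv' : continuous v'.
  move=> x; apply: cvgD; first exact: (cM _ _ ci (cM _ _ cg cu)).
  by apply: cvgB; [exact: (cM _ _ cg cu')|exact: (cM _ _ ck cu)].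
have := gauss_ibp _ _ dv cv' pgu pv'.
rewrite /v' RintegralD//; last 2 first.
- by apply: int => //; [exact: cM|exact: poly_growth_id].
- apply: integrable_poly_growth.
    by apply: measurable_funB; apply: continuous_measurable; exact: cM.
  apply: poly_growthD; first exact: poly_growthM.
  by apply: poly_growthN; exact: poly_growthM.
rewrite RintegralB//; [|exact: int..].
move/eqP; rewrite -subr_eq0 addrAC subrr add0r subr_eq0 => /eqP ->//.
Qed.

Lemma integrable_continuous (f : R -> R) : continuous f -> poly_growth f ->
  gam.-integrable setT (EFin \o f).
Proof.
by move=> cf pf; apply: integrable_poly_growth => //; exact: continuous_measurable.
Qed.

(** The regularity shared by the summands, their derivatives and their Stein
    kernels: enough for measurability, integrability and Stein's identity. *)
Definition tame (f : R -> R) := continuous f /\ poly_growth f.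

Lemma tame_cst (c : R) : tame (fun=> c).
Proof. by split; [move=> x; exact: cvg_cst|exact: poly_growth_cst]. Qed.

Lemma tame_id : tame (fun x => x).
Proof. by split; [move=> x; exact: cvg_id|exact: poly_growth_id]. Qed.

Lemma tameD (f g : R -> R) : tame f -> tame g -> tame (fun x => f x + g x).
Proof.
move=> [cf pf] [cg pg]; split; last exact: poly_growthD.
by move=> x; apply: cvgD; [exact: cf|exact: cg].
Qed.

Lemma tameM (f g : R -> R) : tame f -> tame g -> tame (fun x => f x * g x).
Proof.
move=> [cf pf] [cg pg]; split; last exact: poly_growthM.
by move=> x; apply: cvgM; [exact: cf|exact: cg].
Qed.

Lemma tameN (f : R -> R) : tame f -> tame (fun x => - f x).
Proof.
move=> [cf pf]; split; last exact: poly_growthN.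
by move=> x; apply: cvgN; exact: cf.
Qed.

Lemma tameX (f : R -> R) n : tame f -> tame (fun x => f x ^+ n).
Proof.
move=> tf; elim: n => [|n ih].
  by under eq_fun do rewrite expr0; exact: tame_cst.
by under eq_fun do rewrite exprS; exact: tameM.
Qed.

Lemma integrable_tame (f : R -> R) : tame f -> gam.-integrable setT (EFin \o f).
Proof. by move=> [cf pf]; exact: integrable_continuous. Qed.

Lemma measurable_tame (f : R -> R) : tame f -> measurable_fun setT f.
Proof. by move=> [cf pf]; exact: continuous_measurable. Qed.

Lemma gauss_meanD (f g : R -> R) : tame f -> tame g ->
  \int[gam]_x (f x + g x) = \int[gam]_x f x + \int[gam]_x g x.
Proof. by move=> tf tg; rewrite RintegralD//; exact: integrable_tame. Qed.

Lemma gauss_meanZ (c : R) (f : R -> R) : tame f ->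
  \int[gam]_x (c * f x) = c * \int[gam]_x f x.
Proof. by move=> tf; rewrite RintegralZl//; exact: integrable_tame. Qed.

Lemma gauss_mean_le (f g : R -> R) : tame f -> tame g -> (forall x, f x <= g x) ->
  \int[gam]_x f x <= \int[gam]_x g x.
Proof.
by move=> tf tg fg; apply: le_Rintegral => //; exact: integrable_tame.
Qed.

Lemma tame_negsq : tame negsq.
Proof.
split; first exact: is_derive_continuous _ _ is_derive_negsq.
apply: (poly_growth_le _ (fun x => x ^+ 2)) => [x|].
  rewrite !ger0_norm ?sqr_ge0//.
  by have := negsq_le 0 x (lexx _); rewrite add0r.
by apply: poly_growthX; exact: poly_growth_id.
Qed.

(** By symmetry, as [negsq x + negsq (- x) = x^2]. *)
Lemma gauss_mean_negsq : \int[gam]_x negsq x = 2^-1.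
Proof.
have tn := tame_negsq.
have h : \int[gam]_x (negsq x + negsq (- x)) = 1.
  apply: etrans gauss_mean_sqr; apply: eq_Rintegral => x _; rewrite /negsq.
  by case: (lerP x 0) => ?; case: (lerP (- x) 0) => ?; nra.
have tnN : tame (fun x => negsq (- x)).
  split.
    move=> x; apply: (cvg_comp -%R negsq); last exact: tn.1.
    by apply: cvgN; exact: cvg_id.
  apply: (poly_growth_le _ (fun x => x ^+ 2)) => [x|].
    rewrite !ger0_norm ?sqr_ge0//.
    by have := negsq_le 0 (- x) (lexx _); rewrite add0r sqrrN.
  by apply: poly_growthX; exact: poly_growth_id.
move: h; rewrite gauss_meanD//.
rewrite (gauss_sym _ (measurable_tame _ tn) (integrable_tame _ tn)) => h.
by lra.
Qed.

(** A coordinate of mean [a], with deviation [d] from the null, contributes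
    [(x + d)^2 - negsq (a + x) = lrt_coord a x + 2 d x + d^2] to the statistic,
    [x] being the noise. Isolating [lrt_coord], which lies between [0] and
    [x^2] whatever [a >= 0] is, makes all bounds uniform in [a]. *)
Definition lrt_coord (a x : R) : R := x ^+ 2 - negsq (a + x).

Definition lrt_coord_mean (a : R) : R := \int[gam]_x lrt_coord a x.

Definition centered (a d x : R) : R := lrt_coord a x - lrt_coord_mean a + 2 * d * x.

Definition centered' (a d x : R) : R := 2 * x - 2 * Num.min (a + x) 0 + 2 * d.

(** The solution [g] of [g' = x g - centered a d] with linear growth; the
    linear part [2 d x] of the right-hand side has the constant solution [2 d],
    for which no estimate is lost. *)
Definition kernel_factor (a d x : R) : R :=
  2 * d - stein_sol (fun y => lrt_coord a y - lrt_coord_mean a) x.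

Definition stein_kernel_coord (a d x : R) : R := kernel_factor a d x * centered' a d x.

Definition centered_var (a d : R) : R := \int[gam]_x (centered a d x ^+ 2).

Section coordinate.
Variables (a d : R).
Hypothesis a0 : 0 <= a.
Local Notation m := (lrt_coord_mean a).
Local Notation k0 := (fun y : R => lrt_coord a y - m).

Lemma lrt_coord_ge0 x : 0 <= lrt_coord a x.
Proof. by rewrite subr_ge0; exact: negsq_le. Qed.

Lemma lrt_coord_le x : lrt_coord a x <= x ^+ 2.
Proof. by rewrite lerBlDr lerDl negsq_ge0. Qed.

Lemma is_derive_centered e x : is_derive x (1 : R) (centered a e) (centered' a e x).
Proof.
have d2 : is_derive x (1 : R) (fun x : R => a + x) 1.
  by have := is_deriveD (is_derive_cst a x 1) (is_derive_id x (1 : R)); rewrite add0r.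
have d1 : is_derive x (1 : R) (negsq \o (fun x => a + x))
    (2 * Num.min (a + x) 0 * 1).
  by apply: is_derive1_comp; exact: is_derive_negsq.
rewrite /centered /lrt_coord.
by apply: is_derive_eq; rewrite /= /GRing.scale/= /centered'; ring.
Qed.

Lemma continuous_centered e : continuous (centered a e).
Proof. exact: is_derive_continuous _ _ (is_derive_centered e). Qed.

Lemma centered0E x : centered a 0 x = k0 x.
Proof. by rewrite /centered mulr0 mul0r addr0. Qed.

Lemma continuous_lrt_coord : continuous (lrt_coord a).
Proof.
have -> : lrt_coord a = (fun x => centered a 0 x + m).
  by apply/funext => x; rewrite centered0E subrK.
by move=> x; apply: cvgD; [exact: continuous_centered|exact: cvg_cst].
Qed.

Lemma poly_growth_lrt_coord : poly_growth (lrt_coord a).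
Proof.
apply: (poly_growth_le _ (fun x => x ^+ 2)) => [x|].
  by rewrite !ger0_norm ?sqr_ge0 ?lrt_coord_le// lrt_coord_ge0.
by apply: poly_growthX; exact: poly_growth_id.
Qed.

Lemma integrable_lrt_coord : gam.-integrable setT (EFin \o lrt_coord a).
Proof.
apply: integrable_poly_growth; last exact: poly_growth_lrt_coord.
by apply: continuous_measurable; exact: continuous_lrt_coord.
Qed.

Lemma lrt_coord_mean_ge0 : 0 <= m.
Proof. by apply: Rintegral_ge0 => x _; exact: lrt_coord_ge0. Qed.

Lemma lrt_coord_mean_le1 : m <= 1.
Proof.
rewrite -gauss_mean_sqr; apply: le_Rintegral => //.
- exact: integrable_lrt_coord.
- exact: integrable_gauss_pow.
- by move=> x _; exact: lrt_coord_le.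
Qed.

Lemma poly_growth_centered e : poly_growth (centered a e).
Proof.
apply: poly_growthD.
  by apply: poly_growthD; [exact: poly_growth_lrt_coord|exact: poly_growth_cst].
by apply: poly_growthM; [exact: poly_growth_cst|exact: poly_growth_id].
Qed.

Lemma centered0_le x : `|k0 x| <= 1 * (1 + x ^+ 2).
Proof.
have := lrt_coord_ge0 x; have := lrt_coord_le x.
have := lrt_coord_mean_ge0; have := lrt_coord_mean_le1.
by rewrite mul1r ler_norml => *; apply/andP; split; lra.
Qed.

Let ck0 : continuous k0.
Proof. by move=> x; apply: cvgB; [exact: continuous_lrt_coord|exact: cvg_cst]. Qed.

Let gk0 : poly_growth k0.
Proof.
by apply: poly_growthD; [exact: poly_growth_lrt_coord|exact: poly_growth_cst].
Qed.

Lemma centered_mean e : \int[gam]_x centered a e x = 0.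
Proof.
rewrite RintegralD//; last 2 first.
- exact: integrable_continuous.
- apply: integrable_continuous.
    by move=> x; apply: cvgM; [exact: cvg_cst|exact: cvg_id].
  by apply: poly_growthM; [exact: poly_growth_cst|exact: poly_growth_id].
have ii : gam.-integrable setT (EFin \o (fun x : R => x)).
  by apply: integrable_continuous; [move=> x; exact: cvg_id|exact: poly_growth_id].
have ic : gam.-integrable setT (EFin \o (fun x : R => m)).
  exact: finite_measure_integrable_cst.
rewrite RintegralB//; last exact: integrable_lrt_coord.
by rewrite gauss_mean_cst subrr RintegralZl// gauss_mean_id mulr0 addr0.
Qed.

Let k0_mean : \int[gam]_x k0 x = 0.
Proof.
apply: etrans (centered_mean 0).
by apply: eq_Rintegral => x _; rewrite centered0E.
Qed.

Lemma kernel_factor_le x : `|kernel_factor a 0 x| <= stein_cst + `|x|.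
Proof.
rewrite /kernel_factor mulr0 sub0r normrN.
by have := stein_sol_linear _ ck0 gk0 k0_mean _ ler01 centered0_le x; rewrite mul1r.
Qed.

Lemma kernel_factorE x : kernel_factor a d x = kernel_factor a 0 x + 2 * d.
Proof. by rewrite /kernel_factor mulr0 sub0r addrC. Qed.

Lemma centered'E x : centered' a d x = centered' a 0 x + 2 * d.
Proof. by rewrite /centered' mulr0 addr0. Qed.

Lemma centered'0_le x : `|centered' a 0 x| <= 2 * `|x|.
Proof.
rewrite /centered' mulr0 addr0; case: (lerP (a + x) 0) => h.
  have -> : 2 * x - 2 * (a + x) = - (2 * a) by ring.
  have x0 : x <= 0 by have := a0; lra.
  by rewrite normrN ger0_norm ?mulr_ge0// ler0_norm//; have := a0; lra.
by rewrite mulr0 subr0 normrM ger0_norm.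
Qed.

Lemma is_derive_kernel_factor x :
  is_derive x (1 : R) (kernel_factor a d) (x * kernel_factor a d x - centered a d x).
Proof.
have := is_derive_stein_sol _ ck0 gk0 x => ds.
rewrite /kernel_factor; apply: is_derive_eq.
by rewrite /centered; ring.
Qed.

Lemma poly_growth_kernel_factor : poly_growth (kernel_factor a d).
Proof.
rewrite (_ : kernel_factor a d = (fun x => kernel_factor a 0 x + 2 * d)); last first.
  by apply/funext => x; exact: kernel_factorE.
apply: poly_growthD; last exact: poly_growth_cst.
exists stein_cst, 1%N => x; rewrite expr1 (le_trans (kernel_factor_le _))//.
have := stein_cst_ge2; have := normr_ge0 x; nra.
Qed.

Lemma poly_growth_centered' : poly_growth (centered' a d).
Proof.
rewrite (_ : centered' a d = (fun x => centered' a 0 x + 2 * d)); last first.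
  by apply/funext => x; exact: centered'E.
apply: poly_growthD; last exact: poly_growth_cst.
exists 2, 1%N => x; rewrite expr1 (le_trans (centered'0_le _))//.
by have := normr_ge0 x; lra.
Qed.

Lemma continuous_centered' : continuous (centered' a d).
Proof.
move=> x; rewrite /centered'; apply: cvgD; last exact: cvg_cst.
apply: cvgB; apply: cvgM; [exact: cvg_cst|exact: cvg_id|exact: cvg_cst|].
apply: (@continuous_min R R (fun x => a + x) (cst 0)); last exact: cvg_cst.
by apply: cvgD; [exact: cvg_cst|exact: cvg_id].
Qed.

Lemma tame_centered : tame (centered a d).
Proof. by split; [exact: continuous_centered|exact: poly_growth_centered]. Qed.

Lemma tame_centered' : tame (centered' a d).
Proof. by split; [exact: continuous_centered'|exact: poly_growth_centered']. Qed.

Lemma tame_kernel_factor : tame (kernel_factor a d).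
Proof.
split; last exact: poly_growth_kernel_factor.
exact: is_derive_continuous _ _ is_derive_kernel_factor.
Qed.

Lemma tame_stein_kernel_coord : tame (stein_kernel_coord a d).
Proof. exact: tameM tame_kernel_factor tame_centered'. Qed.

(** The kernel identity for a summand; tested against the summand itself, it
    shows that the kernel has mean the variance. *)
Lemma stein_coord (u u' : R -> R) :
  (forall x, is_derive x (1 : R) u (u' x)) -> tame u -> tame u' ->
  \int[gam]_x (centered a d x * u x) = \int[gam]_x (kernel_factor a d x * u' x).
Proof.
move=> du [cu pu] [cu' pu'].
exact: (stein_kernel _ _ _ _ tame_centered.1 tame_centered.2
  is_derive_kernel_factor tame_kernel_factor.2 du cu' pu pu').
Qed.

Lemma stein_kernel_coord_mean :
  \int[gam]_x stein_kernel_coord a d x = centered_var a d.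
Proof.
have := stein_coord _ _ (is_derive_centered d) tame_centered tame_centered'.
by move=> h; rewrite -[LHS]h; apply: eq_Rintegral => x _; rewrite expr2.
Qed.

(** Cauchy-Schwarz against the second Hermite polynomial [x^2 - 1], of variance
    [2]: its covariance with the summand is the mean of [x * centered'], at least [1]
    because the worst case is [a = 0]. *)
Lemma centered_var_ge : 2^-1 <= centered_var a d.
Proof.
have tx := tame_id; have tx2 : tame (fun x => x ^+ 2) by exact: tameX.
have t1 := tame_cst (-1); have tk := tame_centered.
have tH : tame (fun x => x ^+ 2 + -1) by exact: tameD.
have h1 : \int[gam]_x ((x ^+ 2 + -1) * centered a d x) =
    \int[gam]_x (x * centered' a d x).
  apply: (stein_kernel (fun x => x ^+ 2 + -1) id).
  - exact: tH.1.
  - exact: tH.2.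
  - by move=> x; apply: is_derive_eq; ring.
  - exact: poly_growth_id.
  - exact: is_derive_centered.
  - exact: tame_centered'.1.
  - exact: tame_centered.2.
  - exact: tame_centered'.2.
have h2 : 1 <= \int[gam]_x (x * centered' a d x).
  have tn := tameM _ _ (tame_cst (-2)) tame_negsq.
  have tx2' := tameM _ _ (tame_cst 2) tx2.
  have tdx := tameM _ _ (tame_cst (2 * d)) tx.
  have ts := tameD _ _ tx2' tn.
  have : \int[gam]_x (2 * x ^+ 2 + -2 * negsq x + 2 * d * x) <=
      \int[gam]_x (x * centered' a d x).
    apply: gauss_mean_le; first exact: tameD.
      exact: tameM tx tame_centered'.
    move=> x; rewrite /negsq /centered'; have := a0.
    by case: (lerP x 0) => ?; case: (lerP (a + x) 0) => ?; nra.
  rewrite !gauss_meanD// !gauss_meanZ//; last exact: tame_negsq.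
  rewrite gauss_mean_sqr gauss_mean_id gauss_mean_negsq; lra.
have h3 : \int[gam]_x ((x ^+ 2 + -1) ^+ 2) = 2.
  transitivity (\int[gam]_x (x ^+ 4 + (-2 * x ^+ 2 + 1))).
    by apply: eq_Rintegral => x _; ring.
  have t4 : tame (fun x => x ^+ 4) by exact: tameX.
  have t2 : tame (fun x => -2 * x ^+ 2) by apply: tameM => //; exact: tame_cst.
  have t0 := tame_cst 1.
  rewrite !gauss_meanD//; last exact: tameD.
  by rewrite gauss_meanZ// gauss_mean_pow4 gauss_mean_sqr gauss_mean_cst; ring.
have : \int[gam]_x ((x ^+ 2 + -1) * centered a d x + - 4^-1 * (x ^+ 2 + -1) ^+ 2)
    <= centered_var a d.
  apply: gauss_mean_le; last first.
  - move=> x; move: (x ^+ 2 + -1) (centered a d x) => u v.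
    by have := sqr_ge0 (v - u / 2); nra.
  - exact: tameX.
  - apply: tameD; first exact: tameM.
    by apply: tameM; [exact: tame_cst|exact: tameX].
rewrite gauss_meanD; [|exact: tameM|by apply: tameM; [exact: tame_cst|exact: tameX]].
rewrite gauss_meanZ ?h1 ?h3; last exact: tameX.
lra.
Qed.

Lemma tame_quartic : tame (fun x => (1 + x ^+ 2) ^+ 2).
Proof.
by apply: tameX; apply: tameD; [exact: tame_cst|exact: (tameX _ _ tame_id)].
Qed.

Lemma gauss_mean_quartic : \int[gam]_x ((1 + x ^+ 2) ^+ 2) = 6.
Proof.
have tx2 : tame (fun x => x ^+ 2) by exact: (tameX _ _ tame_id).
have tx4 : tame (fun x => x ^+ 4) by exact: (tameX _ _ tame_id).
have t2 : tame (fun x => 2 * x ^+ 2) by apply: tameM => //; exact: tame_cst.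
have t0 := tame_cst 1.
transitivity (\int[gam]_x (x ^+ 4 + (2 * x ^+ 2 + 1))).
  by apply: eq_Rintegral => x _; ring.
rewrite !gauss_meanD//; last exact: tameD.
by rewrite gauss_meanZ// gauss_mean_pow4 gauss_mean_sqr gauss_mean_cst; ring.
Qed.

Lemma centered_var_le : centered_var a d <= 12 + 8 * d ^+ 2.
Proof.
have tx2 : tame (fun x => x ^+ 2) by exact: (tameX _ _ tame_id).
have tq : tame (fun x => 2 * (1 + x ^+ 2) ^+ 2).
  by apply: tameM; [exact: tame_cst|exact: tame_quartic].
have tl : tame (fun x => (8 * d ^+ 2) * x ^+ 2).
  by apply: tameM; [exact: tame_cst|].
apply: (@le_trans _ _ (\int[gam]_x (2 * (1 + x ^+ 2) ^+ 2 + (8 * d ^+ 2) * x ^+ 2))).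
  apply: gauss_mean_le; first by apply: tameX; exact: tame_centered.
    exact: tameD.
  move=> x; rewrite /centered.
  have := centered0_le x; rewrite mul1r ler_norml.
  move: (lrt_coord a x - m) => k /andP[h1 h2].
  have : k ^+ 2 <= (1 + x ^+ 2) ^+ 2.
    by move: (1 + x ^+ 2) h1 h2 => w h1 h2; nra.
  by have := sqr_ge0 (k - 2 * d * x); nra.
rewrite gauss_meanD// !gauss_meanZ//; last exact: tame_quartic.
by rewrite gauss_mean_quartic gauss_mean_sqr; lra.
Qed.

Definition kernel_var_cst : R := 1728 * stein_cst ^+ 2.

Lemma kernel_var_cst_gt0 : 0 < kernel_var_cst.
Proof.
have s0 : 0 < stein_cst by have := stein_cst_ge2; lra.
by apply: mulr_gt0; [rewrite ltr0n|exact: exprn_gt0].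
Qed.

(** The part of the kernel that is quadratic in [d] is the constant [4 d^2]:
    hence the variance of the kernel grows like [d^2] and not like [d^4]. This
    is what makes the normal approximation valid for alternatives at squared
    distance of order [n] from the null. *)
Lemma stein_kernel_coord_var :
  \int[gam]_x ((stein_kernel_coord a d x - centered_var a d) ^+ 2) <=
  kernel_var_cst * (1 + d ^+ 2).
Proof.
pose c := 4 * d ^+ 2; pose v := centered_var a d.
have s2 := stein_cst_ge2.
have tT := tame_stein_kernel_coord.
have tc : tame (fun x => stein_kernel_coord a d x - c).
  by apply: tameD => //; exact: tame_cst.
have tcc : tame (fun x => (stein_kernel_coord a d x - c) ^+ 2) by exact: tameX.
have e : \int[gam]_x ((stein_kernel_coord a d x - v) ^+ 2) =
  \int[gam]_x ((stein_kernel_coord a d x - c) ^+ 2) - (v - c) ^+ 2.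
  transitivity (\int[gam]_x ((stein_kernel_coord a d x - c) ^+ 2 +
      ((-2 * (v - c)) * (stein_kernel_coord a d x - c) + (v - c) ^+ 2))).
    by apply: eq_Rintegral => x _; ring.
  have tl : tame (fun x => (-2 * (v - c)) * (stein_kernel_coord a d x - c)).
    by apply: tameM => //; exact: tame_cst.
  have t0 := tame_cst ((v - c) ^+ 2).
  rewrite !gauss_meanD//; last exact: tameD.
  rewrite gauss_meanZ// gauss_mean_cst gauss_meanD//; last exact: tame_cst.
  rewrite stein_kernel_coord_mean gauss_mean_cst -/v; ring.
rewrite e; apply: (@le_trans _ _ (\int[gam]_x ((stein_kernel_coord a d x - c) ^+ 2))).
  by rewrite gerBl sqr_ge0.
have -> : kernel_var_cst * (1 + d ^+ 2) =
    \int[gam]_x ((288 * stein_cst ^+ 2 * (1 + d ^+ 2)) * (1 + x ^+ 2) ^+ 2).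
  rewrite gauss_meanZ; last exact: tame_quartic.
  by rewrite gauss_mean_quartic /kernel_var_cst; ring.
apply: gauss_mean_le => //.
  by apply: tameM; [exact: tame_cst|exact: tame_quartic].
move=> x.
have -> : stein_kernel_coord a d x - c = kernel_factor a 0 x * centered' a 0 x +
    2 * d * (kernel_factor a 0 x + centered' a 0 x).
  by rewrite /stein_kernel_coord kernel_factorE centered'E /c; ring.
have h1 := kernel_factor_le x; have h2 := centered'0_le x.
have x0 := normr_ge0 x; have d0 := normr_ge0 d.
have : `|kernel_factor a 0 x * centered' a 0 x +
    2 * d * (kernel_factor a 0 x + centered' a 0 x)| <=
    12 * stein_cst * (1 + x ^+ 2) * (1 + `|d|).
  apply: (le_trans (ler_normD _ _)); rewrite !normrM (@ger0_norm _ 2)//.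
  apply: (@le_trans _ _ ((stein_cst + `|x|) * (2 * `|x|) +
      2 * `|d| * (stein_cst + `|x| + 2 * `|x|))).
    apply: lerD; first by apply: ler_pM.
    rewrite ler_wpM2l ?mulr_ge0// (le_trans (ler_normD _ _))// lerD//.
  rewrite -(real_normK (num_real x)).
  move: (stein_cst) (`|x|) (`|d|) s2 x0 d0 => s y e' s2 y0 e0.
  have : (s + y) * (2 * y) <= 12 * s * (1 + y ^+ 2).
    have := sqr_ge0 (y - 1); have := mulr_ge0 y0 y0; nra.
  have : 2 * (s + y + 2 * y) <= 12 * s * (1 + y ^+ 2).
    have := sqr_ge0 (y - 1); nra.
  nra.
set A := (X in `|X| <= _) => hA.
rewrite -[A ^+ 2]real_normK ?num_real//.
apply: (@le_trans _ _ ((12 * stein_cst * (1 + x ^+ 2) * (1 + `|d|)) ^+ 2)).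
  by rewrite ler_sqr ?nnegrE// (le_trans _ hA).
rewrite -(real_normK (num_real d)) -(real_normK (num_real x)) !exprMn.
have -> : 288 * stein_cst ^+ 2 * (1 + `|d| ^+ 2) * (1 + `|x| ^+ 2) ^+ 2 =
  144 * stein_cst ^+ 2 * (1 + `|x| ^+ 2) ^+ 2 * (2 * (1 + `|d| ^+ 2)) by ring.
have -> : 12 ^+ 2 = 144 :> R by ring.
apply: ler_wpM2l; first by rewrite mulr_ge0 ?sqr_ge0// mulr_ge0 ?sqr_ge0.
by have := sqr_ge0 (1 - `|d|); nra.
Qed.

End coordinate.
End gauss_calculus.

(** * Sums of independent coordinates *)

Section independence.
Context {R : realType} {d : measure_display} {Omega : measurableType d}.
Variable P : probability Omega R.

Definition indep_pair (X Y : Omega -> R) : Prop :=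
  forall A B, measurable A -> measurable B ->
  P ((X @^-1` A) `&` (Y @^-1` B)) = (P (X @^-1` A) * P (Y @^-1` B))%E.

Lemma indep_eventC (D E : set Omega) : measurable D -> measurable E ->
  P (D `&` E) = (P D * P E)%E -> P (~` D `&` E) = (P (~` D) * P E)%E.
Proof.
move=> mD mE h.
have : P E = (P (E `\` D) + P (E `&` D))%E by exact: measureDI.
rewrite probability_setC//.
have -> : E `\` D = ~` D `&` E by rewrite setDE setIC.
rewrite (setIC E D) h.
have [f1 f2] : P D \is a fin_num /\ P E \is a fin_num by split; exact: fin_num_measure.
have f3 : P (~` D `&` E) \is a fin_num.
  by apply: fin_num_measure; apply: measurableI => //; exact: measurableC.
rewrite -(fineK f1) -(fineK f2) -(fineK f3) -[1%E]/(1%:E) -EFinB -!EFinM -EFinD.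
by case=> e; congr (_%:E); lra.
Qed.

Lemma indep_event_bigcup (F : (set Omega)^nat) (E : set Omega) :
  (forall k, measurable (F k)) -> trivIset setT F -> measurable E ->
  (forall k, P (F k `&` E) = (P (F k) * P E)%E) ->
  P (\bigcup_k F k `&` E) = (P (\bigcup_k F k) * P E)%E.
Proof.
move=> mF tF mE h; rewrite setI_bigcupl !measure_bigcup//.
- rewrite muleC -(fineK (fin_num_measure P _ mE)) -nneseriesZl//.
  rewrite fineK ?fin_num_measure//.
  by apply: eq_eseriesr => n _; apply: etrans (h n) _; exact: muleC.
- by move=> k _; exact: measurableI.
- by apply: trivIset_setIr.
Qed.

(** Independence from [E] extends from rectangles to all measurable sets of the
    plane. *)
Lemma indep_event_prod (X Y : Omega -> R) (E : set Omega) :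
  measurable_fun setT X -> measurable_fun setT Y -> measurable E ->
  (forall A B, measurable A -> measurable B ->
    P ((X @^-1` A) `&` (Y @^-1` B) `&` E) =
    (P ((X @^-1` A) `&` (Y @^-1` B)) * P E)%E) ->
  forall C : set (R * R), measurable C ->
  P ((fun w => (X w, Y w)) @^-1` C `&` E) =
  (P ((fun w => (X w, Y w)) @^-1` C) * P E)%E.
Proof.
move=> mX mY mE H C mC.
set Z := fun w => (X w, Y w).
have mZ : measurable_fun setT Z by exact: measurable_fun_pair.
have mZi D : measurable D -> measurable (Z @^-1` D).
  by move=> mD; rewrite -[_ @^-1` _]setTI; exact: mZ.
pose G : set (set (R * R)) := [set D | exists A, measurable A /\
   exists B, measurable B /\ D = A `*` B].
have GE : @measurable _ (R * R)%type = <<s G >>.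
  rewrite measurable_prod_measurableType //; congr (<<s _ >>).
  rewrite predeqE; split => [[A mA [B mB <-]]|[A [mA [B [mB ->]]]]].
    by exists A; split => //; exists B.
  by exists A => //; exists B.
apply: (@dynkin_induction _ _ G
  (fun D => P (Z @^-1` D `&` E) = (P (Z @^-1` D) * P E)%E)) => //.
- move=> /= _ _ [X1 [mX1 [X2 [mX2 ->]]]] [Y1 [mY1 [Y2 [mY2 ->]]]].
  rewrite -setXI; exists (X1 `&` Y1); split; first exact: measurableI.
  by exists (X2 `&` Y2); split => //; exact: measurableI.
- by rewrite preimage_setT setTI probability_setT mul1e.
- by move=> _ [A [mA [B [mB ->]]]]; exact: H.
- by move=> S mS hS; apply: indep_eventC => //; exact: mZi.
- move=> F mF tF hF; rewrite preimage_bigcup.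
  apply: indep_event_bigcup => //; first by move=> k; exact: mZi.
  by move=> i j _ _ [w [/= Fi Fj]]; apply: (tF i j) => //; exists (Z w).
- by rewrite -GE.
Qed.

(** The joint law of an independent pair is the product of the marginals, so
    that Fubini's theorem lets one average over the first variable with the
    second one fixed. *)
Lemma indep_pair_mean0 (X Y : {mfun Omega >-> measurableTypeR R})
    (G : measurableTypeR R * measurableTypeR R -> R) :
  indep_pair X Y -> measurable_fun setT G ->
  P.-integrable setT (EFin \o (fun w => G (X w, Y w))) ->
  (forall y, \int[distribution P X]_x (G (x, y))%:E = 0)%E ->
  \int[P]_w G (X w, Y w) = 0.
Proof.
move=> iXY mG iG G0.
pose Z w : measurableTypeR R * measurableTypeR R := (X w, Y w).
have mZ : measurable_fun setT Z by exact: measurable_fun_pair.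
have prodE (C : set (measurableTypeR R * measurableTypeR R)) : measurable C ->
    (distribution P X \x distribution P Y)%E C = pushforward P Z C.
  by move=> mC; apply: product_measure_unique.
have mGE : measurable_fun setT (EFin \o G) by exact/measurable_EFinP.
have e1 := @integral_pushforward _ _ _ _ R Z mZ P setT (EFin \o G) mGE iG measurableT.
have i1 := @integrable_pushforward _ _ _ _ R Z mZ P setT (EFin \o G) mGE iG measurableT.
have e2 : (\int[(distribution P X \x distribution P Y)%E]_z (G z)%:E =
    \int[pushforward P Z]_z (G z)%:E)%E.
  by apply: eq_measure_integral => A mA _; exact: prodE.
have i2 : (distribution P X \x distribution P Y)%E.-integrable setT (EFin \o G).
  move/integrableP : i1 => [_ h]; apply/integrableP; split => //.
  apply: le_lt_trans h; rewrite le_eqVlt; apply/orP; left; apply/eqP.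
  by apply: eq_measure_integral => A mA _; exact: prodE.
rewrite /Rintegral -[X in fine X]e1 -e2 -integral21_prod_meas1//.
rewrite (_ : integral _ _ _ = 0%E)//.
by rewrite integral0_eq// => y _; exact: G0.
Qed.

Section independent_sums.
Variables (n : nat) (xi : 'I_n -> {RV P >-> R}).
Hypothesis ixi : mutually_independent xi.

Let block (J : {set 'I_n}) (B : 'I_n -> set R) : set Omega :=
  \bigcap_(i in [set` J]) (xi i @^-1` B i).

Let measurable_xi i (A : set R) : measurable A -> measurable (xi i @^-1` A).
Proof. by move=> mA; rewrite -[_ @^-1` _]setTI; exact: measurable_funPT. Qed.

Let measurable_block (J : {set 'I_n}) (B : 'I_n -> set R) :
  (forall i, measurable (B i)) -> measurable (block J B).
Proof.
by move=> mB; apply: fin_bigcap_measurable => // i _; exact: measurable_xi.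
Qed.

Definition coord_sum (f : 'I_n -> R -> R) (l : seq 'I_n) (w : Omega) : R :=
  \sum_(j <- l) f j (xi j w).

Lemma measurable_coord_sum f l : (forall j, measurable_fun setT (f j)) ->
  measurable_fun setT (coord_sum f l).
Proof.
move=> mf; rewrite /coord_sum; apply: measurable_sum => j.
exact: measurableT_comp.
Qed.

(** A partial sum is independent of every event about the remaining
    coordinates; the induction peels off one summand at a time. *)
Lemma coord_sum_indep_block (f : 'I_n -> R -> R) (l : seq 'I_n)
    (J : {set 'I_n}) (A : set R) (B : 'I_n -> set R) :
  (forall j, measurable_fun setT (f j)) -> uniq l ->
  (forall j, j \in l -> j \notin J) -> measurable A ->
  (forall i, measurable (B i)) ->
  P ((coord_sum f l @^-1` A) `&` block J B) =
  (P (coord_sum f l @^-1` A) * P (block J B))%E.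
Proof.
move=> mf; elim: l J A B => [|j l ih] J A B.
  move=> _ _ mA mB; have -> : coord_sum f [::] = cst 0.
    by apply/funext => w; rewrite /coord_sum big_nil.
  rewrite preimage_cst; case: ifPn => _.
    by rewrite setTI probability_setT mul1e.
  by rewrite set0I measure0 mul0e.
rewrite cons_uniq => /andP[jl ul] lJ mA mB.
have jJ : j \notin J by apply: lJ; rewrite mem_head.
have mE := measurable_block J _ mB.
have mS := measurable_coord_sum f l mf.
(* The constraint on coordinate j is moved into the block: the induction
   hypothesis is used for the block enlarged by j and for j alone. *)
pose upd (A1 : set R) i := if i == j then A1 else B i.
have mupd A1 i : measurable A1 -> measurable (upd A1 i).
  by rewrite /upd; case: ifP.
have blockU A1 : block (j |: J) (upd A1) = (xi j @^-1` A1) `&` block J B.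
  apply/seteqP; split => [w hw|w [hj hJ] i /=].
    split; first by have := hw j; rewrite /upd eqxx; apply => /=; rewrite setU11.
    move=> i /= iJ; have := hw i; rewrite /upd ifF; first by apply => /=; rewrite setU1r.
    by apply: contraNF jJ => /eqP <-.
  rewrite finset.in_setU1 /upd => /orP[/eqP ->|iJ]; first by rewrite eqxx.
  by rewrite ifF; [exact: hJ|apply: contraNF jJ => /eqP <-].
have block1 A1 : block [set j] (upd A1) = xi j @^-1` A1.
  apply/seteqP; split => [w hw|w hj i /=].
    by have := hw j; rewrite /upd eqxx; apply => /=; rewrite set11.
  by rewrite finset.in_set1 /upd => /eqP ->; rewrite eqxx.
pose g (z : R * R) := f j z.1 + z.2.
have mg : measurable_fun setT g.
  by apply: measurable_funD => //; apply: measurableT_comp.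
have -> : coord_sum f (j :: l) @^-1` A =
    (fun w => (xi j w, coord_sum f l w)) @^-1` (g @^-1` A).
  by apply/seteqP; split => w; rewrite /coord_sum /= big_cons.
have mgA : measurable (g @^-1` A) by rewrite -[_ @^-1` _]setTI; exact: mg.
apply: indep_event_prod => // A1 A2 mA1 mA2.
have lJ' : forall i, i \in l -> i \notin j |: J.
  move=> i il; rewrite finset.in_setU1 negb_or lJ ?in_cons ?il ?orbT// andbT.
  by apply: contraNneq jl => <-.
have lj : forall i, i \in l -> i \notin [set j]%SET.
  by move=> i il; rewrite finset.in_set1; apply: contraNneq jl => <-.
have h1 := ih _ _ _ ul lJ' mA2 (fun i => mupd A1 i mA1).
have h2 := ih _ _ _ ul lj mA2 (fun i => mupd A1 i mA1).
rewrite blockU in h1; rewrite block1 in h2.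
rewrite (setIC (xi j @^-1` A1)) -setIA h1 h2 -muleA; congr (_ * _)%E.
rewrite -blockU /block (ixi (j |: J)); last by move=> i; exact: mupd.
rewrite big_setU1//= /upd eqxx; congr (_ * _)%E.
rewrite (ixi J)//; apply: eq_bigr => i iJ.
by rewrite ifF//; apply: contraNF jJ => /eqP <-.
Qed.

End independent_sums.
End independence.

Lemma Rintegral_sum {R : realType} (d : measure_display) (T : measurableType d)
    (mu : {measure set T -> \bar R}) (I : Type) (l : seq I) (f : I -> T -> R) :
  (forall i, mu.-integrable setT (EFin \o f i)) ->
  mu.-integrable setT (EFin \o (fun x => \sum_(i <- l) f i x)) /\
  \int[mu]_x (\sum_(i <- l) f i x) = \sum_(i <- l) \int[mu]_x f i x.
Proof.
move=> fi; elim: l => [|i l [ih1 ih2]].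
  split; last first.
    by rewrite big_nil; under eq_Rintegral do rewrite big_nil; rewrite Rintegral_cst// mul0r.
  by rewrite (_ : _ \o _ = cst 0%E); [exact: integrable0|apply/funext => x /=; rewrite big_nil].
split.
  rewrite (_ : _ \o _ = (EFin \o f i) \+ (EFin \o (fun x => \sum_(i <- l) f i x)%R))%E.
    exact: integrableD.
  by apply/funext => x /=; rewrite big_cons.
rewrite big_cons -ih2 -RintegralD//.
by apply: eq_Rintegral => x _; rewrite big_cons.
Qed.

Section gaussian_coordinates.
Context {R : realType} {d : measure_display} {Omega : measurableType d}.
Variables (P : probability Omega R) (n : nat) (xi : 'I_n -> {RV P >-> R}).
Hypothesis gxi : std_gaussian xi.
Local Notation gam := (@normal_prob R 0 1).

Let mxi i : measurable_fun setT (xi i : Omega -> measurableTypeR R).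
Proof. by have h : measurable_fun setT (xi i) by []; exact: h. Qed.

Let xi' i : {mfun Omega >-> measurableTypeR R} :=
  HB.pack (xi i : Omega -> measurableTypeR R)
    (isMeasurableFun.Build _ _ _ _ _ (mxi i)).

Let law_integral i (f : R -> \bar R) :
  (\int[distribution P (xi' i)]_x f x = \int[gam]_x f x)%E.
Proof. by apply: eq_measure_integral => A mA _; exact: gxi.2. Qed.

Lemma integrable_coord i (f : R -> R) : measurable_fun setT f ->
  gam.-integrable setT (EFin \o f) ->
  P.-integrable setT (EFin \o (fun w => f (xi i w))).
Proof.
move=> mf /integrableP[_ h]; apply/integrableP; split.
  by apply/measurable_EFinP; exact: measurableT_comp.
apply: le_lt_trans h; rewrite -(law_integral i).
rewrite (ge0_integral_distribution (xi' i) (f := fun x => `|(f x)%:E|%E))//.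
by do 2 apply: measurableT_comp => //.
Qed.

Lemma mean_coord i (f : R -> R) : measurable_fun setT f ->
  gam.-integrable setT (EFin \o f) ->
  \int[P]_w f (xi i w) = \int[gam]_x f x.
Proof.
move=> mf fi; rewrite /Rintegral -(law_integral i); congr fine.
rewrite (integral_distribution (X := xi' i) (f := EFin \o f))//.
  by apply/measurable_EFinP.
exact: integrable_coord.
Qed.

Lemma coord_sum_indep (f : 'I_n -> R -> R) (l : seq 'I_n) i :
  (forall j, measurable_fun setT (f j)) -> uniq l -> i \notin l ->
  indep_pair P (xi i) (coord_sum P n xi f l).
Proof.
move=> mf ul il A B mA mB.
have lJ j : j \in l -> j \notin [set i]%SET.
  by move=> jl; rewrite finset.in_set1; apply: contraNneq il => <-.
have := coord_sum_indep_block P n xi gxi.1 f l [set i]%SET B (fun=> A)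
  mf ul lJ mB (fun=> mA).
have -> : \bigcap_(j in [set` [set i]%SET]) (xi j @^-1` A) = xi i @^-1` A.
  apply/seteqP; split => [w hw|w hw j /=]; first by apply: hw; rewrite /= set11.
  by rewrite finset.in_set1 => /eqP ->.
by rewrite setIC muleC.
Qed.

(** An identity that holds in mean for one coordinate, the sum of the others
    being frozen at any value, holds in mean on the whole space. *)
Lemma mean0_given_others (f : 'I_n -> R -> R) (l : seq 'I_n) i
    (G : measurableTypeR R * measurableTypeR R -> R) :
  (forall j, measurable_fun setT (f j)) -> uniq l -> i \notin l ->
  measurable_fun setT G ->
  P.-integrable setT (EFin \o (fun w => G (xi i w, coord_sum P n xi f l w))) ->
  (forall y, gam.-integrable setT (EFin \o (fun x => G (x, y)))) ->
  (forall y, \int[gam]_x G (x, y) = 0) ->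
  \int[P]_w G (xi i w, coord_sum P n xi f l w) = 0.
Proof.
move=> mf ul il mG iG iGy G0.
have mS := measurable_coord_sum P n xi f l mf.
have mS' : measurable_fun setT (coord_sum P n xi f l : Omega -> measurableTypeR R).
  exact: mS.
pose S : {mfun Omega >-> measurableTypeR R} :=
  HB.pack (coord_sum P n xi f l : Omega -> measurableTypeR R)
    (isMeasurableFun.Build _ _ _ _ _ mS').
apply: (indep_pair_mean0 P (xi' i) S G) => //.
  exact: coord_sum_indep.
move=> y; rewrite law_integral.
have := G0 y; rewrite /Rintegral => h.
by rewrite -[LHS]fineK ?h//; apply: integrable_fin_num => //; exact: iGy.
Qed.

End gaussian_coordinates.

Section sum_of_coordinates.
Context {R : realType} {d : measure_display} {Omega : measurableType d}.
Variables (P : probability Omega R) (n : nat) (xi : 'I_n -> {RV P >-> R}).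
Hypothesis gxi : std_gaussian xi.
Local Notation gam := (@normal_prob R 0 1).
Local Notation intP f := (P.-integrable setT (EFin \o f)).

Lemma integrable_tame_coord i (f : R -> R) : tame f -> intP (fun w => f (xi i w)).
Proof.
move=> tf; apply: (integrable_coord P n xi gxi).
  exact: measurable_tame.
exact: integrable_tame.
Qed.

Lemma mean_tame_coord i (f : R -> R) : tame f ->
  \int[P]_w f (xi i w) = \int[gam]_x f x.
Proof.
move=> tf; apply: (mean_coord P n xi gxi).
  exact: measurable_tame.
exact: integrable_tame.
Qed.

Lemma measurable_tame_coord i (f : R -> R) : tame f ->
  measurable_fun setT (fun w => f (xi i w)).
Proof. by move=> tf; apply: measurableT_comp; [exact: measurable_tame|]. Qed.

Lemma integrable_le_abs (f g : Omega -> R) : measurable_fun setT f ->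
  intP g -> (forall w, `|f w| <= g w) -> intP f.
Proof.
move=> mf ig fg; apply: le_integrable ig => //.
  exact/measurable_EFinP.
by move=> w _; rewrite lee_fin (le_trans (fg w))// ler_norm.
Qed.

Lemma integrable_coord_mul i j (f g : R -> R) : tame f -> tame g ->
  intP (fun w => f (xi i w) * g (xi j w)).
Proof.
move=> tf tg.
have mfg : measurable_fun setT (fun w => f (xi i w) * g (xi j w)).
  by apply: measurable_funM; exact: measurable_tame_coord.
have i1 : intP (fun w => f (xi i w) ^+ 2).
  by apply: (integrable_tame_coord i (fun x => f x ^+ 2)); exact: tameX.
have i2 : intP (fun w => g (xi j w) ^+ 2).
  by apply: (integrable_tame_coord j (fun x => g x ^+ 2)); exact: tameX.
apply: (integrable_le_abs _ (fun w => f (xi i w) ^+ 2 + g (xi j w) ^+ 2)) => //.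
  have -> : EFin \o (fun w => f (xi i w) ^+ 2 + g (xi j w) ^+ 2) =
    ((EFin \o (fun w => f (xi i w) ^+ 2)%R) \+ (EFin \o (fun w => g (xi j w) ^+ 2)%R))%E by [].
  exact: integrableD.
move=> w; rewrite normrM; move: (f _) (g _) => x y.
rewrite -[x ^+ 2]real_normK ?num_real// -[y ^+ 2]real_normK ?num_real//.
by have := sqr_ge0 (`|x| - `|y|); have := sqr_ge0 `|x|; have := sqr_ge0 `|y|; nra.
Qed.

Lemma uncorrelated i j (f g : R -> R) : i != j -> tame f -> tame g ->
  \int[gam]_x f x = 0 -> \int[P]_w (f (xi i w) * g (xi j w)) = 0.
Proof.
move=> ij tf tg f0.
have mg : forall k : 'I_n, measurable_fun setT g by move=> _; exact: measurable_tame.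
have il : i \notin [:: j] by rewrite mem_seq1.
pose G (z : measurableTypeR R * measurableTypeR R) : R := f z.1 * z.2.
have GE w : G (xi i w, coord_sum P n xi (fun=> g) [:: j] w) = f (xi i w) * g (xi j w).
  by rewrite /G /coord_sum /= big_seq1.
have mG : measurable_fun setT G.
  apply: measurable_funM => //; apply: measurableT_comp => //.
  exact: measurable_tame.
have iG : intP (fun w => G (xi i w, coord_sum P n xi (fun=> g) [:: j] w)).
  by under eq_fun do rewrite GE; exact: integrable_coord_mul.
have ty (y : R) : tame (fun x => f x * y) by apply: tameM => //; exact: tame_cst.
have := mean0_given_others P n xi gxi (fun=> g) [:: j] i G mg isT il mG iG.
under [X in _ -> _ -> X = _]eq_Rintegral do rewrite GE.
apply=> y; first exact: (integrable_tame _ (ty y)).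
rewrite /G /=; under eq_Rintegral do rewrite mulrC.
by rewrite gauss_meanZ// f0 mulr0.
Qed.

(** Pythagoras for mean-zero functions of distinct coordinates; used both for
    the variance of the statistic and for that of the sum of the kernels. *)
Lemma second_moment_sum (f : 'I_n -> R -> R) : (forall i, tame (f i)) ->
  (forall i, \int[gam]_x f i x = 0) ->
  intP (fun w => (\sum_(i < n) f i (xi i w)) ^+ 2) /\
  \int[P]_w ((\sum_(i < n) f i (xi i w)) ^+ 2) =
  \sum_(i < n) \int[gam]_x (f i x ^+ 2).
Proof.
move=> tf f0.
have E w : (\sum_(i < n) f i (xi i w)) ^+ 2 =
    \sum_(i < n) \sum_(j < n) (f i (xi i w) * f j (xi j w)).
  by rewrite expr2 mulr_suml; apply: eq_bigr => i _; rewrite mulr_sumr.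
have H i := Rintegral_sum _ _ P _ (index_enum 'I_n)
  (fun j w => f i (xi i w) * f j (xi j w))
  (fun j => integrable_coord_mul i j _ _ (tf i) (tf j)).
have [h1 h2] := Rintegral_sum _ _ P _ (index_enum 'I_n)
  (fun i w => \sum_(j < n) (f i (xi i w) * f j (xi j w))) (fun i => (H i).1).
split; first by under eq_fun do rewrite E.
under eq_Rintegral do rewrite E.
rewrite h2; apply: eq_bigr => i _; rewrite (H i).2 (bigD1 i)//= big1 ?addr0.
  rewrite -(mean_tame_coord i (fun x => f i x ^+ 2)); last exact: tameX.
  by apply: eq_Rintegral => w _; rewrite expr2.
by move=> j ji; apply: uncorrelated => //; rewrite eq_sym.
Qed.

End sum_of_coordinates.

(** * Stein's method for the standardized statistic *)

Section stein_bound.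
Context {R : realType} {d : measure_display} {Omega : measurableType d}.
Variables (P : probability Omega R) (n : nat) (xi : 'I_n -> {RV P >-> R}).
Hypothesis gxi : std_gaussian xi.
Local Notation gam := (@normal_prob R 0 1).
Local Notation intP f := (P.-integrable setT (EFin \o f)).
Variables (a e : 'I_n -> R).
Hypothesis a0 : forall i, 0 <= a i.
Hypothesis n0 : (0 < n)%N.

Let k i := centered (a i) (e i).
Let tau i := stein_kernel_coord (a i) (e i).
Let v i := centered_var (a i) (e i).

Let tk i : tame (k i). Proof. exact: tame_centered. Qed.
Let tt i : tame (tau i). Proof. exact: tame_stein_kernel_coord. Qed.

Definition total_var : R := \sum_(i < n) centered_var (a i) (e i).

Definition normalized_sum (w : Omega) : R :=
  (\sum_(i < n) centered (a i) (e i) (xi i w)) / Num.sqrt total_var.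

Lemma total_var_ge : n%:R / 2 <= total_var.
Proof.
rewrite -[n%:R / 2](_ : \sum_(i < n) 2^-1 = _); last first.
  by rewrite sumr_const card_ord mulr_natl.
by apply: ler_sum => i _; exact: centered_var_ge.
Qed.

Lemma total_var_gt0 : 0 < total_var.
Proof. by apply: lt_le_trans total_var_ge; rewrite divr_gt0// ltr0n. Qed.

Let sg := Num.sqrt total_var.

Let sg_gt0 : 0 < sg. Proof. by rewrite sqrtr_gt0 total_var_gt0. Qed.

Let sg2 : sg ^+ 2 = total_var. Proof. by rewrite sqr_sqrtr// ltW// total_var_gt0. Qed.

Lemma measurable_normalized_sum : measurable_fun setT normalized_sum.
Proof.
apply: measurable_funM => //; apply: measurable_sum => i.
apply: (measurable_tame_coord P n xi i (k i)); exact: tk.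
Qed.

Section test_function.
Variables (F F' : R -> R) (M : R).
Hypothesis dF : forall x, is_derive x (1 : R) F (F' x).
Hypothesis cF' : continuous F'.
Hypothesis F_le : forall x, `|F x| <= M.
Hypothesis F'_le : forall x, `|F' x| <= M.

Let cF : continuous F. Proof. exact: is_derive_continuous _ _ dF. Qed.

(** The kernel identity for coordinate [i], applied with the other coordinates
    frozen to the test function [F] of the standardized sum. *)
Lemma stein_one_coord i :
  \int[P]_w (k i (xi i w) * F (normalized_sum w) / sg -
             tau i (xi i w) * F' (normalized_sum w) / total_var) = 0.
Proof.
pose l := rem i (index_enum 'I_n).
have ul : uniq l by apply: rem_uniq; exact: index_enum_uniq.
have il : i \notin l by rewrite mem_rem_uniq ?index_enum_uniq// !inE eqxx.
have mk j : measurable_fun setT (k j) by exact: measurable_tame.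
have WE w : normalized_sum w = (k i (xi i w) + coord_sum P n xi k l w) / sg.
  rewrite /normalized_sum /coord_sum; congr (_ / _).
  have pl : perm_eq (index_enum 'I_n) (i :: l).
    by apply: perm_to_rem; exact: mem_index_enum.
  by rewrite (perm_big _ pl)/= big_cons.
pose arg (z : measurableTypeR R * measurableTypeR R) : R := (k i z.1 + z.2) / sg.
pose G (z : measurableTypeR R * measurableTypeR R) : R :=
  k i z.1 * F (arg z) / sg - tau i z.1 * F' (arg z) / total_var.
have marg : measurable_fun setT arg.
  apply: measurable_funM => //; apply: measurable_funD => //.
  by apply: measurableT_comp => //; exact: mk.
have mF : measurable_fun setT F by exact: continuous_measurable.
have mF' : measurable_fun setT F' by exact: continuous_measurable.
have mtau : measurable_fun setT (tau i) by exact: measurable_tame.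
have mG : measurable_fun setT G.
  apply: measurable_funB; apply: measurable_funM => //; apply: measurable_funM.
  - by apply: measurableT_comp => //; exact: mk.
  - by apply: measurableT_comp => //; exact: mF.
  - by apply: measurableT_comp => //; exact: mtau.
  - by apply: measurableT_comp => //; exact: mF'.
have M0 : 0 <= M by apply: le_trans (F_le 0).
have tv0 := total_var_gt0.
have bound (x y z : R) : `|k i x * F y / sg - tau i x * F' z / total_var| <=
    M / sg * `|k i x| + M / total_var * `|tau i x|.
  have H (A B s : R) : 0 < s -> `|B| <= M -> `|A * B / s| <= M / s * `|A|.
    move=> s0 BM; rewrite !normrM normfV (gtr0_norm s0).
    have -> : M / s * `|A| = `|A| * M / s by ring.
    by rewrite ler_wpM2r ?invr_ge0 ?(ltW s0)// ler_wpM2l.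
  by apply: (le_trans (ler_normB _ _)); apply: lerD; exact: H.
have iG : intP (fun w => G (xi i w, coord_sum P n xi k l w)).
  have ib : intP (fun w => M / sg * `|k i (xi i w)| + M / total_var * `|tau i (xi i w)|).
    have Hc (c : R) (f : R -> R) : tame f -> intP (fun w => c * `|f (xi i w)|).
      move=> tf; have := integrable_norm (integrable_tame_coord P n xi gxi i f tf).
      by move=> /(integrableZl measurableT c).
    have := integrableD measurableT (Hc (M / sg) _ (tk i)) (Hc (M / total_var) _ (tt i)).
    by apply: eq_integrable.
  apply: (integrable_le_abs P _ _ _ ib) => [|w]; last exact: bound.
  have mx : measurable_fun setT (xi i) by [].
  apply: (measurableT_comp mG); apply: measurable_fun_pair; first exact: mx.
  exact: (measurable_coord_sum P n xi k l mk).
have Gy (y : R) : gam.-integrable setT (EFin \o (fun x => G (x, y))) /\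
    \int[gam]_x G (x, y) = 0.
  pose u x := F ((k i x + y) / sg).
  pose u' x := centered' (a i) (e i) x / sg * F' ((k i x + y) / sg).
  have darg (x : R) : is_derive x (1 : R) (fun x => (k i x + y) / sg)
      (centered' (a i) (e i) x / sg).
    have d1 := is_derive_centered (a i) (e i) x.
    by apply: is_derive_eq; rewrite /= /GRing.scale/=; ring.
  have carg : continuous (fun x => (k i x + y) / sg).
    exact: is_derive_continuous _ _ darg.
  have du (x : R) : is_derive x (1 : R) u (u' x).
    have := is_derive1_comp (g := fun x => (k i x + y) / sg) (dF _) (darg x).
    by rewrite mulrC.
  have tu : tame u.
    split; first exact: is_derive_continuous _ _ du.
    by apply: (@poly_growth_bounded _ _ M) => x; exact: F_le.
  have tF'a : tame (fun x => F' ((k i x + y) / sg)).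
    split; last by apply: (@poly_growth_bounded _ _ M) => x; exact: F'_le.
    by move=> x; apply: (cvg_comp _ F'); [exact: carg|exact: cF'].
  have tu' : tame u'.
    apply: tameM => //; apply: tameM; [exact: tame_centered'|exact: tame_cst].
  have GE x : G (x, y) = sg^-1 * (k i x * u x) +
      - sg^-1 * (kernel_factor (a i) (e i) x * u' x).
    rewrite /G /arg /u /u' /tau /stein_kernel_coord -sg2 /=.
    by field; rewrite gt_eqF.
  have t1 : tame (fun x => k i x * u x) by exact: tameM.
  have t2 : tame (fun x => kernel_factor (a i) (e i) x * u' x).
    by apply: tameM => //; exact: tame_kernel_factor.
  have t1' := tameM _ _ (tame_cst sg^-1) t1; have t2' := tameM _ _ (tame_cst (- sg^-1)) t2.
  split.
    by under eq_fun do rewrite GE; exact: (integrable_tame _ (tameD _ _ t1' t2')).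
  under eq_Rintegral do rewrite GE.
  rewrite gauss_meanD// !gauss_meanZ//.
  by rewrite (stein_coord _ _ (a0 i) _ _ du tu tu'); ring.
have := mean0_given_others P n xi gxi k l i G mk ul il mG iG
  (fun y => (Gy y).1) (fun y => (Gy y).2).
by move=> <-; apply: eq_Rintegral => w _; rewrite WE.
Qed.

Let mW := measurable_normalized_sum.

Lemma integrable_bounded_mul i (f : R -> R) (H : R -> R) : tame f ->
  continuous H -> (forall x, `|H x| <= M) ->
  intP (fun w => f (xi i w) * H (normalized_sum w)).
Proof.
move=> tf cH HM.
have M0 : 0 <= M by apply: le_trans (HM 0).
have ib : intP (fun w => M * `|f (xi i w)|).
  have := integrable_norm (integrable_tame_coord P n xi gxi i f tf).
  by move=> /(integrableZl measurableT M).
apply: (integrable_le_abs P _ _ _ ib).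
  apply: measurable_funM; first exact: (measurable_tame_coord P n xi).
  by apply: measurableT_comp; [exact: continuous_measurable|exact: mW].
by move=> w; rewrite normrM mulrC ler_wpM2r.
Qed.

(** Summing over the coordinates, the standardized sum satisfies Stein's
    identity up to the replacement of the constant [1] by the ratio of the sum
    of the kernels to its mean. *)
Lemma stein_discrepancy :
  intP (fun w => normalized_sum w * F (normalized_sum w) -
    (\sum_(i < n) tau i (xi i w)) * F' (normalized_sum w) / total_var) /\
  \int[P]_w (normalized_sum w * F (normalized_sum w) -
    (\sum_(i < n) tau i (xi i w)) * F' (normalized_sum w) / total_var) = 0.
Proof.
pose f i w := k i (xi i w) * F (normalized_sum w) / sg -
             tau i (xi i w) * F' (normalized_sum w) / total_var.
have intf i : intP (f i).
  have i1 := integrable_bounded_mul i _ _ (tk i) cF F_le.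
  have i2 := integrable_bounded_mul i _ _ (tt i) cF' F'_le.
  have := integrableB measurableT (integrableZl measurableT sg^-1 i1)
    (integrableZl measurableT total_var^-1 i2).
  by apply: eq_integrable => // w _; rewrite /f/= -!EFinM -EFinB 2!(mulrC _^-1).
have [h1 h2] := Rintegral_sum _ _ P _ (index_enum 'I_n) f intf.
have fE w : \sum_(i < n) f i w = normalized_sum w * F (normalized_sum w) -
    (\sum_(i < n) tau i (xi i w)) * F' (normalized_sum w) / total_var.
  rewrite /f sumrB -!mulr_suml; congr (_ - _).
  by rewrite {2}/normalized_sum mulrAC.
split; first by under eq_fun do rewrite -fE.
under eq_Rintegral do rewrite -fE.
by rewrite h2 big1// => i _; exact: stein_one_coord.
Qed.

End test_function.

Let ksum : R := kernel_var_cst * (n%:R + \sum_(i < n) e i ^+ 2).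

(** Plugging the Stein solution of [h] into the previous identity leaves
    [E (F' (W) (1 - sum of kernels / variance))]. As [F'] is bounded, this is at
    most a constant times the standard deviation of the sum of the kernels over
    the variance. *)
Lemma stein_bound_continuous (h : R -> R) : continuous h ->
  (forall x, 0 <= h x <= 1) ->
  `|\int[P]_w h (normalized_sum w) - \int[gam]_x h x| <=
  (stein_cst + 1) * Num.sqrt ksum / total_var.
Proof.
move=> ch h01.
have ph : poly_growth h.
  by apply: (@poly_growth_bounded _ _ 1) => x; have /andP[? ?] := h01 x; rewrite ger0_norm.
have th : tame h by [].
pose m := \int[gam]_x h x; pose kh x := h x - m.
have m01 : 0 <= m <= 1.
  apply/andP; split; first by apply: Rintegral_ge0 => x _; have /andP[] := h01 x.
  rewrite -[leRHS]gauss_mean_cst; apply: gauss_mean_le => //; first exact: tame_cst.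
  by move=> x; have /andP[] := h01 x.
have tkh : tame kh by apply: tameD => //; exact: tame_cst.
have kh0 : \int[gam]_x kh x = 0.
  by rewrite /kh gauss_meanD//; [rewrite gauss_mean_cst subrr|exact: tame_cst].
have kh1 x : `|kh x| <= 1.
  have /andP[? ?] := h01 x; have /andP[? ?] := m01.
  by rewrite ler_norml; apply/andP; split; rewrite /kh; lra.
pose M := stein_cst (R := R) + 1; pose F := stein_sol kh.
pose F' x := x * F x + kh x.
have dF x : is_derive x (1 : R) F (F' x).
  exact: (is_derive_stein_sol _ tkh.1 tkh.2).
have Fb x := stein_sol_bounded _ tkh.1 tkh.2 kh0 kh1 x.
have F_le x : `|F x| <= M by rewrite (le_trans (Fb x).1)// lerDl.
have F'_le x : `|F' x| <= M.
  by apply: (le_trans (ler_normD _ _)); apply: lerD; [exact: (Fb x).2|exact: kh1].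
have cF' : continuous F'.
  move=> x; apply: cvgD; last exact: tkh.1.
  by apply: cvgM; [exact: cvg_id|exact: (is_derive_continuous _ _ dF)].
have [i1 z1] := stein_discrepancy F F' M dF cF' F_le F'_le.
have mW := measurable_normalized_sum.
have ikh : intP (fun w => kh (normalized_sum w)).
  apply: (integrable_le_abs P _ (cst 1)).
  - by apply: measurableT_comp => //; exact: measurable_tame.
  - exact: finite_measure_integrable_cst.
  - by move=> w; exact: kh1.
have ih : intP (fun w => h (normalized_sum w)).
  apply: (integrable_le_abs P _ (cst 1)).
  - by apply: measurableT_comp => //; exact: measurable_tame.
  - exact: finite_measure_integrable_cst.
  - by move=> w; have /andP[? ?] := h01 (normalized_sum w); rewrite ger0_norm.
have -> : \int[P]_w h (normalized_sum w) - m = \int[P]_w kh (normalized_sum w).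
  rewrite RintegralB//; last exact: finite_measure_integrable_cst.
  by rewrite Rintegral_cst//= probability_setT mulr1.
pose Q w := (\sum_(i < n) (tau i (xi i w) - v i)) ^+ 2.
have tv0 := total_var_gt0.
pose Z w := F' (normalized_sum w) * (1 - (\sum_(i < n) tau i (xi i w)) / total_var).
have ZE w : Z w = kh (normalized_sum w) + (normalized_sum w * F (normalized_sum w) -
    (\sum_(i < n) tau i (xi i w)) * F' (normalized_sum w) / total_var).
  by rewrite /Z /F'; ring.
have iZ : intP Z.
  have -> : Z = (fun w => kh (normalized_sum w) +
      (normalized_sum w * F (normalized_sum w) -
       (\sum_(i < n) tau i (xi i w)) * F' (normalized_sum w) / total_var)).
    by apply/funext.
  exact: (integrableD measurableT ikh i1).
have -> : \int[P]_w kh (normalized_sum w) = \int[P]_w Z w.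
  rewrite -[LHS]addr0 -z1 -RintegralD//.
  by apply: eq_Rintegral => w _; rewrite ZE.
have tf i : tame (fun x => tau i x - v i) by apply: tameD; [exact: tt|exact: tame_cst].
have f0 i : \int[gam]_x (tau i x - v i) = 0.
  rewrite gauss_meanD; [|exact: tt|exact: tame_cst].
  by rewrite gauss_mean_cst (stein_kernel_coord_mean _ _ (a0 i)) subrr.
have [iQ eQ] := second_moment_sum P n xi gxi _ tf f0.
have Q_le : \int[P]_w Q w <= ksum.
  rewrite eQ /ksum mulrDr mulr_natr mulr_sumr -[n in _ *+ n]card_ord -sumr_const.
  rewrite -big_split/=; apply: ler_sum => i _.
  by have := stein_kernel_coord_var _ (e i) (a0 i); rewrite mulrDr mulr1.
have ksum0 : 0 < ksum.
  apply: mulr_gt0; first exact: kernel_var_cst_gt0.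
  by rewrite ltr_wpDr ?ltr0n// sumr_ge0// => i _; exact: sqr_ge0.
pose eps := Num.sqrt ksum; have eps0 : 0 < eps by rewrite sqrtr_gt0.
have eps2 : eps ^+ 2 = ksum by rewrite sqr_sqrtr// ltW.
have M0 : 0 <= M by apply: le_trans (F_le 0).
(* Cauchy-Schwarz is used in the form 2 |y| <= y^2 / eps + eps, with eps the
   bound on the standard deviation of the sum of the kernels. *)
pose c := M / total_var / 2.
have c0 : 0 <= c by rewrite !divr_ge0// ltW.
have ie : intP (fun=> eps) by exact: finite_measure_integrable_cst.
have iB : intP (fun w => c * (eps^-1 * Q w + eps)).
  have := integrableZl measurableT c (integrableD measurableT
    (integrableZl measurableT eps^-1 iQ) ie).
  by apply: eq_integrable => // w _ /=; rewrite -EFinM -EFinD -EFinM.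
have ZB w : `|Z w| <= c * (eps^-1 * Q w + eps).
  have -> : Z w = F' (normalized_sum w) / total_var *
      - (\sum_(i < n) (tau i (xi i w) - v i)).
    by rewrite /Z sumrB -/total_var; field; rewrite gt_eqF.
  rewrite /Q; move: (\sum_(i < n) _) => y.
  rewrite !normrM normrN normfV (gtr0_norm tv0).
  have hy : `|y| <= 2^-1 * (eps^-1 * y ^+ 2 + eps).
    rewrite -(real_normK (num_real y)).
    have -> : 2^-1 * (eps^-1 * `|y| ^+ 2 + eps) =
        `|y| + 2^-1 * eps^-1 * (`|y| - eps) ^+ 2 by field; rewrite gt_eqF.
    by rewrite lerDl mulr_ge0 ?sqr_ge0// mulr_ge0// invr_ge0 ltW.
  apply: (@le_trans _ _ (M / total_var * (2^-1 * (eps^-1 * y ^+ 2 + eps)))).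
    by apply: ler_pM => //; [rewrite divr_ge0// ltW|rewrite ler_wpM2r// invr_ge0 ltW].
  by rewrite /c -!mulrA.
apply: (le_trans (le_normr_Rintegral measurableT iZ)).
apply: (@le_trans _ _ (\int[P]_w (c * (eps^-1 * Q w + eps)))).
  by apply: le_Rintegral => //; exact: integrable_norm.
have iQ' : intP (fun w => eps^-1 * Q w).
  by have := integrableZl measurableT eps^-1 iQ; apply: eq_integrable.
rewrite RintegralZl//; last first.
  have := integrableD measurableT iQ' ie.
  by apply: eq_integrable.
rewrite RintegralD//.
rewrite RintegralZl// Rintegral_cst//= probability_setT mulr1.
have -> : M * eps / total_var = c * (eps^-1 * ksum + eps).
  by rewrite -eps2 /c; field; rewrite !gt_eqF.
by rewrite ler_wpM2l// lerD2r ler_wpM2l// invr_ge0 ltW.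
Qed.

End stein_bound.

(** * From continuous test functions to Borel sets *)

Section continuous_test_functions.
Context {R : realType}.
Local Notation MR := (measurableTypeR R).
Variables (I : finType) (m : I -> probability MR R).
Local Notation int b f := ((m b).-integrable setT (EFin \o f)).

Let int_bounded b (f : R -> R) (c : R) : measurable_fun setT f ->
  (forall x, `|f x| <= c) -> int b f.
Proof.
move=> mf fc.
have ic : int b (cst c) by exact: finite_measure_integrable_cst.
apply: (le_integrable _ _ _ ic) => //; first exact/measurable_EFinP.
by move=> x _; rewrite lee_fin (le_trans (fc x))// ler_norm.
Qed.

Let dominated_to0 (g : nat -> R -> R) : (forall n, measurable_fun setT (g n)) ->
  (forall n x, 0 <= g n x <= 1) -> (forall x, g n x @[n --> \oo] --> 0) ->
  forall e, 0 < e -> exists n, forall b, \int[m b]_x g n x <= e.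
Proof.
move=> mg g01 g0 e e0.
have H b : \forall n \near \oo, \int[m b]_x g n x <= e.
  have h : (\int[m b]_x (g n x)%:E)%E @[n --> \oo] --> (\int[m b]_x (cst 0 x))%E.
    apply: (@dominated_cvg _ _ _ (m b) setT measurableT _ _ (cst 1%E)).
    - by move=> n; apply/measurable_EFinP; exact: mg.
    - by move=> x _; apply: cvg_EFin; [exact: nearW|exact: g0].
    - by [].
    - exact: finite_measure_integrable_cst.
    - by move=> n x _; rewrite lee_fin; have /andP[? ?] := g01 n x; rewrite ger0_norm.
  rewrite integral0 in h.
  have h' : \int[m b]_x g n x @[n --> \oo] --> (0 : R) by exact: fine_cvg h.
  move/cvgr0Pnorm_le : h' => /(_ e e0); apply: filterS => n.
  by apply: le_trans; exact: ler_norm.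
have [n _ hn] : \forall n \near \oo, forall b, \int[m b]_x g n x <= e.
  by apply: filter_forall => b; exact: H.
by exists n => b; exact: (hn n (leqnn n)).
Qed.

Definition continuous_approx (B : set R) := forall e, 0 < e ->
  exists h : R -> R, [/\ continuous h, forall x, 0 <= h x <= 1 &
    forall b, \int[m b]_x `|h x - \1_B x| <= e].

Let indic01 (B : set R) (x : R) : 0 <= (\1_B x : R) <= 1.
Proof. by rewrite indicE; case: (_ \in _); rewrite ?lexx ler01. Qed.

Let int_diff b (h : R -> R) (B : set R) : measurable_fun setT h -> measurable B ->
  (forall x, 0 <= h x <= 1) -> int b (fun x => `|h x - \1_B x|).
Proof.
move=> mh mB h01; apply: (int_bounded b _ 1) => [|x].
  by apply: measurableT_comp => //; apply: measurable_funB => //.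
have /andP[? ?] := h01 x; have /andP[? ?] := indic01 B x.
by rewrite normr_id ler_norml; apply/andP; split; lra.
Qed.

Let approx_ray (x : R) : continuous_approx `]x, +oo[.
Proof.
move=> e e0.
pose h (n : nat) (y : R) := Num.min 1 (Num.max 0 (n%:R * (y - x))).
have ch n : continuous (h n).
  move=> y; rewrite /h.
  apply: (@continuous_min R R (cst 1) (fun y => Num.max 0 (n%:R * (y - x)))).
    exact: cvg_cst.
  apply: (@continuous_max R R (cst 0) (fun y => n%:R * (y - x))).
    exact: cvg_cst.
  apply: cvgM; first exact: cvg_cst.
  by apply: cvgB; [exact: cvg_id|exact: cvg_cst].
have h01 n y : 0 <= h n y <= 1.
  by rewrite /h le_min ler01 le_max lexx/= ge_min lexx.
have mray : measurable (`]x, +oo[%classic : set MR) by exact: measurable_itv.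
have mh n : measurable_fun setT (h n) by exact: continuous_measurable.
have [|||n hn] := dominated_to0 (fun n y => `|h n y - \1_(`]x, +oo[) y|) _ _ _ e e0.
- move=> n; apply: measurableT_comp => //; apply: measurable_funB => //.
- move=> n y; have /andP[? ?] := h01 n y; have /andP[? ?] := indic01 `]x, +oo[ y.
  by rewrite normr_ge0 ler_norml; apply/andP; split; lra.
- move=> y; apply: cvg_near_cst; near=> n.
  rewrite indicE mem_setE in_itv/= andbT /h.
  have [yx|yx] := leP y x.
    rewrite max_l ?min_r ?subrr ?normr0//.
    by rewrite mulr_ge0_le0// subr_le0.
  have nx : 1 <= n%:R * (y - x).
    rewrite -ler_pdivrMr ?subr_gt0//; near: n; exact: nbhs_infty_ger.
  by rewrite max_r ?min_l ?subrr ?normr0// (le_trans _ nx).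
by exists (h n); split.
Unshelve. all: by end_near. Qed.

Let approxC (B : set R) : measurable B -> continuous_approx B ->
  continuous_approx (~` B).
Proof.
move=> mB aB e e0; have [h [ch h01 hB]] := aB e e0.
exists (fun x => 1 - h x); split.
- by move=> x; apply: cvgB; [exact: cvg_cst|exact: ch].
- by move=> x; have /andP[? ?] := h01 x; apply/andP; split; lra.
- move=> b; apply: le_trans (hB b); rewrite le_eqVlt; apply/orP; left; apply/eqP.
  apply: eq_Rintegral => x _; rewrite !indicE in_setC -normrN; congr `|_|.
  by case: (x \in B) => /=; ring.
Qed.

Let approx0 : continuous_approx set0.
Proof.
move=> e e0; exists (cst 0); split.
- by move=> x; exact: cvg_cst.
- by move=> x; rewrite lexx ler01.
- move=> b; rewrite (_ : Rintegral _ _ _ = 0) ?ltW//.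
  transitivity (\int[m b]_x (0 : R)); last by rewrite Rintegral_cst// mul0r.
  by apply: eq_Rintegral => x _; rewrite indic0 subrr normr0.
Qed.

Let normr_max_sub (a b c d : R) :
  `|Num.max a b - Num.max c d| <= `|a - c| + `|b - d|.
Proof.
have := ler_norm (a - c); have := ler_norm (b - d).
have := ler_norm (- (a - c)); have := ler_norm (- (b - d)).
rewrite !normrN ler_norml => *.
by case: (lerP a b) => ?; case: (lerP c d) => ?; apply/andP; split; lra.
Qed.

Let approxU (A B : set R) : measurable A -> measurable B ->
  continuous_approx A -> continuous_approx B -> continuous_approx (A `|` B).
Proof.
move=> mA mB aA aB e e0.
have e20 : 0 < e / 2 by rewrite divr_gt0.
have [h [ch h01 hA]] := aA _ e20; have [g [cg g01 gB]] := aB _ e20.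
exists (fun x => Num.max (h x) (g x)).
have cm : continuous (fun x => Num.max (h x) (g x)).
  by move=> x; apply: (@continuous_max R R h g); [exact: ch|exact: cg].
have m01 x : 0 <= Num.max (h x) (g x) <= 1.
  have /andP[? ?] := h01 x; have /andP[? ?] := g01 x.
  by rewrite le_max ge_max; apply/andP; split; apply/orP || apply/andP; [left|split].
split => // b.
have mh : measurable_fun setT h by exact: continuous_measurable.
have mg : measurable_fun setT g by exact: continuous_measurable.
have mm : measurable_fun setT (fun x => Num.max (h x) (g x)).
  exact: continuous_measurable.
have iA := int_diff b h A mh mA h01; have iB := int_diff b g B mg mB g01.
have iAB := int_diff b _ (A `|` B) mm (measurableU _ _ mA mB) m01.
apply: (@le_trans _ _ (\int[m b]_x (`|h x - \1_A x| + `|g x - \1_B x|))).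
  apply: le_Rintegral => //; first exact: (integrableD measurableT iA iB).
  move=> x _; have -> : (\1_(A `|` B) x : R) = Num.max (\1_A x) (\1_B x).
    rewrite !indicE in_setU.
    by case: (x \in A); case: (x \in B); rewrite /= maxEle ?lexx ?ler01 ?ler10.
  exact: normr_max_sub.
rewrite RintegralD//.
by rewrite [leRHS](splitr e); apply: lerD; [exact: hA|exact: gB].
Qed.

Let approx_bigcup (F : (set R)^nat) : (forall k, measurable (F k)) ->
  (forall k, continuous_approx (F k)) -> continuous_approx (\bigcup_k F k).
Proof.
move=> mF aF e e0.
pose S n := \bigcup_(k < n) F k.
have mU : measurable (\bigcup_k F k) by exact: bigcupT_measurable.
have mS n : measurable (S n) by exact: bigcup_measurable.
have aS n : continuous_approx (S n).
  elim: n => [|n ih].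
    by rewrite /S (_ : \bigcup_(k < 0) _ = set0); [exact: approx0|rewrite bigcup0].
  have -> : S n.+1 = F n `|` S n.
    by rewrite /S bigcup_mkord big_ord_recr/= setUC -bigcup_mkord.
  exact: approxU.
have e20 : 0 < e / 2 by rewrite divr_gt0.
have [|||n hn] := dominated_to0 (fun n y => `|\1_(S n) y - \1_(\bigcup_k F k) y|)
  _ _ _ _ e20.
- by move=> n; apply: measurableT_comp => //; apply: measurable_funB => //.
- move=> n y; have /andP[? ?] := indic01 (S n) y.
  have /andP[? ?] := indic01 (\bigcup_k F k) y.
  by rewrite normr_ge0 ler_norml; apply/andP; split; lra.
- move=> y; apply: cvg_near_cst.
  have [[k _ Fk]|yU] := pselect ((\bigcup_k F k) y).
    near=> n.
    have Sn : S n y by exists k => //=; near: n; exact: nbhs_infty_gt.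
    have Un : (\bigcup_k F k) y by exists k.
    by rewrite !indicE (mem_set Sn) (mem_set Un) subrr normr0.
  near=> n; have yS : ~ S n y by move=> [k _ Fk]; apply: yU; exists k.
  by rewrite !indicE (memNset yS) (memNset yU) subrr normr0.
have [h [ch h01 hS]] := aS n _ e20.
exists h; split => // b.
have mh : measurable_fun setT h by exact: continuous_measurable.
have i1 := int_diff b h (S n) mh (mS n) h01.
have i2 := int_diff b _ _ (measurable_indic (mS n)) mU (indic01 (S n)).
have i3 := int_diff b h _ mh mU h01.
apply: (@le_trans _ _ (\int[m b]_x
    (`|h x - \1_(S n) x| + `|\1_(S n) x - \1_(\bigcup_k F k) x|))).
  apply: le_Rintegral => //; first exact: (integrableD measurableT i1 i2).
  by move=> x _; rewrite (le_trans _ (ler_normD _ _))// addrA subrK.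
rewrite RintegralD//.
by rewrite [leRHS](splitr e); apply: lerD; [exact: hS|exact: hn].
Unshelve. all: by end_near. Qed.

(** By a pi-lambda argument starting from rays. Approximating for several laws
    at once is what allows two of them to be compared. *)
Lemma measurable_continuous_approx (B : set MR) : measurable B -> continuous_approx B.
Proof.
move=> mB.
refine (@dynkin_induction _ MR (@RGenOInfty.G R) continuous_approx _ _ _ _ _ _ B _).
- exact: RGenOInfty.measurableE.
- move=> _ _ [x ->] [y ->]; exists (Num.max x y).
  apply/seteqP; split => z /=; rewrite !in_itv/= !andbT gt_max.
    by move=> [-> ->].
  by move=> /andP[].
- by rewrite -setC0; apply: approxC => //; exact: approx0.
- by move=> _ [x ->]; exact: approx_ray.
- exact: approxC.
- by move=> F mF _; exact: approx_bigcup.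
- by have := mB; rewrite RGenOInfty.measurableE.
Qed.

End continuous_test_functions.

Lemma probability_test_le {R : realType} (mu nu : probability (measurableTypeR R) R)
    (c : R) :
  (forall h : R -> R, continuous h -> (forall x, 0 <= h x <= 1) ->
    `|\int[mu]_x h x - \int[nu]_x h x| <= c) ->
  forall B : set (measurableTypeR R), measurable B -> `|fine (mu B) - fine (nu B)| <= c.
Proof.
move=> H B mB; apply/ler_addgt0Pr => e e0.
have e20 : 0 < e / 2 by rewrite divr_gt0.
pose m (b : bool) := if b then mu else nu.
have [h [ch h01 hB]] := measurable_continuous_approx bool m B mB _ e20.
have mh : measurable_fun setT h by exact: continuous_measurable.
have key b : `|fine (m b B) - \int[m b]_x h x| <= e / 2.
  apply: le_trans (hB b).
  have ic : (m b).-integrable setT (cst 1%E) by exact: finite_measure_integrable_cst.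
  have ih : (m b).-integrable setT (EFin \o h).
    apply: (le_integrable _ _ _ ic) => //; first exact/measurable_EFinP.
    by move=> x _; rewrite lee_fin normr1; have /andP[? ?] := h01 x; rewrite ger0_norm.
  have iB : (m b).-integrable setT (EFin \o (\1_B : R -> R)).
    by apply: integrable_indic.
  have -> : fine (m b B) = \int[m b]_x (\1_B x).
    by rewrite /Rintegral integral_indic// setIT.
  rewrite -normrN opprB -RintegralB//.
  by apply: le_normr_Rintegral => //; exact: (integrableB measurableT ih iB).
have := key true; have := key false; have := H h ch h01; rewrite /m /= !ler_norml.
by move=> /andP[? ?] /andP[? ?] /andP[? ?]; apply/andP; split; lra.
Qed.

(** * Normal approximation of the likelihood ratio statistic *)

Section total_variation.
Context {R : realType} {d : measure_display} {Omega : measurableType d}.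
Variables (P : probability Omega R) (n : nat) (xi : 'I_n -> {RV P >-> R}).
Hypothesis gxi : std_gaussian xi.
Local Notation gam := (@normal_prob R 0 1).
Variables (a e : 'I_n -> R).
Hypothesis a0 : forall i, 0 <= a i.
Hypothesis n0 : (0 < n)%N.
Local Notation W := (normalized_sum P n xi a e).

(** Since [total_var] is at least [n / 2], this is of order [n^(-1/2)] as soon
    as the sum of the [e i ^+ 2] is of order [n]. *)
Definition stein_rate : R :=
  (stein_cst + 1) * Num.sqrt (kernel_var_cst * (n%:R + \sum_(i < n) e i ^+ 2)) /
  total_var n a e.

Lemma normalized_sum_tv (B : set R) : measurable B ->
  `|fine (P (W @^-1` B)) - fine (gam B)| <= stein_rate.
Proof.
move=> mB.
have mW : measurable_fun setT (W : Omega -> measurableTypeR R).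
  exact: (measurable_normalized_sum P n xi a e a0).
pose X : {mfun Omega >-> measurableTypeR R} :=
  HB.pack (W : Omega -> measurableTypeR R) (isMeasurableFun.Build _ _ _ _ _ mW).
pose mu : probability (measurableTypeR R) R := distribution P X.
apply: (probability_test_le mu gam stein_rate _ B mB) => h ch h01.
have -> : \int[mu]_x h x = \int[P]_w h (W w).
  have mh : measurable_fun setT (EFin \o h).
    by apply/measurable_EFinP; exact: continuous_measurable.
  rewrite /Rintegral (integral_distribution (X := X) (f := EFin \o h))//.
  have ic : P.-integrable setT (cst 1%E) by exact: finite_measure_integrable_cst.
  apply: (le_integrable _ _ _ ic) => //; first exact: (measurableT_comp mh mW).
  by move=> w _; rewrite lee_fin normr1; have /andP[? ?] := h01 (W w); rewrite ger0_norm.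
exact: stein_bound_continuous.
Qed.

End total_variation.

Section likelihood_ratio.
Context {R : realType} {d : measure_display} {Omega : measurableType d}.
Local Notation gam := (@normal_prob R 0 1).

Lemma enorm_sqr (n : nat) (x : 'rV[R]_n) : enorm x ^+ 2 = \sum_(i < n) x 0 i ^+ 2.
Proof. by rewrite sqr_sqrtr// sumr_ge0// => i _; exact: sqr_ge0. Qed.

(** The projection onto the orthant acts coordinatewise, by taking positive
    parts: it is the minimizer because each coordinate is minimized. *)
Lemma metric_proj_orthant_dist (n : nat) (y : 'rV[R]_n) :
  enorm (y - metric_proj (orthant R n) y) ^+ 2 = \sum_(i < n) negsq (y 0 i).
Proof.
pose q : 'rV[R]_n := \row_i Num.max (y 0 i) 0.
have qi i : (y - q) 0 i = Num.min (y 0 i) 0.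
  by rewrite !mxE; case: (lerP (y 0 i) 0) => _; ring.
have Kq : orthant R n q by move=> i; rewrite mxE le_max lexx orbT.
have qmin p : orthant R n p -> enorm (y - q) <= enorm (y - p).
  move=> Kp; apply: ler_wsqrtr; apply: ler_sum => i _; rewrite qi !mxE.
  move: (y 0 i) (p 0 i) (Kp i) => u v v0; case: (lerP u 0) => u0.
    have := mulr_ge0 v0 (_ : 0 <= - u); rewrite oppr_ge0 => /(_ u0).
    by have := sqr_ge0 v; nra.
  by rewrite expr0n sqr_ge0.
have [Kp pmin] : [set p | orthant R n p /\
    forall r, orthant R n r -> enorm (y - p) <= enorm (y - r)]
    (metric_proj (orthant R n) y).
  by apply: xgetPex; exists q.
have -> : enorm (y - metric_proj (orthant R n) y) = enorm (y - q).
  by apply/eqP; rewrite eq_le pmin// qmin.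
by rewrite enorm_sqr; apply: eq_bigr => i _; rewrite qi.
Qed.

Variables (P : probability Omega R) (n : nat) (xi : 'I_n -> {RV P >-> R}).
Hypothesis gxi : std_gaussian xi.
Variables mu0 mu : 'rV[R]_n.
Hypothesis mu_ge0 : orthant R n mu.

Let a i := mu 0 i.
Let e i := mu 0 i - mu0 0 i.

Definition lrt_mean : R := \sum_(i < n) (lrt_coord_mean (mu 0 i) + (mu 0 i - mu0 0 i) ^+ 2).

Lemma T_plusE (w : Omega) : T_plus mu0 (obs xi mu w) =
  \sum_(i < n) centered (a i) (e i) (xi i w) + lrt_mean.
Proof.
rewrite /T_plus /lrt metric_proj_orthant_dist enorm_sqr -sumrB -big_split/=.
apply: eq_bigr => i _; rewrite /obs !mxE /centered /lrt_coord /a /e; ring.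
Qed.

Let tc i : tame (centered (a i) (e i)). Proof. exact: tame_centered. Qed.

Let sum_facts := Rintegral_sum _ _ P _ (index_enum 'I_n)
  (fun i w => centered (a i) (e i) (xi i w))
  (fun i => integrable_tame_coord P n xi gxi i _ (tc i)).

Lemma lrt_meanE : mean_T xi mu0 mu = lrt_mean.
Proof.
rewrite /mean_T unlock -/(Rintegral _ _ _).
under eq_Rintegral do rewrite T_plusE.
have [h1 h2] := sum_facts.
rewrite RintegralD//; last exact: finite_measure_integrable_cst.
rewrite h2 Rintegral_cst//= probability_setT mulr1 big1 ?add0r// => i _.
by rewrite (mean_tame_coord P n xi gxi)// centered_mean.
Qed.

Lemma sd_TE : sd_T xi mu0 mu = Num.sqrt (total_var n a e).
Proof.
rewrite /sd_T; congr Num.sqrt.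
have [h1 h2] := second_moment_sum P n xi gxi _ tc
  (fun i => centered_mean _ (mu_ge0 i) (e i)).
rewrite [RHS](_ : _ = \int[P]_w ((\sum_(i < n) centered (a i) (e i) (xi i w)) ^+ 2)).
  have := lrt_meanE; rewrite /mean_T unlock => mE.
  rewrite /variance unlock unlock mE; apply: eq_Rintegral => w _ /=.
  transitivity ((T_plus mu0 (obs xi mu w) - lrt_mean) ^+ 2); first by [].
  by rewrite T_plusE addrK.
by rewrite h2.
Qed.

End likelihood_ratio.

(** * The normal distribution function and its quantiles *)

Section normal_cdf.
Context {R : realType}.
Local Notation gam := (@normal_prob R 0 1).
Local Notation phi := (@normal_pdf R 0 1).
Local Notation Phi := (@std_normal_cdf R).
Local Notation leb := (@lebesgue_measure R).

Lemma std_normal_cdfE (x : R) : Phi x = stein_prim (cst 1) x.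
Proof.
rewrite /std_normal_cdf /stein_prim /Rintegral /normal_prob.
by congr fine; apply: eq_integral => y _; rewrite mul1r.
Qed.

Lemma is_derive_std_normal_cdf (x : R) : is_derive x (1 : R) Phi (phi x).
Proof.
have -> : Phi = stein_prim (cst 1) by apply/funext => y; exact: std_normal_cdfE.
have h := is_derive_stein_prim (cst 1) (tame_cst 1).1 (tame_cst 1).2 x.
by apply: (is_derive_eq h); rewrite mul1r.
Qed.

Lemma continuous_std_normal_cdf : continuous Phi.
Proof. exact: is_derive_continuous _ _ is_derive_std_normal_cdf. Qed.

Lemma std_normal_cdf_tails :
  (Phi n%:R @[n --> \oo] --> (1 : R)) * (Phi (- n%:R) @[n --> \oo] --> 0).
Proof.
have i1 : leb.-integrable setT (EFin \o phi) by exact: integrable_normal_pdf.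
have [h1 h2] := cvg_integral_tails _ i1.
have E : \int[leb]_x phi x = 1 by rewrite /Rintegral integral_normal_pdf.
rewrite E in h1.
have e (x : R) : \int[leb]_(y in `]-oo, x]) phi y = Phi x by [].
by split.
Qed.

Lemma fine_gauss (B : set R) : measurable B -> gam B = (fine (gam B))%:E.
Proof.
by move=> mB; rewrite fineK//; exact: (fin_num_measure (normal_prob 0 1)).
Qed.

Lemma fine_gaussC (B : set R) : measurable B -> fine (gam (~` B)) = 1 - fine (gam B).
Proof.
move=> mB; have := @probability_setC _ _ R (normal_prob 0 1) B mB.
have f : gam B \is a fin_num by exact: (fin_num_measure (normal_prob 0 1)).
by move=> ->; rewrite fineB.
Qed.

Lemma gauss_setN (B : set R) : measurable B ->
  fine (gam [set x | B (- x)]) = fine (gam B).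
Proof.
move=> mB.
have mN : measurable [set x : R | B (- x)].
  have mo : measurable_fun setT (-%R : R -> R) by [].
  by have := mo measurableT B mB; rewrite setTI.
have H (A : set R) : measurable A -> fine (gam A) = \int[gam]_x (\1_A x).
  by move=> mA; rewrite /Rintegral integral_indic// setIT.
rewrite !H// -[RHS]gauss_sym; [|exact: measurable_indic|exact: integrable_indic].
by apply: eq_Rintegral => x _.
Qed.

Lemma gauss_Ny_open (x : R) : fine (gam `]-oo, x[) = Phi x.
Proof.
rewrite /std_normal_cdf; congr fine; rewrite /normal_prob.
apply: integral_itv_bndo_bndc; apply/measurable_EFinP/measurable_funTS.
exact: measurable_normal_pdf.
Qed.

Lemma gauss_ccdf (x : R) : fine (gam `[x, +oo[) = 1 - Phi x.
Proof. by rewrite -gauss_Ny_open -fine_gaussC// setCitvl. Qed.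

Lemma std_normal_cdfN (x : R) : Phi (- x) = 1 - Phi x.
Proof.
rewrite -gauss_ccdf -gauss_setN//; congr (fine (gam _)).
by apply/seteqP; split => y /=; rewrite !in_itv/= ?andbT lerNr.
Qed.

Lemma std_normal_cdf_increasing (x y : R) : x < y -> Phi x < Phi y.
Proof.
move=> xy; have [||c] := @MVT R Phi phi x y xy.
- by move=> z _; exact: is_derive_std_normal_cdf.
- by apply: continuous_subspaceT; exact: continuous_std_normal_cdf.
by move=> _ e; rewrite -subr_gt0 e mulr_gt0 ?subr_gt0// phi_gt0.
Qed.

Lemma std_normal_cdf_ge0 (x : R) : 0 <= Phi x.
Proof. by rewrite fine_ge0. Qed.

(** Existence of the quantile by the intermediate value theorem. *)
Lemma z_spec (a : R) : 0 < a < 1 -> Phi (z_ a) = 1 - a.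
Proof.
move=> /andP[a0 a1].
suff [z hz] : exists z : R, gam `[z, +oo[ = a%:E.
  have : gam `[z_ a, +oo[ = a%:E.
    by apply: (@xgetPex _ 0 [set z : R | gam `[z, +oo[%classic = a%:E]); exists z.
  by move=> h; have := gauss_ccdf (z_ a); rewrite h /=; lra.
have [t1 t2] := std_normal_cdf_tails.
have e0 : 0 < Num.min a (1 - a) by rewrite lt_min a0 subr_gt0.
have [n [hn1 hn2]] : exists n : nat, 1 - a <= Phi n%:R /\ Phi (- n%:R) <= 1 - a.
  near \oo => n; exists n; split.
    have : `|1 - Phi n%:R| <= Num.min a (1 - a).
      near: n; move/cvgrPdist_le : t1; exact.
    rewrite le_min => /andP[+ _]; have := ler_norm (1 - Phi n%:R); lra.
  have : `|0 - Phi (- n%:R)| <= Num.min a (1 - a).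
    near: n; move/cvgrPdist_le : t2; exact.
  rewrite le_min sub0r normrN => /andP[_]; exact: le_trans (ler_norm _).
have nn : - n%:R <= n%:R :> R by rewrite -subr_ge0 opprK addr_ge0.
have [||z _ hz] := @IVT R Phi (- n%:R) n%:R (1 - a) nn.
- apply: continuous_subspaceT; exact: continuous_std_normal_cdf.
- by rewrite ge_min hn2 le_max hn1 orbT.
exists z; rewrite fine_gauss ?gauss_ccdf//; first by rewrite hz; congr EFin; ring.
Unshelve. all: by end_near. Qed.

Lemma z_gt0 (a : R) : 0 < a < 2^-1 -> 0 < z_ a.
Proof.
move=> /andP[a0 a1]; have := z_spec a; rewrite a0/= => /(_ _) h.
have {}h : Phi (z_ a) = 1 - a by apply: h; lra.
rewrite ltNge; apply/negP => z0.
have : Phi (z_ a) <= Phi 0.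
  move: z0; rewrite le_eqVlt => /predU1P[->//|/std_normal_cdf_increasing/ltW//].
have := std_normal_cdfN 0; rewrite oppr0 h; lra.
Qed.

Lemma two_sidedE (z : R) : [set x | z < `|x|] = ~` `[- z, z]%classic.
Proof.
apply/seteqP; split => x /=; rewrite in_itv/= -ler_norml ltNge.
  by move/negP.
by move/negP.
Qed.

Lemma gauss_itvcc (x y : R) : x <= y -> fine (gam `[x, y]) = Phi y - Phi x.
Proof.
move=> xy.
have h : gam `]-oo, y] = (gam `]-oo, x[ + gam `[x, y])%E.
  rewrite -measureU//.
    by rewrite -itv_bndbnd_setU// bnd_simp.
  by apply/seteqP; split => // t [/=]; rewrite !in_itv/= => ? /andP[]; lra.
have f1 : gam `]-oo, x[ \is a fin_num.
  exact: (fin_num_measure (normal_prob 0 1)).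
have f2 : gam `[x, y] \is a fin_num.
  exact: (fin_num_measure (normal_prob 0 1)).
have -> : Phi y = fine (gam `]-oo, x[) + fine (gam `[x, y]).
  rewrite -(fineD f1 f2).
  exact: (congr1 fine h).
by rewrite gauss_Ny_open addrAC subrr add0r.
Qed.

Lemma gauss_two_sided (z : R) : 0 <= z -> fine (gam [set x | z < `|x|]) = 2 * (1 - Phi z).
Proof.
move=> z0; rewrite two_sidedE fine_gaussC// gauss_itvcc; last by lra.
by rewrite std_normal_cdfN; lra.
Qed.

End normal_cdf.

(** * The function Splus *)

Section Splus_properties.
Context {R : realType}.
Local Notation gam := (@normal_prob R 0 1).
Local Notation phi := (@normal_pdf R 0 1).
Local Notation Phi := (@std_normal_cdf R).
Local Notation leb := (@lebesgue_measure R).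

Lemma tame_negsq_shift (a : R) : tame (fun x => negsq (a + x)).
Proof.
have ta : tame (fun x => a + x) by apply: tameD; [exact: tame_cst|exact: tame_id].
split.
  move=> x; apply: (cvg_comp (fun x => a + x) negsq); [exact: ta.1|exact: tame_negsq.1].
apply: (poly_growth_le _ (fun x => (a + x) ^+ 2)); last exact: poly_growthX ta.2.
move=> x; rewrite !ger0_norm ?sqr_ge0//.
by have := negsq_le 0 (a + x) (lexx _); rewrite add0r.
Qed.

Lemma lrt_coord_meanE (a : R) :
  lrt_coord_mean a = 1 - \int[gam]_x negsq (a + x).
Proof.
rewrite /lrt_coord_mean /lrt_coord gauss_meanD; last first.
- exact: tameN (tame_negsq_shift a).
- exact: tameX tame_id.
rewrite gauss_mean_sqr; congr (_ + _).
under eq_Rintegral do rewrite -mulN1r.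
by rewrite gauss_meanZ ?mulN1r//; exact: tame_negsq_shift.
Qed.

(** Both sides have the same derivative and vanish at minus infinity. *)
Lemma stein_prim_shift_sqr (a y : R) :
  stein_prim (fun x => (a + x) ^+ 2) y = (a ^+ 2 + 1) * Phi y - (2 * a + y) * phi y.
Proof.
have tk : tame (fun x => (a + x) ^+ 2).
  by apply: tameX; apply: tameD; [exact: tame_cst|exact: tame_id].
have tl : tame (fun x => 2 * a + x).
  by apply: tameD; [exact: tame_cst|exact: tame_id].
pose A x := (a ^+ 2 + 1) * Phi x - (2 * a + x) * phi x.
have d1 (x : R) : is_derive x (1 : R)
    (fun x => stein_prim (fun x => (a + x) ^+ 2) x - A x) 0.
  have h1 := is_derive_stein_prim (fun x => (a + x) ^+ 2) tk.1 tk.2 x.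
  have h2 := is_derive_std_normal_cdf x; have h3 := is_derive_phi x.
  by rewrite /A; apply: is_derive_eq; rewrite /= /GRing.scale/=; ring.
have k0 : stein_prim (fun x => (a + x) ^+ 2) (- n%:R) - A (- n%:R) @[n --> \oo]
    --> (0 : R).
  rewrite -[X in _ --> X](subr0 0); apply: cvgB.
    have ik : leb.-integrable setT (EFin \o (fun x => (a + x) ^+ 2 * phi x)).
      apply/integrable_gaussP; first exact: measurable_tame.
      exact: integrable_tame.
    exact: (cvg_integral_tails _ ik).2.
  rewrite -[X in _ --> X](subr0 0); apply: cvgB.
    rewrite -[X in _ --> X](mulr0 (a ^+ 2 + 1)).
    by apply: cvgM; [exact: cvg_cst|exact: std_normal_cdf_tails.2].
  have [C hC] := poly_growth_vanish _ tl.2.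
  exact: (cvg_le_inv (fun x => (2 * a + x) * phi x) C hC).2.
have := tail_domination _ (fun=> 0) (fun=> 0) (fun=> 0) y (fun x _ => d1 x)
  (fun x _ => is_derive_cst _ _ _) _ k0 (cvg_cst _) y (lexx y).
rewrite normr0 normr_le0 => /(_ (fun x _ => lexx _) _).
by rewrite subr_eq0 => h; apply/eqP; apply: h.
Qed.

Lemma gauss_mean_negsq_shift (a : R) : \int[gam]_x negsq (a + x) =
  (a ^+ 2 + 1) * Phi (- a) - a * phi (- a).
Proof.
have tn := tame_negsq_shift a.
have -> : (a ^+ 2 + 1) * Phi (- a) - a * phi (- a) =
    stein_prim (fun x => (a + x) ^+ 2) (- a).
  by rewrite stein_prim_shift_sqr; ring.
rewrite Rintegral_gauss; [|exact: measurable_tame|exact: integrable_tame].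
rewrite /stein_prim [RHS]Rintegral_mkcond; apply: eq_Rintegral => x _.
rewrite patchE mem_setE in_itv/=; case: ifPn => [xa|/negbTE xa].
  by rewrite /negsq min_l// -lerBrDl sub0r.
by rewrite /negsq min_r ?expr0n ?mul0r//; move/negbT: xa; rewrite -ltNge; lra.
Qed.

(** The probabilistic meaning of [Splus]: up to a constant it is the mean
    contribution of a coordinate to the statistic. Monotonicity, concavity and
    boundedness are read off the integrand. *)
Lemma SplusE (a : R) : Splus a = 2^-1 - \int[gam]_x negsq (a + x).
Proof.
by rewrite gauss_mean_negsq_shift /Splus std_normal_cdfN phiN; lra.
Qed.

Lemma lrt_coord_mean_Splus (a : R) : lrt_coord_mean a = Splus a + 2^-1.
Proof. by rewrite SplusE lrt_coord_meanE; lra. Qed.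

Lemma Splus0 : Splus (0 : R) = 0.
Proof.
rewrite SplusE; under eq_Rintegral do rewrite add0r.
by rewrite gauss_mean_negsq subrr.
Qed.

Lemma Splus_bounds (a : R) : 0 <= a -> - 2^-1 <= Splus a <= 2^-1.
Proof.
move=> a0; have := lrt_coord_mean_le1 _ a0; have := lrt_coord_mean_ge0 _ a0.
by rewrite lrt_coord_mean_Splus => *; apply/andP; split; lra.
Qed.

(** The function [min (x, 0)] is concave with nonpositive values, a region where
    the square is decreasing; the square is itself convex. *)
Lemma negsq_shift_convex (t x y z : R) : 0 <= t <= 1 ->
  negsq (t * x + (1 - t) * y + z) <= t * negsq (x + z) + (1 - t) * negsq (y + z).
Proof.
move=> /andP[t0 t1].
have -> : t * x + (1 - t) * y + z = t * (x + z) + (1 - t) * (y + z) by ring.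
move: (x + z) (y + z) => u v; have s0 : 0 <= 1 - t by lra.
have minle (w : R) : Num.min w 0 <= w /\ Num.min w 0 <= 0.
  by rewrite !ge_min !lexx orbT.
pose U := Num.min u 0; pose V := Num.min v 0.
have [u1 u2] := minle u; have [v1 v2] := minle v.
have h : negsq (t * u + (1 - t) * v) <= (t * U + (1 - t) * V) ^+ 2.
  rewrite /negsq; set m := Num.min _ _.
  have m0 : m <= 0 by rewrite ge_min lexx orbT.
  have lm : t * U + (1 - t) * V <= m.
    rewrite le_min; apply/andP; split; first by rewrite lerD// ler_wpM2l.
    by rewrite -oppr_ge0 opprD addr_ge0// -mulrN mulr_ge0// oppr_ge0.
  by rewrite -sqrrN -[leRHS]sqrrN ler_sqr ?nnegrE ?oppr_ge0 ?lerN2// (le_trans lm).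
apply: (le_trans h); rewrite /negsq -/U -/V.
have -> : t * U ^+ 2 + (1 - t) * V ^+ 2 =
  (t * U + (1 - t) * V) ^+ 2 + t * (1 - t) * (U - V) ^+ 2 by ring.
by rewrite lerDl mulr_ge0 ?sqr_ge0// mulr_ge0.
Qed.

Lemma Splus_convex : convex_function (`[0, +oo[%classic : set R^o)
  (fun x : R^o => - Splus x : R^o).
Proof.
move=> t x y _ _; rewrite !convRE.
have t01 : 0 <= t%:num <= 1 by apply/andP; split.
have T (b : R) := tame_negsq_shift b.
have Tc (c b : R) := tameM _ _ (tame_cst c) (T b).
have : \int[gam]_z negsq (t%:num * x + (1 - t%:num) * y + z) <=
    \int[gam]_z (t%:num * negsq (x + z) + (1 - t%:num) * negsq (y + z)).
  apply: gauss_mean_le => [||z]; [exact: T|exact: tameD|].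
  exact: negsq_shift_convex.
rewrite gauss_meanD// !gauss_meanZ// !SplusE.
rewrite [conv t x y](_ : _ = t%:num * x + (1 - t%:num) * y)// /unstable.onem.
move: (\int[gam]_z negsq (_ + _)) (\int[gam]_z negsq (x + _)) (\int[gam]_z _).
by move=> A B C h; lra.
Qed.

(** The integrand is nonincreasing in the shift, and decreases by at least
    [(y - x)^2] on the ray where [y + z <= 0], which has positive mass. *)
Lemma Splus_increasing : {in `[0, +oo[ &, {homo @Splus R : x y / x < y}}.
Proof.
move=> x y; rewrite !in_itv/= !andbT => x0 y0 xy.
rewrite !SplusE ltrD2l ltrN2.
have T (b : R) := tame_negsq_shift b.
have Tc (b : R) := tameM _ _ (tame_cst (-1)) (T b).
have TT := tameD _ _ (T x) (Tc y).
have p0 : 0 < Phi (- y).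
  have := std_normal_cdf_increasing (- y - 1) (- y); have := std_normal_cdf_ge0 (- y - 1).
  by move=> h1 h2; apply: le_lt_trans h1 (h2 _); lra.
have e1 : Phi (- y) = \int[gam]_z (\1_(`]-oo, (- y)] : set R) z).
  by rewrite /Rintegral integral_indic// setIT.
have : (y - x) ^+ 2 * Phi (- y) <= \int[gam]_z (negsq (x + z) + -1 * negsq (y + z)).
  rewrite e1 -RintegralZl//; last exact: integrable_indic.
  apply: le_Rintegral => //.
  - have := integrableZl measurableT ((y - x) ^+ 2)
      (integrable_indic (normal_prob 0 1) (measurable_itv `]-oo, (- y)])).
    by apply: eq_integrable.
  - exact: integrable_tame.
  - move=> z _; rewrite indicE mem_setE in_itv/= /negsq.
    case: (lerP z (- y)) => zy.
      by rewrite mulr1 !min_l; nra.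
    rewrite mulr0 mulN1r subr_ge0.
    by case: (lerP (y + z) 0) => ?; case: (lerP (x + z) 0) => ?; nra.
rewrite gauss_meanD// gauss_meanZ// mulN1r => h.
have : 0 < (y - x) ^+ 2 * Phi (- y) by rewrite mulr_gt0// exprn_gt0// subr_gt0.
lra.
Qed.

Lemma Splus_bounded : [bounded Splus x : R^o | x in (`[0, +oo[%classic : set R)].
Proof.
exists 1; split => // M M1 x /=; rewrite in_itv/= andbT => x0.
have /andP[? ?] := Splus_bounds _ x0.
apply: (@le_trans _ _ 1); last exact: ltW.
by rewrite ler_norml; apply/andP; split; lra.
Qed.

End Splus_properties.

(** * Distribution and level under the null *)

Section test_level.
Context {R : realType}.
Local Notation gam := (@normal_prob R 0 1).

Definition tv_cst (A : R) : R := 2 * (stein_cst + 1) * Num.sqrt (kernel_var_cst * (1 + A)).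

Lemma tv_cst_gt0 (A : R) : 0 <= A -> 0 < tv_cst A.
Proof.
move=> A0; have s2 := @stein_cst_ge2 R.
have s1 : 0 < (stein_cst : R) + 1 by lra.
apply: mulr_gt0; first exact: mulr_gt0.
by rewrite sqrtr_gt0 mulr_gt0// ?kernel_var_cst_gt0// ltr_pwDl.
Qed.

Lemma stein_rate_le (n : nat) (a e : 'I_n -> R) (A : R) : (0 < n)%N ->
  (forall i, 0 <= a i) -> 0 <= A -> \sum_(i < n) e i ^+ 2 <= A * n%:R ->
  stein_rate n a e <= tv_cst A / Num.sqrt n%:R.
Proof.
move=> n0 a0 A0 eA; have s2 := @stein_cst_ge2 R.
have nR : (0 : R) < n%:R by rewrite ltr0n.
have sn : 0 < Num.sqrt (n%:R : R) by rewrite sqrtr_gt0.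
have k0 := @kernel_var_cst_gt0 R.
have tv := total_var_ge n a e a0; have tv0 := total_var_gt0 n a e a0 n0.
rewrite /stein_rate ler_pdivrMr//.
apply: (@le_trans _ _ (tv_cst A / Num.sqrt n%:R * (n%:R / 2))); last first.
  rewrite ler_wpM2l// divr_ge0//; exact: ltW (tv_cst_gt0 _ A0).
have -> : tv_cst A / Num.sqrt n%:R * (n%:R / 2) =
    (stein_cst + 1) * (Num.sqrt (kernel_var_cst * (1 + A)) * Num.sqrt n%:R).
  rewrite /tv_cst -[X in _ * (X / 2)](@sqr_sqrtr _ n%:R) ?ltW//.
  by field; rewrite gt_eqF.
rewrite ler_wpM2l//; first by lra.
rewrite -sqrtrM; last by apply: mulr_ge0; [exact: ltW|rewrite addr_ge0].
apply: ler_wsqrtr; rewrite -(mulrA kernel_var_cst); apply: ler_wpM2l; first exact: ltW.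
by rewrite mulrDl mul1r lerD2l.
Qed.

Context {d : measure_display} {Omega : measurableType d}.
Variables (P : probability Omega R) (n : nat) (xi : 'I_n -> {RV P >-> R}).
Hypothesis gxi : std_gaussian xi.
Variables mu0 mu : 'rV[R]_n.
Hypotheses (mu0_ge0 : orthant R n mu0) (mu_ge0 : orthant R n mu).

Local Notation W := (normalized_sum P n xi (mu 0) (fun i => mu 0 i - mu0 0 i)).

Lemma normalized_TE (w : Omega) :
  (T_plus mu0 (obs xi mu w) - mean_T xi mu0 mu) / sd_T xi mu0 mu = W w.
Proof.
rewrite (lrt_meanE P n xi gxi mu0 mu mu_ge0) (sd_TE P n xi gxi mu0 mu mu_ge0).
by rewrite T_plusE addrK.
Qed.

Lemma measurable_T : measurable_fun setT (fun w => T_plus mu0 (obs xi mu w)).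
Proof.
under eq_fun do rewrite T_plusE.
apply: measurable_funD => //; apply: measurable_sum => i.
by apply: (measurable_tame_coord P n xi i); exact: tame_centered.
Qed.

Lemma power_tsE (alpha : R) : power_ts xi alpha mu0 mu =
  P [set w | z_ (alpha / 2) <
    `|T_plus mu0 (obs xi mu w) - mean_T xi mu0 mu0| / sd_T xi mu0 mu0].
Proof.
set A := [set w | _].
have mA : measurable A.
  pose b w := z_ (alpha / 2) <
      `|T_plus mu0 (obs xi mu w) - mean_T xi mu0 mu0| / sd_T xi mu0 mu0.
  have mb : measurable_fun setT b.
    apply: measurable_fun_ltr => //; apply: measurable_funM => //.
    apply: measurableT_comp => //; apply: measurable_funB => //.
    exact: measurable_T.
  have -> : A = setT `&` (b @^-1` [set true]) by rewrite setTI; apply/seteqP; split.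
  exact: mb.
rewrite /power_ts -(expectation_indic _ mA); congr expectation.
apply/funext => w; rewrite /Psi_ts indicE; congr (_%:R).
case: (boolP (_ < _)) => E; first by rewrite mem_set.
by rewrite memNset//; exact/negP.
Qed.

End test_level.

Section null_distribution.
Context {R : realType} {d : measure_display} {Omega : measurableType d}.
Local Notation gam := (@normal_prob R 0 1).
Variables (P : probability Omega R) (n : nat) (xi : 'I_n -> {RV P >-> R}).
Hypotheses (n0 : (0 < n)%N) (gxi : std_gaussian xi).
Variables mu0 mu : 'rV[R]_n.
Hypotheses (mu0_ge0 : orthant R n mu0) (mu_ge0 : orthant R n mu).
Let T (w : Omega) : R :=
  (T_plus mu0 (obs xi mu w) - mean_T xi mu0 mu) / sd_T xi mu0 mu.

Lemma T_tv (A : R) : 0 <= A -> enorm (mu - mu0) ^+ 2 <= A * n%:R ->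
  forall B : set R, measurable B ->
  `|fine (P (T @^-1` B)) - fine (gam B)| <= tv_cst A / Num.sqrt n%:R.
Proof.
move=> A0 hA B mB.
have -> : T = normalized_sum P n xi (mu 0) (fun i => mu 0 i - mu0 0 i).
  by apply/funext => w; exact: normalized_TE.
apply: (le_trans (normalized_sum_tv P n xi gxi _ _ mu_ge0 n0 B mB)).
apply: stein_rate_le => //; apply: le_trans hA.
by rewrite enorm_sqr; apply: ler_sum => i _; rewrite !mxE.
Qed.

Lemma measurable_normalized_T : measurable_fun setT T.
Proof.
apply: measurable_funM => //; apply: measurable_funB => //.
exact: measurable_T.
Qed.

End null_distribution.

Section theorem_part1.
Context {R : realType} {d : measure_display} {Omega : measurableType d}.
Local Notation gam := (@normal_prob R 0 1).
Variables (P : probability Omega R) (n : nat) (xi : 'I_n -> {RV P >-> R}).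
Hypotheses (n0 : (0 < n)%N) (gxi : std_gaussian xi).
Variables mu0 : 'rV[R]_n.
Hypotheses (mu0_ge0 : orthant R n mu0).

Let enorm0 : enorm (mu0 - mu0) ^+ 2 <= 0 * n%:R.
Proof. by rewrite enorm_sqr mul0r big1// => i _; rewrite !mxE subrr expr0n. Qed.

Let X (w : Omega) : R :=
  (T_plus mu0 (obs xi mu0 w) - mean_T xi mu0 mu0) / sd_T xi mu0 mu0.

Let null_tv (B : set R) : measurable B ->
  (`|P (X @^-1` B) - gam B| <= (tv_cst 0 / Num.sqrt n%:R)%:E)%E.
Proof.
move=> mB; have mX := measurable_normalized_T P n xi mu0 mu0.
have mXB : measurable (X @^-1` B) by rewrite -[_ @^-1` _]setTI; exact: mX.
have f1 : P (X @^-1` B) \is a fin_num by exact: fin_num_measure.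
rewrite (fine_gauss _ mB) -(fineK f1) -EFinB lee_fin.
exact: (T_tv P n xi n0 gxi mu0 mu0 mu0_ge0 0 (lexx _) enorm0 B mB).
Qed.

Lemma null_dTV :
  (dTV (pushforward P (fun w =>
          (T_plus mu0 (obs xi mu0 w) - mean_T xi mu0 mu0) / sd_T xi mu0 mu0)%R)
       (normal_prob 0 1)
   <= (tv_cst 0 / Num.sqrt n%:R)%:E)%E.
Proof. by apply: ge_ereal_sup => _ [B mB <-]; exact: null_tv. Qed.

Lemma null_level (alpha : R) : 0 < alpha < 1 ->
  (`|power_ts xi alpha mu0 mu0 - alpha%:E| <= (tv_cst 0 / Num.sqrt n%:R)%:E)%E.
Proof.
move=> /andP[al0 al1]; set z := z_ (alpha / 2).
have mz : measurable [set x : R | z < `|x|] by rewrite two_sidedE; exact: measurableC.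
have -> : power_ts xi alpha mu0 mu0 = P (X @^-1` [set x | z < `|x|]).
  rewrite power_tsE//; congr (P _); apply/seteqP; split => w /=;
    by rewrite /X normrM normfV (ger0_norm (sqrtr_ge0 _)).
suff -> : alpha%:E = gam [set x | z < `|x|] by exact: null_tv.
have z0 : 0 < z by apply: z_gt0; apply/andP; split; lra.
rewrite fine_gauss// gauss_two_sided ?(ltW z0)// z_spec; last by apply/andP; split; lra.
by congr EFin; lra.
Qed.

End theorem_part1.

(** * Power of the two-sided test *)

Section power.
Context {R : realType} {d : measure_display} {Omega : measurableType d}.
Local Notation gam := (@normal_prob R 0 1).
Local Notation phi := (@normal_pdf R 0 1).
Local Notation Phi := (@std_normal_cdf R).
Variables (P : probability Omega R) (n : nat) (xi : 'I_n -> {RV P >-> R}).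
Hypotheses (n0 : (0 < n)%N) (gxi : std_gaussian xi).
Variables mu0 mu : 'rV[R]_n.
Hypotheses (mu0_ge0 : orthant R n mu0) (mu_ge0 : orthant R n mu).

Definition mean_shift : R :=
  \sum_(i < n) (Splus (mu 0 i) - Splus (mu0 0 i)) + enorm (mu - mu0) ^+ 2.

(** The quantity that governs the power is the displacement of the mean of the
    statistic. *)
Lemma mean_shiftE : mean_shift = mean_T xi mu0 mu - mean_T xi mu0 mu0.
Proof.
rewrite !(lrt_meanE P n xi gxi)// /lrt_mean /mean_shift enorm_sqr.
rewrite -sumrB -big_split/=; apply: eq_bigr => i _.
by rewrite !lrt_coord_mean_Splus !mxE subrr; ring.
Qed.

(** Each difference of values of [Splus] is at least [-1]. *)
Lemma enorm_sqr_le_shift : enorm (mu - mu0) ^+ 2 <= `|mean_shift| + n%:R.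
Proof.
have h : - n%:R <= \sum_(i < n) (Splus (mu 0 i) - Splus (mu0 0 i)).
  rewrite -[n in n%:R]card_ord -sumr_const -sumrN; apply: ler_sum => i _.
  have /andP[? ?] := Splus_bounds _ (mu_ge0 i).
  by have /andP[? ?] := Splus_bounds _ (mu0_ge0 i); lra.
have := ler_norm mean_shift; rewrite {1}/mean_shift; lra.
Qed.

Lemma enorm_sqr_le_bound (A : R) : 0 <= A -> `|mean_shift| <= A * Num.sqrt n%:R ->
  enorm (mu - mu0) ^+ 2 <= (A + 1) * n%:R.
Proof.
move=> A0 hD; have nR : (1 : R) <= n%:R by rewrite ler1n.
have sn1 : 1 <= Num.sqrt (n%:R : R) by rewrite -[leLHS]sqrtr1; apply: ler_wsqrtr.
have snn : Num.sqrt (n%:R : R) ^+ 2 = n%:R by rewrite sqr_sqrtr.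
apply: (le_trans enorm_sqr_le_shift); rewrite mulrDl mul1r lerD2r.
apply: (le_trans hD); rewrite ler_wpM2l// -[leRHS]snn expr2 ler_peMl//; lra.
Qed.

Let sd2 (nu : 'rV[R]_n) : orthant R n nu ->
  sd_T xi mu0 nu ^+ 2 = total_var n (nu 0) (fun i => nu 0 i - mu0 0 i).
Proof.
move=> nu0; rewrite (sd_TE P n xi gxi)// sqr_sqrtr//.
by apply: ltW; exact: total_var_gt0.
Qed.

Lemma sd_T_bounds (nu : 'rV[R]_n) : orthant R n nu ->
  n%:R / 2 <= sd_T xi mu0 nu ^+ 2 <= 12 * n%:R + 8 * enorm (nu - mu0) ^+ 2.
Proof.
move=> nu0; rewrite sd2//; apply/andP; split; first exact: total_var_ge.
rewrite enorm_sqr mulr_sumr mulr_natr -[n in _ *+ n]card_ord -sumr_const -big_split/=.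
apply: ler_sum => i _; rewrite !mxE; exact: centered_var_le.
Qed.

Lemma sd_T_gt0 (nu : 'rV[R]_n) : orthant R n nu -> 0 < sd_T xi mu0 nu.
Proof.
move=> nu0; rewrite (sd_TE P n xi gxi)// sqrtr_gt0; exact: total_var_gt0.
Qed.

Lemma sd_T_null_bounds :
  n%:R / 2 <= sd_T xi mu0 mu0 ^+ 2 <= 12 * n%:R.
Proof.
have := sd_T_bounds _ mu0_ge0.
by rewrite subrr enorm_sqr big1 ?mulr0 ?addr0// => i _; rewrite mxE expr0n.
Qed.

Variable alpha : R.
Local Notation z := (z_ (alpha / 2)).
Local Notation pw := (power_ts xi alpha mu0 mu).

Let T w := T_plus mu0 (obs xi mu w).
Let accept : set Omega := [set w | `|T w - mean_T xi mu0 mu0| <= z * sd_T xi mu0 mu0].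

Let maccept : measurable accept.
Proof.
pose b w := `|T w - mean_T xi mu0 mu0| <= z * sd_T xi mu0 mu0.
have mb : measurable_fun setT b.
  apply: measurable_fun_ler => //; apply: measurableT_comp => //.
  by apply: measurable_funB => //; exact: measurable_T.
have -> : accept = setT `&` (b @^-1` [set true]) by rewrite setTI; apply/seteqP; split.
exact: mb.
Qed.

Lemma power_accept : pw = (1 - P accept)%E.
Proof.
rewrite power_tsE// -probability_setC//; congr (P _).
apply/seteqP; split => w /=; rewrite /accept /= ltr_pdivlMr ?sd_T_gt0// ltNge.
  by move/negP.
by move/negP.
Qed.

Lemma power_fine : pw = (1 - fine (P accept))%:E.
Proof.
by rewrite power_accept EFinB fineK//; exact: fin_num_measure.
Qed.

Lemma power_fin_num_le1 : pw \is a fin_num /\ fine pw <= 1.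
Proof.
rewrite power_fine; split => //=; rewrite gerBl fine_ge0//.
Qed.

Let standardized_shift_le (D s q A : R) : 0 < s -> 0 <= q -> 0 <= A ->
  `|D| <= A * q -> q ^+ 2 / 2 <= s ^+ 2 -> `|- D / s| <= 2 * A.
Proof.
move=> s0 q0 A0 hD hs; rewrite normrM normrN normfV (gtr0_norm s0) ler_pdivrMr//.
have qs : q <= 2 * s.
  rewrite -ler_sqr ?nnegrE ?mulr_ge0 ?(ltW s0)//.
  have := sqr_ge0 s; rewrite exprMn; lra.
apply: (le_trans hD); have -> : 2 * A * s = A * (2 * s) by ring.
exact: ler_wpM2l.
Qed.

Let shifted_interval (t m0 m1 D s l c1 : R) : 0 < s -> D = m1 - m0 -> l * s <= c1 ->
  - D / s - l <= (t - m1) / s -> (t - m1) / s <= - D / s + l -> `|t - m0| <= c1.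
Proof.
move=> s0 -> ls; rewrite ler_pdivrMr// ler_pdivlMr// mulrBl mulrDl divfK ?gt_eqF//.
by move=> h1 h2; rewrite ler_norml; apply/andP; split; lra.
Qed.

Let chain_le (t p g r q : R) : - t <= p - g -> r <= g -> p <= q -> r - t <= q.
Proof. by move=> ? ? ?; lra. Qed.

Let itv_nonempty (c l : R) : 0 < l -> c - l < c + l.
Proof. by move=> ?; lra. Qed.

Let norm_in_itv (c l y b : R) : `|c| <= b -> c - l < y -> y < c + l -> `|y| <= b + l.
Proof. by rewrite !ler_norml => /andP[? ?] ? ?; apply/andP; split; lra. Qed.

Let far_from_mean (t m0 m1 D b c : R) : D = m1 - m0 ->
  `|t - m0| <= b -> 2 * b <= `|D| -> 2 * c <= `|D| -> c <= `|t - m1|.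
Proof.
move=> E h hb hc; have : `|D| <= `|t - m0| + `|t - m1|.
  rewrite (_ : D = (t - m0) - (t - m1)); last by rewrite E; ring.
  exact: ler_normB.
lra.
Qed.

(** Anti-concentration at the normal scale: an acceptance interval of length
    comparable to the standard deviation, at bounded standardized distance from
    the mean, keeps a probability bounded away from zero. *)
Lemma accept_lower (A l : R) : 0 <= A -> 0 < l -> `|mean_shift| <= A * Num.sqrt n%:R ->
  l * sd_T xi mu0 mu <= z * sd_T xi mu0 mu0 ->
  l * 2 * phi (2 * A + l) - tv_cst (A + 1) / Num.sqrt n%:R <= fine (P accept).
Proof.
move=> A0 l0 hD hl.
have snn : Num.sqrt (n%:R : R) ^+ 2 = n%:R by rewrite sqr_sqrtr.
have s0 := sd_T_gt0 _ mu_ge0.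
have /andP[s2l s2u] := sd_T_bounds _ mu_ge0.
have hE := enorm_sqr_le_bound _ A0 hD.
set c := - mean_shift / sd_T xi mu0 mu.
have cA : `|c| <= 2 * A.
  have h2 : Num.sqrt (n%:R : R) ^+ 2 / 2 <= sd_T xi mu0 mu ^+ 2 by rewrite snn.
  exact: (standardized_shift_le mean_shift _ _ A s0 (sqrtr_ge0 n%:R) A0 hD h2).
pose B : set R := `[c - l, c + l]%classic.
have mB : measurable B by exact: measurable_itv.
have sub : (fun w => (T w - mean_T xi mu0 mu) / sd_T xi mu0 mu) @^-1` B `<=` accept.
  move=> w; rewrite /B /accept /= in_itv/= => /andP[h1 h2].
  apply: (shifted_interval _ _ _ _ _ _ _ s0 mean_shiftE hl h1 h2).
have mX : measurable ((fun w => (T w - mean_T xi mu0 mu) / sd_T xi mu0 mu) @^-1` B).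
  by rewrite -[_ @^-1` _]setTI; apply: (measurable_normalized_T P n xi mu0 mu).
have h1 : fine (P ((fun w => (T w - mean_T xi mu0 mu) / sd_T xi mu0 mu) @^-1` B)) <=
    fine (P accept).
  apply: fine_le; [exact: fin_num_measure|exact: fin_num_measure|].
  by apply: le_measure => //; rewrite inE.
have A1 : 0 <= A + 1 by rewrite addr_ge0.
have := T_tv P n xi n0 gxi mu0 mu mu_ge0 (A + 1) A1 hE B mB.
rewrite ler_norml => /andP[h2 _].
suff h3 : l * 2 * phi (2 * A + l) <= fine (gam B).
  exact: (chain_le _ _ _ _ _ h2 h3 h1).
have cl : c - l < c + l by exact: itv_nonempty.
rewrite gauss_itvcc; last exact: ltW.
have [||y] := @MVT R Phi phi _ _ cl.
- by move=> y _; exact: is_derive_std_normal_cdf.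
- by apply: continuous_subspaceT; exact: continuous_std_normal_cdf.
rewrite in_itv/= => /andP[y1 y2] ->.
have -> : c + l - (c - l) = l * 2 by ring.
rewrite mulrC ler_wpM2r ?mulr_ge0 ?(ltW l0)//.
have yA : `|y| <= 2 * A + l.
  exact: (norm_in_itv _ _ _ _ cA y1 y2).
rewrite !phiE ler_wpM2l ?normal_peak_ge0// ler_expR lerN2 ler_pM2r//.
rewrite -(real_normK (num_real y)) ler_sqr ?nnegrE//.
by apply: le_trans yA.
Qed.

(** Chebyshev's inequality: acceptance forces the statistic far from its mean
    when the displacement exceeds the width of the acceptance interval. *)
Lemma accept_upper (c : R) : 0 < c -> 2 * (z * sd_T xi mu0 mu0) <= `|mean_shift| ->
  2 * c <= `|mean_shift| ->
  fine (P accept) <= sd_T xi mu0 mu ^+ 2 / c ^+ 2.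
Proof.
move=> c0 hz hc.
have mT : measurable_fun setT T by exact: measurable_T.
pose X : {RV P >-> R} := HB.pack T (isMeasurableFun.Build _ _ _ _ T mT).
have V0 : (0 <= 'V_P[X])%E by exact: variance_ge0.
have Vfin : 'V_P[X] \is a fin_num.
  have := sd_T_gt0 _ mu_ge0; rewrite /sd_T sqrtr_gt0.
  by rewrite -[fun w => _]/(X : Omega -> R); case: 'V_P[X] => //=; rewrite ltxx.
have sE : sd_T xi mu0 mu ^+ 2 = fine 'V_P[X] by rewrite sqr_sqrtr// fine_ge0.
have sub : accept `<=` [set w | c <= `|X w - fine 'E_P[X]|].
  move=> w /= hw; exact: (far_from_mean _ _ _ _ _ _ mean_shiftE hw hz hc).
have ch := chebyshev X c0.
have mB : measurable [set w | c <= `|X w - fine 'E_P[X]|].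
  pose b w := c <= `|X w - fine 'E_P[X]|.
  have mb : measurable_fun setT b.
    apply: measurable_fun_ler => //; apply: measurableT_comp => //.
    exact: measurable_funB.
  have -> : [set w | c <= `|X w - fine 'E_P[X]|] = setT `&` (b @^-1` [set true]).
    by rewrite setTI; apply/seteqP; split.
  exact: mb.
have h1 : (P accept <= (sd_T xi mu0 mu ^+ 2 / c ^+ 2)%:E)%E.
  apply: (le_trans (le_measure P _ _ sub)); rewrite ?inE//.
  apply: (le_trans ch); rewrite sE mulrC EFinM fineK//.
rewrite -lee_fin fineK//; exact: fin_num_measure.
Qed.

Lemma power_le (A l : R) : 0 <= A -> 0 < l -> `|mean_shift| <= A * Num.sqrt n%:R ->
  l * sd_T xi mu0 mu <= z * sd_T xi mu0 mu0 ->
  fine pw <= 1 - (l * 2 * phi (2 * A + l) - tv_cst (A + 1) / Num.sqrt n%:R).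
Proof.
move=> A0 l0 hD hl; rewrite power_fine lerD2l lerN2; exact: accept_lower.
Qed.

Lemma power_ge (c : R) : 0 < c -> 2 * (z * sd_T xi mu0 mu0) <= `|mean_shift| ->
  2 * c <= `|mean_shift| -> 1 - sd_T xi mu0 mu ^+ 2 / c ^+ 2 <= fine pw.
Proof.
move=> c0 hz hc; rewrite power_fine lerD2l lerN2; exact: accept_upper.
Qed.

End power.

Section power_rates.
Context {R : realType}.
Local Notation phi := (@normal_pdf R 0 1).

Let sd_ratio (z s s0 K N : R) : 0 < z -> 0 <= s -> 0 < s0 -> 0 < K ->
  s ^+ 2 <= K * N -> N / 2 <= s0 ^+ 2 -> z / Num.sqrt (2 * K) * s <= z * s0.
Proof.
move=> z0 s_ge0 s00 K0 h1 h2; have k0 : 0 < Num.sqrt (2 * K) by rewrite sqrtr_gt0 mulr_gt0.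
rewrite -mulrA ler_pM2l// mulrC ler_pdivrMr// -ler_sqr ?nnegrE ?mulr_ge0 ?(ltW s00) ?(ltW k0)//.
rewrite exprMn sqr_sqrtr ?mulr_ge0 ?(ltW K0)//.
apply: (le_trans h1); have : K * (N / 2) <= K * s0 ^+ 2 by rewrite ler_pM2l.
by move=> ?; lra.
Qed.

Let sqrt_eventually (t p : R) : 0 < t -> 0 < p -> exists N : nat, forall n : nat,
  (0 < n)%N -> (N <= n)%N -> t / Num.sqrt n%:R <= p.
Proof.
move=> t0 p0; have tp : 0 < t / p by rewrite divr_gt0.
exists (Num.bound ((t / p) ^+ 2)) => n n0 Nn.
have sn : 0 < Num.sqrt (n%:R : R) by rewrite sqrtr_gt0 ltr0n.
rewrite ler_pdivrMr// mulrC -ler_pdivrMr// -ler_sqr ?nnegrE ?(ltW sn) ?(ltW tp)//.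
rewrite sqr_sqrtr//; apply: le_trans (ltW (archi_boundP (sqr_ge0 _))) _.
by rewrite ler_nat.
Qed.

Let chebyshev_ratio (q A D s2 eps : R) : 1 <= q -> 1 <= A -> A * q <= D ->
  s2 <= 12 * q ^+ 2 + 8 * (D + q ^+ 2) -> 112 <= eps * A ->
  s2 / (D / 2) ^+ 2 <= eps.
Proof.
move=> q1 A1 hD hs hA.
have qD : q <= D by apply: le_trans hD; rewrite ler_peMl//; lra.
have AD : A <= D by apply: le_trans hD; rewrite ler_peMr//; lra.
have D0 : 0 < D by lra.
have h1 : A * q * q <= D * D by apply: ler_pM => //; [apply: mulr_ge0; lra|lra].
have h2 : A * D <= D * D by rewrite ler_pM2r.
have h3 : A * s2 <= A * (12 * q ^+ 2 + 8 * (D + q ^+ 2)) by rewrite ler_pM2l//; lra.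
have h4 : 112 * (D * D) <= eps * A * (D * D) by rewrite ler_pM2r// mulr_gt0.
rewrite ler_pdivrMr ?exprn_gt0 ?divr_gt0//.
have A0 : 0 < A by lra.
rewrite -(ler_pM2l A0).
have -> : A * (eps * (D / 2) ^+ 2) = eps * A * (D * D) / 4 by field.
have e3 : A * (12 * q ^+ 2 + 8 * (D + q ^+ 2)) = 20 * (A * q * q) + 8 * (A * D) by ring.
rewrite e3 in h3; lra.
Qed.

Let null_sd_le (q s z A D : R) : 0 <= q -> 0 <= s -> 0 < z -> s ^+ 2 <= 12 * q ^+ 2 ->
  8 * z <= A -> A * q <= D -> 2 * (z * s) <= D.
Proof.
move=> q0 s0 z0 hs Az; apply: le_trans.
have sq : s <= 4 * q.
  rewrite -ler_sqr ?nnegrE ?mulr_ge0//; apply: (le_trans hs).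
  by have := sqr_ge0 q; rewrite exprMn; lra.
have h1 : z * s <= z * (4 * q) by rewrite ler_pM2l.
have h2 : 8 * z * q <= A * q by rewrite ler_wpM2r.
by move: h1 h2; lra.
Qed.

Let var_le (s2 m e A : R) : s2 <= 12 * m + 8 * e -> e <= (A + 1) * m ->
  s2 <= (20 + 8 * A) * m.
Proof. by move=> h1 h2; lra. Qed.

Let half_loss (u v p : R) : v <= p / 2 -> u <= 1 - (p - v) -> u <= 1 - p / 2.
Proof. by move=> h1 h2; lra. Qed.

(** When the displacement is at most [A * sqrt n], the squared distance to the
    null is of order [n]; hence the standard deviations under the null and
    under the alternative are both of order [sqrt n] and the normal
    approximation holds under the alternative. *)
Lemma power_bounded_away (alpha A : R) : 0 < alpha < 1 -> 0 <= A ->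
  exists eps : R, 0 < eps /\ exists N : nat,
  forall (n : nat) (d : measure_display) (Omega : measurableType d)
    (P : probability Omega R) (xi : 'I_n -> {RV P >-> R}) (mu0 mu : 'rV[R]_n),
  (0 < n)%N -> (N <= n)%N -> std_gaussian xi -> orthant R n mu0 -> orthant R n mu ->
  `|mean_shift n mu0 mu| <= A * Num.sqrt n%:R ->
  fine (power_ts xi alpha mu0 mu) <= 1 - eps.
Proof.
move=> al A0; set z := z_ (alpha / 2).
have z0 : 0 < z by move: al => /andP[? ?]; apply: z_gt0; apply/andP; split; lra.
have K0 : 0 < 20 + 8 * A by lra.
have AA : 0 <= A + 1 by lra.
(* The ratio of the standard deviations is at most this square root. *)
pose l := z / Num.sqrt (2 * (20 + 8 * A)).
have l0 : 0 < l by rewrite divr_gt0// sqrtr_gt0 mulr_gt0.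
pose p := l * 2 * phi (2 * A + l).
have p0 : 0 < p by rewrite mulr_gt0 ?phi_gt0// mulr_gt0.
have p20 : 0 < p / 2 by rewrite divr_gt0.
exists (p / 2); split => //.
have [N hN] := sqrt_eventually _ _ (tv_cst_gt0 _ AA) p20; exists N.
move=> n d Omega P xi mu0 mu n0 Nn gxi h0 h1 hD.
have hE := enorm_sqr_le_bound n n0 mu0 mu h0 h1 _ A0 hD.
have /andP[_ su] := sd_T_bounds P n xi n0 gxi mu0 mu h1.
have /andP[sl _] := sd_T_null_bounds P n xi n0 gxi mu0 h0.
have s0 := sd_T_gt0 P n xi n0 gxi mu0 mu h1.
have s00 := sd_T_gt0 P n xi n0 gxi mu0 mu0 h0.
have su' : sd_T xi mu0 mu ^+ 2 <= (20 + 8 * A) * n%:R.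
  exact: (var_le _ _ _ _ su hE).
have hl : l * sd_T xi mu0 mu <= z * sd_T xi mu0 mu0.
  exact: (sd_ratio _ _ _ _ n%:R z0 (ltW s0) s00 K0 su' sl).
have := power_le P n xi n0 gxi mu0 mu h0 h1 alpha A l A0 l0 hD hl.
exact: half_loss (hN n n0 Nn).
Qed.

(** The variance under the alternative is at most of order [n] plus the
    displacement; both are negligible with respect to the square of the
    displacement when the latter is a large multiple of [sqrt n]. *)
Lemma power_close_to_one (alpha eps : R) : 0 < alpha < 1 -> 0 < eps ->
  exists A : R,
  forall (n : nat) (d : measure_display) (Omega : measurableType d)
    (P : probability Omega R) (xi : 'I_n -> {RV P >-> R}) (mu0 mu : 'rV[R]_n),
  (0 < n)%N -> std_gaussian xi -> orthant R n mu0 -> orthant R n mu ->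
  A * Num.sqrt n%:R <= `|mean_shift n mu0 mu| ->
  1 - eps <= fine (power_ts xi alpha mu0 mu).
Proof.
move=> al eps0; set z := z_ (alpha / 2).
have z0 : 0 < z by move: al => /andP[? ?]; apply: z_gt0; apply/andP; split; lra.
have i0 : 0 < 112 / eps by rewrite divr_gt0.
pose A := 1 + 8 * z + 112 / eps.
have A1 : 1 <= A by rewrite /A; lra.
have Az : 8 * z <= A by rewrite /A; lra.
have Ae : 112 <= eps * A by rewrite mulrC -ler_pdivrMr// /A; lra.
exists A => n d Omega P xi mu0 mu n0 gxi h0 h1 hD.
have q1 : 1 <= Num.sqrt (n%:R : R) by rewrite -[leLHS]sqrtr1; apply: ler_wsqrtr; rewrite ler1n.
have qq : Num.sqrt (n%:R : R) ^+ 2 = n%:R by rewrite sqr_sqrtr.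
have hE := enorm_sqr_le_shift n mu0 mu h0 h1.
have /andP[_ su] := sd_T_bounds P n xi n0 gxi mu0 mu h1.
have /andP[_ sl] := sd_T_null_bounds P n xi n0 gxi mu0 h0.
have s00 := sd_T_gt0 P n xi n0 gxi mu0 mu0 h0.
have pw := power_ge P n xi n0 gxi mu0 mu h0 h1 alpha (`|mean_shift n mu0 mu| / 2).
have {}su : sd_T xi mu0 mu ^+ 2 <= 12 * Num.sqrt (n%:R : R) ^+ 2 +
    8 * (`|mean_shift n mu0 mu| + Num.sqrt (n%:R : R) ^+ 2).
  rewrite qq; apply: (le_trans su); rewrite lerD2l ler_pM2l//.
have hz : 2 * (z * sd_T xi mu0 mu0) <= `|mean_shift n mu0 mu|.
  by apply: (null_sd_le _ _ _ _ _ _ (ltW s00) z0 _ Az hD); [exact: le_trans q1|rewrite qq].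
have h2 := chebyshev_ratio _ _ _ _ _ q1 A1 hD su Ae.
apply: le_trans (pw _ hz _); first by rewrite lerD2l lerN2.
  have D0 := lt_le_trans (mulr_gt0 (lt_le_trans ltr01 A1) (lt_le_trans ltr01 q1)) hD.
  by apply: divr_gt0; [exact: D0|exact: ltr0Sn].
by rewrite mulrCA mulfV ?mulr1 ?pnatr_eq0.
Qed.

End power_rates.

Section power_limit.
Context {R : realType}.
Variables (alpha : R) (d : nat -> measure_display) (Omega : forall n, measurableType (d n)).
Variables (P : forall n, probability (Omega n) R) (xi : forall n, 'I_n -> {RV (P n) >-> R}).
Variables mu0 mu : forall n, 'rV[R]_n.
Hypotheses (alpha01 : 0 < alpha < 1) (gxi : forall n, std_gaussian (xi n)).
Hypotheses (mu0_ge0 : forall n, orthant R n (mu0 n)) (mu_ge0 : forall n, orthant R n (mu n)).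

Local Notation power n := (power_ts (xi n) alpha (mu0 n) (mu n)).
Local Notation shift n := (mean_shift n (mu0 n) (mu n)).

Let near_gt0 : \forall n \near \oo, (0 < n)%N.
Proof. by exists 1%N. Qed.

(** The power can only tend to one if, for every [A], the displacement
    eventually leaves the range of size [A * sqrt n] where the power is bounded
    away from one. *)
Lemma power_limitP : power n @[n --> \oo] --> 1%E <->
  `|shift n| / Num.sqrt n%:R @[n --> \oo] --> +oo.
Proof.
split.
  move=> /fine_cvgP[_ cf]; apply/cvgryPge => A.
  have A0 : 0 <= Num.max A 0 by rewrite le_max lexx orbT.
  have [eps [eps0 [N hN]]] := power_bounded_away _ _ alpha01 A0.
  move/cvgrPdist_lt : cf => /(_ eps eps0) cf.
  near=> n.
  have n0 : (0 < n)%N by near: n.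
  have Nn : (N <= n)%N by near: n; exact: nbhs_infty_ge.
  have pn : `|1 - fine (power n)| < eps by near: n.
  have sn : 0 < Num.sqrt (n%:R : R) by rewrite sqrtr_gt0 ltr0n.
  rewrite ler_pdivlMr// leNgt; apply/negP => small.
  have := hN n _ _ _ (xi n) _ _ n0 Nn (gxi n) (mu0_ge0 n) (mu_ge0 n) (le_trans (ltW small) _).
  have le1 : A * Num.sqrt n%:R <= Num.max A 0 * Num.sqrt n%:R.
    by rewrite ler_pM2r// le_max lexx.
  move=> /(_ le1) up; move: pn; rewrite ltNge => /negP; apply.
  apply: le_trans (ler_norm _); rewrite lerBrDr -lerBrDl.
  exact: up.
move=> /cvgryPge hD; apply/fine_cvgP; split.
  near=> n; have n0 : (0 < n)%N by near: n.
  by have [] := power_fin_num_le1 (P n) n (xi n) n0 (gxi n) _ _ (mu0_ge0 n) (mu_ge0 n) alpha.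
apply/cvgrPdist_le => eps eps0.
have [A hA] := power_close_to_one _ _ alpha01 eps0.
near=> n; have n0 : (0 < n)%N by near: n.
have sn : 0 < Num.sqrt (n%:R : R) by rewrite sqrtr_gt0 ltr0n.
have big : A * Num.sqrt n%:R <= `|shift n|.
  by rewrite -ler_pdivlMr//; near: n; exact: hD.
have lo := hA n _ _ _ (xi n) _ _ n0 (gxi n) (mu0_ge0 n) (mu_ge0 n) big.
have [_ up] := power_fin_num_le1 (P n) n (xi n) n0 (gxi n) _ _ (mu0_ge0 n) (mu_ge0 n) alpha.
by rewrite ger0_norm ?subr_ge0// lerBlDr -lerBlDl.
Unshelve. all: by end_near. Qed.

End power_limit.

Theorem theorem4p1 (R : realType) :
  (* (1): total variation bound under the null *)
  (exists C : R, 0 < C /\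
    forall (n : nat) (d : measure_display) (Omega : measurableType d)
      (P : probability Omega R) (xi : 'I_n -> {RV P >-> R})
      (mu0 : 'rV[R]_n),
      (0 < n)%N -> std_gaussian xi -> orthant R n mu0 ->
      (dTV (pushforward P (fun w =>
              (T_plus mu0 (obs xi mu0 w) - mean_T xi mu0 mu0)
                / sd_T xi mu0 mu0)%R)
           (normal_prob 0 1)
        <= (C / Num.sqrt n%:R)%R%:E)%E)
  /\
  (* (1): size of the two-sided test *)
  (forall alpha : R, 0 < alpha < 1 ->
    exists C : R, 0 < C /\
    forall (n : nat) (d : measure_display) (Omega : measurableType d)
      (P : probability Omega R) (xi : 'I_n -> {RV P >-> R})
      (mu0 : 'rV[R]_n),
      (0 < n)%N -> std_gaussian xi -> orthant R n mu0 ->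
      (`|power_ts xi alpha mu0 mu0 - alpha%:E| <= (C / Num.sqrt n%:R)%R%:E)%E)
  /\
  (* (2): power characterization *)
  (forall (alpha : R) (d : nat -> measure_display)
     (Omega : forall n, measurableType (d n))
     (P : forall n, probability (Omega n) R)
     (xi : forall n, 'I_n -> {RV (P n) >-> R})
     (mu0 mu : forall n, 'rV[R]_n),
     0 < alpha < 1 ->
     (forall n, std_gaussian (xi n)) ->
     (forall n, orthant R n (mu0 n)) ->
     (forall n, orthant R n (mu n)) ->
     (power_ts (xi n) alpha (mu0 n) (mu n) @[n --> \oo] --> 1%E)
     <->
     (`|\sum_(i < n) (Splus (mu n 0 i) - Splus (mu0 n 0 i))
          + enorm (mu n - mu0 n) ^+ 2| / Num.sqrt n%:R
        @[n --> \oo] --> +oo))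
  /\
  (* properties of Splus on [0, +oo[ *)
  [/\ {in `[0, +oo[ &, {homo @Splus R : x y / x < y}},
      convex_function (`[0, +oo[%classic : set R^o)
        (fun x : R^o => - Splus x : R^o),
      [bounded Splus x : R^o | x in (`[0, +oo[%classic : set R)]
    & Splus (0 : R) = 0].
Proof.
have c0 : 0 < tv_cst (0 : R) by exact: tv_cst_gt0.
split; [|split; [|split]].
- exists (tv_cst 0); split => // n d Omega P xi mu0 n0 gxi h0.
  exact: (null_dTV P n xi n0 gxi mu0 h0).
- move=> alpha al; exists (tv_cst 0); split => // n d Omega P xi mu0 n0 gxi h0.
  exact: (null_level P n xi n0 gxi mu0 h0 alpha al).
- move=> alpha d Omega P xi mu0 mu al gxi h0 h1.
  exact: (power_limitP alpha d Omega P xi mu0 mu al gxi h0 h1).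
- split; [exact: Splus_increasing|exact: Splus_convex|exact: Splus_bounded|exact: Splus0].
Qed.
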